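(* Assume (l1)–(l6). Fix $\bar\omega\in\Omega$ and consider the equations $$x'=\mathfrak c(\bar\omega\cdot t)+\mathfrak d(\bar\omega\cdot t)\,x+\mathfrak g^-(\bar\omega\cdot t,x)+\lambda \qquad (E_\lambda)$$ with maximal solutions $x_\lambda(t,s,x)$, $x_\lambda(s,s,x)=x$, defined on $(\alpha_{s,x,\lambda},\beta_{s,x,\lambda})$; let $r^-_\lambda$ and $a^-_\lambda$ denote the lower and upper bounded solutions of $(E_\lambda)$ when bounded solutions exist. Then: (i) there is $\lambda^{\bar\omega}_-\in\mathbb R$ such that $(E_\lambda)$ has two uniformly separated hyperbolic solutions $r^-_\lambda<a^-_\lambda$, $r^-_\lambda$ repulsive and $a^-_\lambda$ attractive, for $\lambda>\lambda^{\bar\omega}_-$; bounded solutions but neither hyperbolic solutions nor uniformly separated bounded solutions for $\lambda=\lambda^{\bar\omega}_-$; and no bounded solutions for $\lambda<\lambda^{\bar\omega}_-$; (ii) the maps $(\lambda^{\bar\omega}_-,\infty)\to C(\mathbb R,\mathbb R)$, $\lambda\mapsto-r^-_\lambda$ and $\lambda\mapsto a^-_\lambda$, are continuous for the uniform topology and strictly increasing; $a^-_{\lambda^{\bar\omega}_-}=\lim_{\lambda\to(\lambda^{\bar\omega}_-)^+}a^-_\lambda$ and $r^-_{\lambda^{\bar\omega}_-}=\lim_{\lambda\to(\lambda^{\bar\omega}_-)^+}r^-_\lambda$ pointwise; and $\lim_{\lambda\to\infty}a^-_\lambda=-\lim_{\lambda\to\infty}r^-_\lambda=\infty$ uniformly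 on $\mathbb R$; (iii) $\lambda^{\bar\omega}_-=\lambda^{\omega}_-$ for every $\omega\in\Omega$ with $\Omega_\omega=\Omega_{\bar\omega}$ (orbit closures); (iv) if $\mu^{\bar\omega}_-:=\inf\{\lambda\in\mathbb R:\mathfrak b_\lambda(\bar\omega\cdot t)\le0\text{ for all }t\in\mathbb R\}$, then $\mu^{\bar\omega}_->\lambda^{\bar\omega}_-$ and $r^-_\lambda(t)=\mathfrak b_\lambda(\bar\omega\cdot t)$ for all $t$ whenever $\lambda\ge\mu^{\bar\omega}_-$; (v) if $\lambda\ge\lambda^{\bar\omega}_-$, then $\lim_{t\to\alpha_{s,x,\lambda}^+}x_\lambda(t,s,x)=\infty$ iff $x>a^-_\lambda(s)$, and $\lim_{t\to\beta_{s,x,\lambda}^-}x_\lambda(t,s,x)=-\infty$ iff $x<r^-_\lambda(s)$; if $\lambda>\lambda^{\bar\omega}_-$, then $\lim_{t\to-\infty}|x_\lambda(t,s,x)-r^-_\lambda(t)|=0$ iff $x<a^-_\lambda(s)$, and $\lim_{t\to\infty}|x_\lambda(t,s,x)-a^-_\lambda(t)|=0$ iff $x>r^-_\lambda(s)$; if $\lambda<\lambda^{\bar\omega}_-$, then for every $(s,x)$, $\lim_{t\to\alpha_{s,x,\lambda}^+}x_\lambda(t,s,x)=\infty$ or $\lim_{t\to\beta_{s,x,\lambda}^-}x_\lambda(t,s,x)=-\infty$.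
   Context: $(\Omega,\sigma)$ is a continuous global flow on a compact metric space, $\omega\cdot t:=\sigma(t,\omega)$; $\mathfrak M_{\rm erg}(\Omega,\sigma)$ is the set of $\sigma$-ergodic invariant Borel probability measures; $C^{0,1}(\Omega\times\mathbb R,\mathbb R)$ is the set of continuous maps with continuous derivative in the second variable. Hypotheses: (l1) $\mathfrak c,\mathfrak d\in C(\Omega,\mathbb R)$, $\mathfrak g^-\in C^{0,1}(\Omega\times\mathbb R,\mathbb R)$; (l2) $\int_\Omega\mathfrak d\,dm>0$ for all $m\in\mathfrak M_{\rm erg}$; (l3) $\lim_{x\to\infty}(\mathfrak d(\omega)x+\mathfrak g^-(\omega,x))=-\infty$ uniformly on $\Omega$; (l4) $\mathfrak g^-\le0$, $\mathfrak g^-(\omega,x)=0$ for $x\le0$, and $m(\{\omega:\mathfrak g^-(\omega,x)<0\ \forall x>0\})=1$ for all $m\in\mathfrak M_{\rm erg}$; (l5) $m(\{\omega:x\mapsto\mathfrak g^-(\omega,x)\text{ concave}\})=1$ for all $m\in\mathfrak M_{\rm erg}$; (l6) $m(\{\omega:x\mapsto\mathfrak g^-_x(\omega,x)\text{ strictly decreasing on }\mathcal J\})>0$ for every compact interval $\mathcal J\subset[0,\infty)$ and $m\in\mathfrak M_{\rm erg}$. $\mathfrak b_\lambda(\omega):=-\int_0^\infty\exp(\int_s^0\mathfrak d(\omega\cdot l)dl)(\mathfrak c(\omega\cdot s)+\lambda)\,ds$ (the unique bounded equilibrium of $x'=\mathfrak c(\omega\cdot t)+\mathfrak d(\omega\cdot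 t)x+\lambda$). A bounded solution $b$ of $x'=f(t,x)$ is attractive (resp. repulsive) hyperbolic if there are $k\ge1,\gamma>0$ with $\exp\int_s^t f_x(r,b(r))dr\le ke^{-\gamma(t-s)}$ for $t\ge s$ (resp. $\le ke^{\gamma(t-s)}$ for $t\le s$); two bounded solutions are uniformly separated if $\inf_t|b_1(t)-b_2(t)|>0$. For $\omega\in\Omega$, $\Omega_\omega$ denotes the closure of $\{\omega\cdot t:t\in\mathbb R\}$ and $\lambda^\omega_-$ the value provided by (i) for the point $\omega$. *)

(* Defs.v *)
From HB Require Import structures.
From mathcomp Require Import all_boot all_order all_algebra.
From mathcomp Require Import all_classical all_reals all_analysis.
Set Implicit Arguments. Unset Strict Implicit. Unset Printing Implicit Defensive.
Import Order.TTheory GRing.Theory Num.Theory.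
Import numFieldNormedType.Exports.
Local Open Scope classical_set_scope.
Local Open Scope ring_scope.

Notation Borel T := (g_sigma_algebraType (@open T)).

Section Defs.
Context {R : realType}.

Definition is_flow (Om : ptopologicalType) (sig : R -> Om -> Om) : Prop :=
  continuous (fun p : R * Om => sig p.1 p.2) /\
  (forall w, sig 0 w = w) /\
  (forall t s w, sig (t + s) w = sig t (sig s w)).

Definition erg_measure (Om : ptopologicalType) (sig : R -> Om -> Om)
    (m : probability (Borel Om) R) : Prop :=
  (forall t (A : set (Borel Om)), measurable A ->
      m ((sig t) @^-1` A) = m A) /\
  (forall (A : set (Borel Om)), measurable A ->
      (forall t, (sig t) @^-1` A = A) -> m A = 0%E \/ m A = 1%E).

Definition orbit_closure (Om : ptopologicalType) (sig : R -> Om -> Om) (w : Om) :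
  set Om := closure (range (fun t => sig t w)).

Definition concave (h : R -> R) : Prop :=
  forall x y t, 0 <= t <= 1 -> t * h x + (1 - t) * h y <= h (t * x + (1 - t) * y).

(** Riemann-type integral over [s, t] (s <= t) as a Lebesgue integral. *)
Definition Rint (s t : R) (h : R -> R) : R :=
  Rintegral lebesgue_measure `[s, t]%classic h.

Definition vfield (Om : Type) (sig : R -> Om -> Om) (c d : Om -> R) (g : Om -> R -> R)
    (w : Om) (lam : R) : R -> R -> R :=
  fun t x => c (sig t w) + d (sig t w) * x + g (sig t w) x + lam.

Definition b_eq (Om : Type) (sig : R -> Om -> Om) (c d : Om -> R) (lam : R) (w : Om) : R :=
  - Rintegral lebesgue_measure `[0, +oo[%classic
      (fun s => expR (- Rint 0 s (fun l => d (sig l w))) * (c (sig s w) + lam)).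

(** u solves x' = f(t,x) on the set I (meant to be an open interval). *)
Definition is_solution_on (f : R -> R -> R) (I : set R) (u : R -> R) : Prop :=
  forall t, I t -> is_derive t 1 u (f t (u t)).

Definition open_int (a b : \bar R) : set R := [set t | (a < t%:E < b)%E].

Definition is_maximal_solution (f : R -> R -> R) (s x : R) (a b : \bar R) (u : R -> R) : Prop :=
  (a < s%:E < b)%E /\ u s = x /\ is_solution_on f (open_int a b) u /\
  (forall (a' b' : \bar R) (v : R -> R), (a' < s%:E < b')%E -> v s = x ->
     is_solution_on f (open_int a' b') v -> (a <= a')%E /\ (b' <= b)%E).

Definition bounded_solution (f : R -> R -> R) (u : R -> R) : Prop :=
  is_solution_on f setT u /\ exists M, forall t, `|u t| <= M.

Definition lower_bounded_solution (f : R -> R -> R) (u : R -> R) : Prop :=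
  bounded_solution f u /\ forall v, bounded_solution f v -> forall t, u t <= v t.

Definition upper_bounded_solution (f : R -> R -> R) (u : R -> R) : Prop :=
  bounded_solution f u /\ forall v, bounded_solution f v -> forall t, v t <= u t.

Definition fx (f : R -> R -> R) (u : R -> R) : R -> R := fun r => derive1 (f r) (u r).

Definition attractive_hyperbolic (f : R -> R -> R) (u : R -> R) : Prop :=
  exists k gam, 1 <= k /\ 0 < gam /\
    forall s t, s <= t -> expR (Rint s t (fx f u)) <= k * expR (- (gam * (t - s))).

(* for t <= s, int_s^t = - int_[t,s] *)
Definition repulsive_hyperbolic (f : R -> R -> R) (u : R -> R) : Prop :=
  exists k gam, 1 <= k /\ 0 < gam /\
    forall s t, t <= s -> expR (- Rint t s (fx f u)) <= k * expR (gam * (t - s)).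

Definition hyperbolic (f : R -> R -> R) (u : R -> R) : Prop :=
  attractive_hyperbolic f u \/ repulsive_hyperbolic f u.

Definition uniformly_separated (u v : R -> R) : Prop :=
  exists e, 0 < e /\ forall t, e <= `|u t - v t|.

Definition prop_i (f : R -> R -> R -> R) (l0 : R) (r a : R -> R -> R) : Prop :=
  (forall lam, l0 <= lam ->
     lower_bounded_solution (f lam) (r lam) /\ upper_bounded_solution (f lam) (a lam)) /\
  (forall lam, l0 < lam ->
     (forall t, r lam t < a lam t) /\ uniformly_separated (r lam) (a lam) /\
     repulsive_hyperbolic (f lam) (r lam) /\ attractive_hyperbolic (f lam) (a lam)) /\
  ((forall u, bounded_solution (f l0) u -> ~ hyperbolic (f l0) u) /\
   (forall u v, bounded_solution (f l0) u -> bounded_solution (f l0) v ->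
      ~ uniformly_separated u v)) /\
  (forall lam, lam < l0 -> forall u, ~ bounded_solution (f lam) u).

Definition blowup_left (a b : \bar R) (u : R -> R) : Prop :=
  forall M, exists t0, (a < t0%:E < b)%E /\
    forall t, (a < t%:E)%E -> t < t0 -> M < u t.

Definition blowup_right (a b : \bar R) (u : R -> R) : Prop :=
  forall M, exists t0, (a < t0%:E < b)%E /\
    forall t, t0 < t -> (t%:E < b)%E -> u t < - M.

(** u is defined on (-oo, ...) and lim_{t -> -oo} |u t - v t| = 0 *)
Definition conv_minus_infty (a b : \bar R) (u v : R -> R) : Prop :=
  a = -oo%E /\ forall e, 0 < e -> exists T, (T%:E < b)%E /\
    forall t, t < T -> `|u t - v t| < e.

(** u is defined on (..., +oo) and lim_{t -> +oo} |u t - v t| = 0 *)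
Definition conv_plus_infty (a b : \bar R) (u v : R -> R) : Prop :=
  b = +oo%E /\ forall e, 0 < e -> exists T, (a < T%:E)%E /\
    forall t, T < t -> `|u t - v t| < e.

End Defs.

(* Main.v *)
Require Import Defs.
From HB Require Import structures.
From mathcomp Require Import all_boot all_order all_algebra.
From mathcomp Require Import all_classical all_reals all_analysis.
From mathcomp Require Import measurable_realfun.
From mathcomp Require Import ring lra.
Set Implicit Arguments. Unset Strict Implicit. Unset Printing Implicit Defensive.
Import Order.TTheory GRing.Theory Num.Theory.
Import numFieldNormedType.Exports.
Local Open Scope classical_set_scope.
Local Open Scope ring_scope.

(** The hypotheses on ergodic measures enter through uniform time averages: if a continuous
    function has negative integral against every ergodic measure, then its averages along all
    orbits are uniformly negative. Otherwise the functionals obtained from the averages contain,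
    by Zorn's lemma, an extremal invariant positive functional with nonnegative value, and the
    measure representing it is ergodic.

    Consequently [x' = d x] is uniformly repelling, so that the linear equation has a unique
    bounded solution, and the failure of concavity of [g] has negligible averages along every
    orbit. The scalar equation on an orbit is thus concave up to an error absorbed by any
    exponential rate. Coercivity bounds the bounded solutions; comparison shows that the set of
    parameters with bounded solutions is a closed half-line, whose left endpoint is the
    bifurcation value. For two bounded solutions at distance [e], strict concavity on a set of
    positive measure makes the upper one attractive: along each orbit the logarithmic derivative
    of the gap exceeds the linearisation at the upper solution by a quantity with positive
    average. The region where both solutions are below the threshold and [g] is inactive is
    controlled by a Lyapunov function, the gap being repelled there. The reflection
    [(t, x) -> (-t, -x)] exchanges the lower solution with the upper one, so only one of them
    has to be studied. *)

Local Notation Rint := Defs.Rint.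

(** * Scalar calculus *)

Section Calculus.
Context {R : realType}.
Implicit Types (u v f h H : R -> R) (s t x : R).

Lemma is_derive_cont u x du : is_derive x 1 u du -> {for x, continuous u}.
Proof.
by move=> Hu; apply: differentiable_continuous; apply/derivable1_diffP.
Qed.

Lemma nearR (x e : R) (P : R -> Prop) : 0 < e -> (forall y, `|y - x| < e -> P y) ->
  \forall y \near x, P y.
Proof.
move=> e0 H; apply/nbhs_ballP; exists e => //= y; rewrite /ball/= distrC; exact: H.
Qed.

Lemma is_derive_near u v x e du : 0 < e -> (forall y, `|y - x| < e -> u y = v y) ->
  is_derive x 1 u du -> is_derive x 1 v du.
Proof.
by move=> e0 H Hu; apply: (near_eq_is_derive _ Hu); apply: (nearR e0).
Qed.

Lemma is_derive_ext u v x du : (forall y, u y = v y) -> is_derive x 1 v du ->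
  is_derive x 1 u du.
Proof. by move=> E; rewrite (_ : u = v) //; apply/funext. Qed.

Lemma is_derive_addf u v x du dv : is_derive x 1 u du -> is_derive x 1 v dv ->
  is_derive x 1 (fun t => u t + v t) (du + dv).
Proof. by move=> Hu Hv; apply: is_deriveD. Qed.

Lemma is_derive_oppf u x du : is_derive x 1 u du ->
  is_derive x 1 (fun t => - u t) (- du).
Proof. by move=> Hu; apply: is_deriveN. Qed.

Lemma is_derive_subf u v x du dv : is_derive x 1 u du -> is_derive x 1 v dv ->
  is_derive x 1 (fun t => u t - v t) (du - dv).
Proof. by move=> Hu Hv; apply: is_deriveB. Qed.

Lemma is_derive_mulf u v x du dv : is_derive x 1 u du -> is_derive x 1 v dv ->
  is_derive x 1 (fun t => u t * v t) (u x * dv + v x * du).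
Proof. by move=> Hu Hv; apply: is_deriveM. Qed.

Lemma is_derive_cstf (k : R) x : is_derive x 1 (fun _ : R => k) 0.
Proof. exact: is_derive_cst. Qed.

Lemma is_derive_idf x : is_derive x 1 (fun t : R => t) 1.
Proof. exact: is_derive_id. Qed.

Lemma is_derive_compf u v x du dv :
  is_derive (v x) 1 u du -> is_derive x 1 v dv ->
  is_derive x 1 (fun t => u (v t)) (dv * du).
Proof.
by move=> Hu Hv; rewrite mulrC; exact: is_derive1_comp.
Qed.

Lemma is_derive_scalef (k : R) u x du : is_derive x 1 u du ->
  is_derive x 1 (fun t => k * u t) (k * du).
Proof.
move=> Hu; apply: (is_derive_eq (is_derive_mulf (is_derive_cstf k x) Hu)).
by rewrite mulr0 addr0.
Qed.

Lemma is_derive_expf u x du : is_derive x 1 u du ->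
  is_derive x 1 (fun t => expR (u t)) (du * expR (u x)).
Proof. by move=> Hu; apply: is_derive_compf => //; exact: is_derive_expR. Qed.

Lemma is_derive_lnf u x du : 0 < u x -> is_derive x 1 u du ->
  is_derive x 1 (fun t => ln (u t)) (du / u x).
Proof. by move=> u0 Hu; apply: is_derive_compf => //; exact: is_derive1_ln. Qed.

Lemma is_derive_refl u x du : is_derive (- x) 1 u du ->
  is_derive x 1 (fun t => u (- t)) (- du).
Proof.
move=> Hu; apply: is_derive_eq
  (is_derive_compf (v := fun t => - t) Hu (is_derive_oppf (is_derive_idf x))) _.
by rewrite mulN1r.
Qed.

Lemma is_derive_shiftf u x k du : is_derive (x + k) 1 u du ->
  is_derive x 1 (fun t => u (t + k)) du.
Proof.
move=> Hu; apply: is_derive_eq (is_derive_compf (v := fun t => t + k) Hu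
  (is_derive_addf (is_derive_idf x) (is_derive_cstf k x))) _.
by rewrite addr0 mul1r.
Qed.

Lemma deriv_ge0_le u (du : R -> R) s t : s <= t ->
  (forall r, s <= r <= t -> is_derive r 1 u (du r)) ->
  (forall r, s <= r <= t -> 0 <= du r) -> u s <= u t.
Proof.
move=> st Hu du0.
have [||c /[!in_itv]/= cst E] := @MVT_segment _ u du s t st.
- by move=> r /[!in_itv]/= /andP[sr rt]; apply: Hu; rewrite !ltW.
- apply: continuous_in_subspaceT => r; rewrite inE/= in_itv/= => rst.
  exact: is_derive_cont (Hu _ rst).
by rewrite -subr_ge0 E mulr_ge0 ?du0 ?subr_ge0.
Qed.

Lemma deriv_le u v (du dv : R -> R) s t : s <= t ->
  (forall r, s <= r <= t -> is_derive r 1 u (du r)) ->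
  (forall r, s <= r <= t -> is_derive r 1 v (dv r)) ->
  (forall r, s <= r <= t -> du r <= dv r) -> u t - u s <= v t - v s.
Proof.
move=> st Hu Hv duv.
suff : v s - u s <= v t - u t by lra.
apply: (@deriv_ge0_le (fun r => v r - u r) (fun r => dv r - du r)) => // r rst.
  exact: is_derive_subf (Hv r rst) (Hu r rst).
by rewrite subr_ge0 duv.
Qed.

Lemma MVT_point u (du : R -> R) x y : x < y -> (forall r : R, is_derive r 1 u (du r)) ->
  exists2 c, x < c < y & u y - u x = du c * (y - x).
Proof.
move=> xy Hu; have [|c /[!in_itv]/= cst E] := @MVT _ u du x y xy (fun r _ => Hu r).
  by apply: continuous_subspaceT => r; exact: is_derive_cont.
by exists c.
Qed.

(* [(max x 0)^2] is C^1: this makes one-sided comparison a Gronwall argument. *)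
Lemma is_derive_pos_sqr x :
  is_derive x 1 (fun y : R => Num.max y 0 ^+ 2) (2 * Num.max x 0).
Proof.
have [x0|x0|->] := ltgtP x 0.
- rewrite mulr0; have e0 : 0 < - x by rewrite oppr_gt0.
  apply: (is_derive_near (u := fun=> 0) e0) (is_derive_cstf 0 x).
  move=> y; rewrite ltr_norml => /andP[h1 h2].
  by rewrite max_r ?expr0n//; lra.
- apply: (is_derive_near (u := fun y => y * y) x0).
    move=> y; rewrite ltr_norml => /andP[h1 h2].
    by rewrite max_l ?expr2//; lra.
  apply: is_derive_eq (is_derive_mulf (is_derive_idf x) (is_derive_idf x)) _.
  by ring.
- rewrite mulr0; apply/is_derive1_caratheodory.
  exists (fun y => if 0 < y then y else 0); split => [z|/=|]; last by rewrite ltxx.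
    rewrite maxxx expr0n/= !subr0.
    by case: ltP => h; rewrite ?expr2 ?expr0n ?mul0r.
  apply/cvgrPdist_lt => e e0; rewrite ltxx; apply: (nearR e0) => y.
  by rewrite sub0r normrN subr0; case: ifP => // _ _; rewrite normr0.
Qed.

Lemma cont_ext u v : (forall x, u x = v x) -> continuous v -> continuous u.
Proof. by move=> E; rewrite (_ : u = v) //; apply/funext. Qed.

Lemma primitive_bounded h s : continuous h -> forall t, s < t ->
  is_derive t 1 (Rint s ^~ h) (h t).
Proof.
move=> hc t st.
have tt : t < t + 1 by rewrite ltrDl.
have hi : lebesgue_measure.-integrable `[s, t + 1] (EFin \o h).
  apply: continuous_compact_integrable; first exact: segment_compact.
  exact: continuous_subspaceT.
have [dF dE] := continuous_FTC1_closed tt hi st (hc t).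
by rewrite -dE derive1E; apply: derivableP.
Qed.

Lemma Rint_primitive h H s t : s <= t -> continuous h ->
  (forall r, s <= r <= t -> is_derive r 1 H (h r)) -> Rint s t h = H t - H s.
Proof.
rewrite le_eqVlt => /predU1P[<-|st] hc Hd.
  by rewrite subrr /Rint set_itv1 Rintegral_set1.
rewrite /Rint /Rintegral (@continuous_FTC2 _ h H s t)//.
- exact: continuous_subspaceT.
- split.
  + move=> r /[!in_itv]/= /andP[sr rt].
    have Hr : is_derive r 1 H (h r) by apply: Hd; rewrite !ltW.
    exact: ex_derive.
  + apply: cvg_at_right_filter; apply: (is_derive_cont (Hd s _)).
    by rewrite lexx ltW.
  + apply: cvg_at_left_filter; apply: (is_derive_cont (Hd t _)).
    by rewrite lexx ltW.
- move=> r /[!in_itv]/= /andP[sr rt].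
  have Hr : is_derive r 1 H (h r) by apply: Hd; rewrite !ltW.
  by rewrite derive1E derive_val.
Qed.

Definition primitive h t : R := if 0 <= t then Rint 0 t h else - Rint t 0 h.

Lemma Rint_chasles h s t r : continuous h -> s <= t -> t <= r ->
  Rint s r h = Rint s t h + Rint t r h.
Proof.
move=> hc st tr.
have D a : a > s - 1 -> is_derive a 1 (Rint (s - 1) ^~ h) (h a).
  exact: primitive_bounded.
have E a b : s <= a -> a <= b -> Rint a b h = Rint (s - 1) b h - Rint (s - 1) a h.
  move=> sa ab; apply: (Rint_primitive (H := Rint (s - 1) ^~ h)) => // c /andP[ac _].
  by apply: D; lra.
by rewrite (E s t (lexx s) st) (E t r st tr) (E s r (lexx s) (le_trans st tr)); ring.
Qed.

Lemma primitiveE h s t : continuous h -> s <= t ->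
  Rint s t h = primitive h t - primitive h s.
Proof.
move=> hc st; rewrite /primitive.
case: (lerP 0 s) => s0; first by
  rewrite (le_trans s0 st) (@Rint_chasles _ 0 s t)//; ring.
case: (lerP 0 t) => t0; first by rewrite (@Rint_chasles _ s 0 t) ?(ltW s0)//; ring.
by rewrite (@Rint_chasles _ s t 0) ?(ltW t0)//; ring.
Qed.

Lemma is_derive_primitive h : continuous h ->
  forall t, is_derive t 1 (primitive h) (h t).
Proof.
move=> hc t.
apply: (is_derive_near (u := fun r => primitive h (t - 1) + Rint (t - 1) r h) ltr01).
  move=> r; rewrite ltr_norml => /andP[h1 h2].
  by rewrite primitiveE//; [ring|lra].
have tt : t - 1 < t by lra.
apply: is_derive_eq (is_derive_addf (is_derive_cstf _ _) (primitive_bounded hc tt)) _.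
by rewrite add0r.
Qed.

End Calculus.

(** * Extremal linear forms below a sublinear functional *)

Section Faces.
Context {R : realType} {V : lmodType R} (C : V -> Prop) (p : V -> R).

Definition sublin (q : V -> R) :=
  (forall f g, C f -> C g -> q (f + g) <= q f + q g) /\
  (forall (k : R) f, 0 < k -> C f -> q (k *: f) <= k * q f).

Definition lin (L : V -> R) :=
  (forall f g, C f -> C g -> L (f + g) = L f + L g) /\
  (forall k f, C f -> L (k *: f) = k * L f).

Definition below (q q' : V -> R) := forall f, C f -> q f <= q' f.

(* A sublinear [q <= p] encodes the convex set of linear forms below [q];
   [face q] says that this set is a face of the set of linear forms below [p]. *)
Definition face (q : V -> R) := [/\ sublin q, below q p &
  forall L1 L2 (th : R), lin L1 -> lin L2 -> below L1 p -> below L2 p -> 0 < th < 1 ->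
  below (fun f => th * L1 f + (1 - th) * L2 f) q -> below L1 q].

Hypothesis C0 : C 0.
Hypothesis CD : forall f g, C f -> C g -> C (f + g).
Hypothesis CZ : forall k f, C f -> C (k *: f).

Let CN f : C f -> C (- f). Proof. by move=> Cf; rewrite -scaleN1r; apply: CZ. Qed.

Lemma sublin0 q : sublin q -> q 0 = 0.
Proof.
move=> [_ qZ]; have h2 : (0 : R) < 2 by lra. have h3 : (0 : R) < 2^-1 by lra.
have := qZ _ _ h2 C0; have := qZ _ _ h3 C0; rewrite !scaler0.
by move=> a b; apply/eqP; rewrite eq_le; apply/andP; split; lra.
Qed.

Lemma sublin_opp q f : sublin q -> C f -> - q (- f) <= q f.
Proof.
move=> sq Cf; have := sq.1 _ _ Cf (CN Cf).
by rewrite subrr sublin0//; lra.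
Qed.

Lemma sublinZ q k f : sublin q -> 0 <= k -> C f -> q (k *: f) = k * q f.
Proof.
move=> sq; rewrite le_eqVlt => /predU1P[<- _|k0 Cf].
  by rewrite scale0r mul0r sublin0.
apply/eqP; rewrite eq_le sq.2//=.
have ki : 0 < k^-1 by rewrite invr_gt0.
have := sq.2 _ _ ki (CZ k Cf); rewrite scalerA mulVf ?gt_eqF// scale1r.
by rewrite mulrC ler_pdivlMr// mulrC.
Qed.

Lemma linN L f : lin L -> C f -> L (- f) = - L f.
Proof. by move=> [_ LZ] Cf; rewrite -scaleN1r LZ// mulN1r. Qed.

Lemma linB L f g : lin L -> C f -> C g -> L (f - g) = L f - L g.
Proof. by move=> hL Cf Cg; rewrite hL.1 ?linN//; exact: CN. Qed.

Lemma sublin_inf (q : V -> R) (S : V -> set R) :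
  (forall f, C f -> q f = inf (S f)) ->
  (forall f, C f -> S f !=set0) -> (forall f, C f -> has_lbound (S f)) ->
  (forall f g y z, C f -> C g -> S f y -> S g z -> exists2 x, S (f + g) x & x <= y + z) ->
  (forall k f y, 0 < k -> C f -> S f y -> S (k *: f) (k * y)) -> sublin q.
Proof.
move=> qE S0 Sb SD SZ; split.
  move=> f g Cf Cg; rewrite (qE _ (CD Cf Cg)) (qE _ Cf) (qE _ Cg).
  rewrite -lerBlDr; apply: lb_le_inf; first exact: S0.
  move=> y Sy; rewrite lerBlDr -lerBlDl; apply: lb_le_inf; first exact: S0.
  move=> z Sz; rewrite lerBlDl; have [x Sx xyz] := SD _ _ _ _ Cf Cg Sy Sz.
  by apply: le_trans xyz; apply: ge_inf => //; apply: Sb; exact: CD.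
move=> k f k0 Cf; rewrite (qE _ (CZ k Cf)) (qE _ Cf).
rewrite -ler_pdivrMl//; apply: lb_le_inf; first exact: S0.
move=> y Sy; rewrite ler_pdivrMl//; apply: ge_inf; first exact: (Sb _ (CZ k Cf)).
exact: SZ.
Qed.

Hypothesis sp : sublin p.

Lemma lin_mono L f g : lin L -> below L p -> C f -> C g -> p (f - g) <= 0 -> L f <= L g.
Proof.
move=> hL Lp Cf Cg h; have := Lp (f - g) (CD Cf (CN Cg)).
by rewrite linB//; lra.
Qed.

Lemma sublin_mono q f g : sublin q -> below q p -> C f -> C g -> p (f - g) <= 0 ->
  q f <= q g.
Proof.
move=> sq qp Cf Cg h; have Cfg := CD Cf (CN Cg).
have := sq.1 _ _ Cfg Cg; rewrite subrK; have := qp _ Cfg; lra.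
Qed.

Lemma face_tighten q (u : nat -> V) (kap : R) :
  face q -> (forall n, C (u n)) ->
  (forall n m, (n <= m)%N -> p (u m - u n) <= 0) ->
  (forall n, kap <= q (u n)) -> (forall e, 0 < e -> exists n, q (u n) < kap + e) ->
  exists q', [/\ face q', below q' q & forall n, q' (- u n) <= - kap].
Proof.
move=> [sq qp qF] Cu udec ulb uinf.
pose S x := [set y | exists n t, 0 <= t /\ y = q (x + t *: u n) - t * kap].
pose q' x := inf (S x).
have Sne x : C x -> S x !=set0.
  by move=> Cx; exists (q x); exists 0%N, 0; rewrite lexx scale0r addr0 mul0r subr0.
have Slb x : C x -> has_lbound (S x).
  move=> Cx; exists (- q (- x)) => y [n [t [t0 ->]]].
  have := sq.1 _ _ (CD Cx (CZ t (Cu n))) (CN Cx); rewrite addrC addrA addNr add0r.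
  rewrite sublinZ//; have := ulb n; have : t * kap <= t * q (u n) by rewrite ler_wpM2l.
  lra.
have q'S x y : C x -> S x y -> q' x <= y by move=> Cx Sy; apply: ge_inf => //; exact: Slb.
have q'q : below q' q.
  move=> x Cx; apply: q'S => //; exists 0%N, 0.
  by rewrite lexx scale0r addr0 mul0r subr0.
have sq' : sublin q'.
  apply: (@sublin_inf _ S) => //.
    move=> f g _ _ Cf Cg [n [t [t0 ->]]] [m [s [s0 ->]]].
    exists (q (f + g + (t + s) *: u (maxn n m)) - (t + s) * kap).
      by exists (maxn n m), (t + s); rewrite addr_ge0.
    have h : q (f + g + (t + s) *: u (maxn n m)) <=
        q ((f + t *: u n) + (g + s *: u m)).
      apply: sublin_mono => //; [by do ?apply: CD => //; apply: CZ|by do ?apply: CD => //; apply: CZ|].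
      rewrite (_ : _ - _ = t *: (u (maxn n m) - u n) + s *: (u (maxn n m) - u m)); last first.
        rewrite scalerDl (addrACA f (t *: u n)) opprD addrACA subrr add0r opprD addrACA.
        by rewrite !scalerBr.
      have Cn := CD (Cu (maxn n m)) (CN (Cu n)).
      have Cm := CD (Cu (maxn n m)) (CN (Cu m)).
      apply: le_trans (sp.1 _ _ (CZ t Cn) (CZ s Cm)) _.
      rewrite !sublinZ//.
      have h1 := udec n (maxn n m) (leq_maxl n m).
      have h2 := udec m (maxn n m) (leq_maxr n m).
      by rewrite -[leRHS](addr0 0) lerD// mulr_ge0_le0.
    have := sq.1 _ _ (CD Cf (CZ t (Cu n))) (CD Cg (CZ s (Cu m))); lra.
  move=> k f _ k0 Cf [n [t [t0 ->]]]; exists n, (k * t); split; first by rewrite mulr_ge0// ltW.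
  by rewrite -scalerA -scalerDr sublinZ ?(ltW k0)//; [ring|exact: CD (CZ _ _)].
exists q'; split => //.
  split=> //.
    by move=> x Cx; apply: le_trans (q'q _ Cx) (qp _ Cx).
  move=> L1 L2 th l1 l2 L1p L2p /andP[th0 th1] Lq'.
  have Lq : below (fun f => th * L1 f + (1 - th) * L2 f) q.
    by move=> x Cx; apply: le_trans (Lq' _ Cx) (q'q _ Cx).
  have L1q : below L1 q by apply: (qF L1 L2 th) => //; rewrite th0.
  have L2q : below L2 q.
    apply: (qF L2 L1 (1 - th)) => //; first by apply/andP; split; lra.
    by move=> x Cx; have := Lq _ Cx; lra.
  have Lu n : kap <= th * L1 (u n) + (1 - th) * L2 (u n).
    have h1 : q' (- u n) <= - kap.
      apply: q'S; first exact: CN.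
      by exists n, 1; split; [lra|rewrite scale1r addNr sublin0//; lra].
    have := Lq' _ (CN (Cu n)); rewrite /= (linN l1 (Cu n)) (linN l2 (Cu n)) => h2; lra.
  have L1u n : kap <= L1 (u n).
    apply/ler_addgt0Pr => e e0.
    have [m um] := uinf (e * th) (mulr_gt0 e0 th0).
    pose k := maxn n m.
    have h1 : L1 (u k) <= L1 (u n).
      by apply: lin_mono => //; apply: udec; exact: leq_maxl.
    have h2 : q (u k) <= q (u m).
      by apply: sublin_mono => //; apply: udec; exact: leq_maxr.
    have h3 := Lu k. have h4 := L2q _ (Cu k). have h5 := L1q _ (Cu k).
    have h6 : (1 - th) * L2 (u k) <= (1 - th) * (kap + e * th) by rewrite ler_pM2l; lra.
    suff : th * kap <= th * (L1 (u k) + e) by rewrite ler_pM2l//; lra.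
    have : 0 <= th * (th * e) by rewrite !mulr_ge0 ?(ltW th0) ?(ltW e0).
    nra.
  move=> x Cx; apply: lb_le_inf; first exact: Sne.
  move=> _ [n [t [t0 ->]]].
  have := L1q _ (CD Cx (CZ t (Cu n))); rewrite l1.1 ?l1.2//; last exact: CZ.
  have : t * kap <= t * L1 (u n) by rewrite ler_wpM2l.
  lra.
move=> n; apply: q'S; first exact: CN.
by exists n, 1; split; [lra|rewrite scale1r addNr sublin0//; lra].
Qed.

Lemma face_minimal q0 : face q0 -> exists q, [/\ face q, below q q0 &
  forall q', face q' -> below q' q -> below q q'].
Proof.
move=> fq0.
pose T := {q : V -> R | face q /\ below q q0}.
pose leT (a b : T) := `[< below (sval b) (sval a) >].
have tq0 : face q0 /\ below q0 q0 by split => // f _; rewrite lexx.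
have [] := @ZL_preorder T (exist _ q0 tq0) leT.
- by move=> a; apply/asboolP => f _; rewrite lexx.
- move=> a b c /asboolP ba /asboolP ac; apply/asboolP => f Cf.
  exact: le_trans (ac _ Cf) (ba _ Cf).
- move=> A tot; have [->|/set0P[a0 Aa0]] := eqVneq A set0; first by exists (exist _ q0 tq0).
  pose S f := [set (sval a) f | a in A].
  have Sne f : S f !=set0 by exists (sval a0 f); exists a0.
  have Slb f : C f -> has_lbound (S f).
    move=> Cf; exists (- p (- f)) => _ [a _ <-].
    have [[sa ap _] _] := svalP a.
    by have := sublin_opp sa Cf; have := ap _ (CN Cf); lra.
  pose q f := inf (S f).
  have qa a f : A a -> C f -> q f <= sval a f.
    by move=> Aa Cf; apply: ge_inf; [exact: Slb|exists a].
  have fq : face q /\ below q q0.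
    split; last by move=> f Cf; apply: le_trans (qa a0 f Aa0 Cf) ((svalP a0).2 f Cf).
    split.
    + apply: (@sublin_inf _ S) => //.
        move=> f g _ _ Cf Cg [a Aa <-] [b Ab <-].
        have [sa _ _] := (svalP a).1; have [sb _ _] := (svalP b).1.
        case: (tot a b Aa Ab) => /asboolP ab.
          exists (sval b (f + g)); first by exists b.
          by apply: le_trans (sb.1 _ _ Cf Cg) _; rewrite lerD2r ab.
        exists (sval a (f + g)); first by exists a.
        by apply: le_trans (sa.1 _ _ Cf Cg) _; rewrite lerD2l ab.
      move=> k f _ k0 Cf [a Aa <-]; exists a => //.
      have [sa _ _] := (svalP a).1; apply: sublinZ => //; exact: ltW.
    + move=> f Cf; have [_ ap _] := (svalP a0).1.
      exact: le_trans (qa a0 f Aa0 Cf) (ap _ Cf).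
    + move=> L1 L2 th l1 l2 L1p L2p th01 Lq f Cf; apply: lb_le_inf => // _ [a Aa <-].
      have [_ _ aF] := (svalP a).1; apply: (aF L1 L2 th) => // g Cg.
      exact: le_trans (Lq _ Cg) (qa a g Aa Cg).
  by exists (exist _ q fq) => a Aa; apply/asboolP => f Cf; exact: qa.
move=> [q [fq qq0]] qmax; exists q; split => // q' fq' q'q.
have tq' : face q' /\ below q' q0.
  by split => // f Cf; apply: le_trans (q'q _ Cf) (qq0 _ Cf).
have /asboolP : leT (exist _ q' tq') (exist _ q (conj fq qq0)); last by [].
by apply: qmax; apply/asboolP.
Qed.

Lemma exists_extremal (u : nat -> V) (kap : R) :
  (forall n, C (u n)) -> (forall n m, (n <= m)%N -> p (u m - u n) <= 0) ->
  (forall n, kap <= p (u n)) ->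
  exists L, [/\ lin L, below L p, forall n, kap <= L (u n) &
    forall L1 L2 (th : R), lin L1 -> lin L2 -> below L1 p -> below L2 p -> 0 < th < 1 ->
    below (fun f => th * L1 f + (1 - th) * L2 f) L -> below L1 L].
Proof.
move=> Cu udec ukap.
pose S := [set p (u n) | n in setT].
have S0 : S !=set0 by exists (p (u 0%N)); exists 0%N.
have Sb : has_lbound S by exists kap => _ [n _ <-].
have fp : face p by split => // f _; rewrite lexx.
have [||q0 [fq0 q0p q0u]] := @face_tighten p u (inf S) fp Cu udec.
- by move=> n; apply: ge_inf => //; exists n.
- move=> e e0; have [_ [n _ <-] h] := inf_adherent e0 (conj S0 Sb).
  by exists n.
have [q [fq qq0 qmin]] := face_minimal fq0.
have [sq qp qF] := fq.
have qN f : C f -> q (- f) = - q f.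
  move=> Cf; have [||n|e e0|q' [fq' q'q q'N]] := @face_tighten q (fun=> f) (q f) fq.
  - by [].
  - by move=> n m _; rewrite subrr sublin0.
  - exact: lexx.
  - by exists 0%N; rewrite ltrDl.
  apply/eqP; rewrite eq_le; apply/andP; split.
    exact: le_trans (qmin _ fq' q'q _ (CN Cf)) (q'N 0%N).
  by rewrite lerNl; exact: sublin_opp.
have lq : lin q.
  split=> [f g Cf Cg|k f Cf].
    apply/eqP; rewrite eq_le sq.1//=.
    have := sq.1 _ _ (CN Cf) (CN Cg); rewrite -opprD !qN//; [lra|exact: CD].
  have [k0|k0] := leP 0 k; first exact: sublinZ.
  rewrite -[k in LHS]opprK scaleNr qN; last exact: CZ.
  by rewrite sublinZ//; [ring|lra].
exists q; split => // n.
have : inf S <= q (u n).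
  have := le_trans (qq0 _ (CN (Cu n))) (q0u n); rewrite qN//; lra.
by apply: le_trans; apply: lb_le_inf => // _ [m _ <-].
Qed.

End Faces.

Section Continuity.
Context {R : realType} {T : topologicalType}.
Implicit Types f g : T -> R.

Lemma ctsD f g : continuous f -> continuous g -> continuous (fun w => f w + g w).
Proof. by move=> cf cg w; apply: cvgD; [exact: cf|exact: cg]. Qed.

Lemma ctsN f : continuous f -> continuous (fun w => - f w).
Proof. by move=> cf w; apply: cvgN; exact: cf. Qed.

Lemma ctsB f g : continuous f -> continuous g -> continuous (fun w => f w - g w).
Proof. by move=> cf cg w; apply: cvgB; [exact: cf|exact: cg]. Qed.

Lemma ctsM f g : continuous f -> continuous g -> continuous (fun w => f w * g w).
Proof. by move=> cf cg w; apply: cvgM; [exact: cf|exact: cg]. Qed.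

Lemma ctsC (k : R) : continuous (fun _ : T => k).
Proof. by move=> w; exact: cvg_cst. Qed.

Lemma ctsmax f g : continuous f -> continuous g ->
  continuous (fun w => Num.max (f w) (g w)).
Proof. exact: max_fun_continuous. Qed.

Lemma ctsmin f g : continuous f -> continuous g ->
  continuous (fun w => Num.min (f w) (g w)).
Proof. exact: min_fun_continuous. Qed.

Lemma cts_comp {U W : topologicalType} (h : U -> W) (k : T -> U) :
  continuous h -> continuous k -> continuous (fun w => h (k w)).
Proof. by move=> ch ck w; apply: continuous_comp; [exact: ck|exact: ch]. Qed.

Lemma cts_pair {U W : topologicalType} (h : T -> U) (k : T -> W) :
  continuous h -> continuous k -> continuous (fun w => (h w, k w)).
Proof. by move=> ch ck w; apply: cvg_pair; [exact: ch|exact: ck]. Qed.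

Lemma cts_bounded f : compact [set: T] -> continuous f ->
  exists2 M : R, 0 < M & forall w, `|f w| <= M.
Proof.
move=> cT cf.
have /compact_bounded[M [_ HM]] : compact (f @` [set: T]).
  by apply: continuous_compact => //; exact: continuous_subspaceT.
exists (`|M| + 1); first by rewrite ltr_wpDl.
by move=> w; apply: HM; [rewrite ltr_pwDr// ler_norm|exists w].
Qed.

End Continuity.

Section Gauge.
Context {R : realType} {Om : pseudoPMetricType R}.

Definition gauge_set (A : set Om) (w : Om) : set R :=
  [set e | e = 1 \/ 0 < e /\ exists2 a, A a & ball w e a].

Definition gauge (A : set Om) (w : Om) : R := inf (gauge_set A w).

Let gs0 A w : gauge_set A w !=set0. Proof. by exists 1; left. Qed.
Let gsb A w : lbound (gauge_set A w) 0.
Proof. by move=> e [->|[/ltW//]]. Qed.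
Let gsh A w : has_lbound (gauge_set A w). Proof. by exists 0; exact: gsb. Qed.

Lemma gauge_ge0 A w : 0 <= gauge A w.
Proof. by rewrite /gauge; exact: lb_le_inf (gs0 A w) (@gsb A w). Qed.

Lemma gauge_eq0 A w : A w -> gauge A w = 0.
Proof.
move=> Aw; apply/eqP; rewrite eq_le gauge_ge0 andbT.
apply/ler_addgt0Pr => e e0; rewrite add0r; rewrite /gauge; apply: (ge_inf (gsh A w)).
by right; split => //; exists w => //; exact: ballxx.
Qed.

Lemma gauge_gt0 A w : closed A -> ~ A w -> 0 < gauge A w.
Proof.
move=> cA nAw.
have : nbhs w (~` A) by apply: open_nbhs_nbhs; split => //; exact: closed_openC.
move=> /nbhs_ballP[e /= e0 He].
apply: (@lt_le_trans _ _ (Num.min e 1)); first by rewrite lt_min e0 ltr01.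
rewrite /gauge; apply: (lb_le_inf (gs0 A w)) => d [->|[d0 [a Aa wa]]]; first by rewrite ge_min lexx orbT.
rewrite leNgt lt_min; apply/negP => /andP[de _].
by apply: (He a) => //; apply: le_ball wa; exact: ltW.
Qed.

Lemma gauge_lip A w w' (d : R) : 0 < d -> ball w d w' -> gauge A w <= gauge A w' + d.
Proof.
move=> d0 ww'; rewrite -lerBlDr; rewrite {2}/gauge; apply: (lb_le_inf (gs0 A w')) => e [->|[e0 [a Aa wa]]].
  have : gauge A w <= 1 by rewrite /gauge; apply: (ge_inf (gsh A w)); left.
  by lra.
rewrite lerBlDr; rewrite /gauge; apply: (ge_inf (gsh A w)); right; split; first exact: addr_gt0.
by exists a => //; rewrite addrC; apply: ball_triangle wa.
Qed.

Lemma gauge_cts A : continuous (gauge A).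
Proof.
move=> w; apply/cvgrPdist_le => e e0.
apply/nbhs_ballP; exists e => //= w' ww'.
by rewrite ler_distlC; have := gauge_lip A e0 ww'; have := gauge_lip A e0 (ball_sym ww'); lra.
Qed.

Lemma closed_indicator_approx A : closed A -> exists v : nat -> Om -> R,
  [/\ forall n, continuous (v n), forall n w, 0 <= v n w <= 1,
      forall n m w, (n <= m)%N -> v m w <= v n w, forall n w, A w -> v n w = 1 &
      forall w, ~ A w -> exists n, v n w = 0].
Proof.
move=> cA; exists (fun n w => Num.max 0 (1 - n%:R * gauge A w)); split.
- move=> n; apply: ctsmax; first exact: ctsC.
  apply: ctsB; first exact: ctsC.
  by apply: ctsM; [exact: ctsC|exact: gauge_cts].
- move=> n w; rewrite le_max lexx/= ge_max ler01/= gerBl mulr_ge0//; exact: gauge_ge0.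
- move=> n m w nm; rewrite ge_max !le_max lexx/=; apply/orP; right.
  by rewrite lerD2l lerN2 ler_wpM2r ?gauge_ge0// ler_nat.
- by move=> n w Aw; rewrite gauge_eq0// mulr0 subr0 max_r.
- move=> w nAw; have g0 := gauge_gt0 cA nAw.
  exists (Num.truncn (gauge A w)^-1).+1; apply/max_idPl.
  rewrite subr_le0 -ler_pdivrMr// mul1r ltW//.
  have g1 : 0 <= (gauge A w)^-1 by rewrite invr_ge0 ltW.
  by have /andP[_] := truncn_itv g1.
Qed.

End Gauge.

Local Notation cts := (fun f => continuous f).

(** * Riesz representation on a compact space *)

Section Riesz.
Context {R : realType} {Om : pseudoPMetricType R}.
Variable L : (Om -> R) -> R.
Hypothesis cptOm : compact [set: Om].
Hypothesis Llin : lin cts L.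
Hypothesis Lpos : forall f : Om -> R, continuous f -> (forall w, 0 <= f w) -> 0 <= L f.
Hypothesis L1 : L (fun=> 1) = 1.

Lemma cts0 : continuous (0 : Om -> R). Proof. exact: ctsC. Qed.

Let LB (f g : Om -> R) : continuous f -> continuous g -> L (fun w => f w - g w) = L f - L g.
Proof.
move=> cf cg; rewrite -[RHS]/(L f - L g) -(@linB _ _ cts) //.
by move=> k h ch; exact: (ctsM (@ctsC _ _ k)).
Qed.

Lemma lin_le (f g : Om -> R) : continuous f -> continuous g -> (forall w, f w <= g w) -> L f <= L g.
Proof.
move=> cf cg fg; rewrite -subr_ge0 -LB//; apply: Lpos; first exact: ctsB.
by move=> w; rewrite subr_ge0.
Qed.

Lemma cts_sum (f : nat -> Om -> R) n : (forall k, continuous (f k)) ->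
  continuous (\sum_(k < n) f k : Om -> R).
Proof.
move=> cf; elim: n => [|n IH]; first by rewrite big_ord0; exact: cts0.
by rewrite big_ord_recr/=; apply: ctsD.
Qed.

Lemma lin_sum (f : nat -> Om -> R) n : (forall k, continuous (f k)) ->
  L (\sum_(k < n) f k) = \sum_(k < n) L (f k).
Proof.
move=> cf; elim: n => [|n IH].
  by rewrite !big_ord0 -(scale0r (0 : Om -> R)) Llin.2 ?mul0r//; exact: cts0.
by rewrite !big_ord_recr/= Llin.1 ?IH//; exact: cts_sum.
Qed.

Definition coverable (A : set Om) (B : R) := exists phi : nat -> Om -> R,
  [/\ forall n, continuous (phi n), forall n w, 0 <= phi n w,
      forall n w, phi n w <= phi n.+1 w,
      forall w, A w -> forall e, 0 < e -> exists n, 1 - e < phi n w &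
      forall n, L (phi n) <= B].

Definition mustar (A : set Om) : R := inf [set B | coverable A B].

Lemma coverable_ge0 A B : coverable A B -> 0 <= B.
Proof.
by move=> [phi [c p _ _ h]]; apply: le_trans (h 0%N); exact: Lpos.
Qed.

Lemma coverable_fun A (f : Om -> R) : continuous f -> (forall w, 0 <= f w) ->
  (forall w, A w -> 1 <= f w) -> coverable A (L f).
Proof.
move=> cf f0 f1; exists (fun=> f); split => // w Aw e e0; exists 0%N.
by apply: lt_le_trans (f1 w Aw); rewrite ltrBlDr ltrDl.
Qed.

Let has_cov A : [set B | coverable A B] !=set0.
Proof.
exists 1; rewrite -L1; apply: coverable_fun => //; exact: ctsC.
Qed.

Let lb_cov A : has_lbound [set B | coverable A B].
Proof. by exists 0 => B; exact: coverable_ge0. Qed.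

Lemma mustar_le A B : coverable A B -> mustar A <= B.
Proof. by move=> h; rewrite /mustar; apply: (ge_inf (lb_cov A)). Qed.

Lemma mustar_ge A x : (forall B, coverable A B -> x <= B) -> x <= mustar A.
Proof. by move=> h; rewrite /mustar; apply: (lb_le_inf (has_cov A)) => B; exact: h. Qed.

Lemma mustar_cov A e : 0 < e -> coverable A (mustar A + e).
Proof.
move=> e0; have [B [phi [c p i s h]] hB] := inf_adherent e0 (conj (has_cov A) (lb_cov A)).
exists phi; split => // n; apply: le_trans (h n) (ltW hB).
Qed.

Lemma mustar_ge0 A : 0 <= mustar A.
Proof. by apply: mustar_ge => B; exact: coverable_ge0. Qed.

Lemma mustar_mono A A' : A `<=` A' -> mustar A <= mustar A'.
Proof.
move=> AA'; apply: mustar_ge => B [phi [c p i s h]]; apply: mustar_le.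
by exists phi; split => // w /AA'; exact: s.
Qed.

Let L0 : L (0 : Om -> R) = 0.
Proof. by rewrite -(scale0r (0 : Om -> R)) Llin.2 ?mul0r//; exact: cts0. Qed.

Lemma mustar0 : mustar set0 = 0.
Proof.
apply/eqP; rewrite eq_le mustar_ge0 andbT -L0; apply: mustar_le.
by apply: coverable_fun => //; exact: cts0.
Qed.

Lemma phi_mono (phi : nat -> Om -> R) : (forall n w, phi n w <= phi n.+1 w) ->
  forall n m w, (n <= m)%N -> phi n w <= phi m w.
Proof.
move=> h n m w; elim: m => [|m IH]; first by rewrite leqn0 => /eqP ->.
by rewrite leq_eqVlt => /predU1P[->//|/IH/le_trans]; apply.
Qed.

Lemma mustarT : mustar setT = 1.
Proof.
apply/eqP; rewrite eq_le; apply/andP; split.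
  by rewrite -L1; apply: mustar_le; apply: coverable_fun => //; exact: ctsC.
apply: mustar_ge => B [phi [c p i s h]]; apply/ler_addgt0Pr => e e0.
have /compact_near_coveringP := cptOm.
move=> /(_ nat \oo (fun n w => 1 - e < phi n w) _) [].
  move=> w _; have [n hn] := s w I e e0.
  have nw : \forall w' \near w, 1 - e < phi n w'.
    exact: (cvgr_gt (phi n w) (c n w)).
  exists ([set w' | 1 - e < phi n w'], [set m | (n <= m)%N]) => /=.
    by split => //; exists n.
  by move=> [w' m] [/= h1 h2]; apply: lt_le_trans h1 _; exact: phi_mono.
move=> N _ /(_ N (leqnn N)) hN; apply: le_trans (_ : L (fun=> 1 - e) + e <= _).
  have -> : (fun=> 1 - e) = ((1 - e) *: (fun=> 1) : Om -> R).
    by apply/funext => w /=; rewrite -[RHS]/((1 - e) * 1) mulr1.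
  by rewrite Llin.2 ?L1; [lra|exact: ctsC].
rewrite lerD2r; apply: le_trans (h N); apply: lin_le => //; first exact: ctsC.
by move=> w; apply/ltW/hN.
Qed.

Lemma sum_geom_le (e : R) n : 0 <= e -> \sum_(k < n) e / 2 ^+ k.+1 <= e.
Proof.
move=> e0; suff -> : \sum_(k < n) e / 2 ^+ k.+1 = e * (1 - (2 ^+ n)^-1).
  by rewrite -[leRHS]mulr1 ler_wpM2l// gerBl invr_ge0 exprn_ge0.
elim: n => [|n IH]; first by rewrite big_ord0 expr0 invr1 subrr mulr0.
rewrite big_ord_recr/= IH exprS; have : (2 : R) ^+ n != 0 by rewrite expf_neq0.
by move=> h; field.
Qed.

Lemma mustar_sigma : sigma_subadditive (fun A => (mustar A)%:E).
Proof.
move=> F; set S := (\sum_(i <oo) _)%E.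
have [->|Sy] := eqVneq S +oo%E; first by rewrite leey.
have S0 : (0 <= S)%E by apply: nneseries_ge0 => n _ _; rewrite lee_fin mustar_ge0.
have [s SE] : exists s, S = s%:E.
  by exists (fine S); rewrite fineK// ge0_fin_numE// ltey.
rewrite SE; apply/lee_addgt0Pr => e e0; rewrite -EFinD lee_fin.
have e2 k : 0 < e / 2 ^+ k.+1 by rewrite divr_gt0// exprn_gt0.
have /choice[phi hphi] : forall k, exists f : nat -> Om -> R,
    [/\ forall n, continuous (f n), forall n w, 0 <= f n w,
      forall n w, f n w <= f n.+1 w,
      forall w, F k w -> forall d, 0 < d -> exists n, 1 - d < f n w &
      forall n, L (f n) <= mustar (F k) + e / 2 ^+ k.+1].
  by move=> k; exact: mustar_cov.
pose Phi n : Om -> R := \sum_(k < n) phi k n.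
have PE n w : Phi n w = \sum_(k < n) phi k n w by rewrite /Phi fct_sumE.
have h0 k n w : 0 <= phi k n w by have [_ + _ _ _] := hphi k; exact.
have hc k n : continuous (phi k n) by have [+ _ _ _ _] := hphi k; exact.
have hi k n w : phi k n w <= phi k n.+1 w by have [_ _ + _ _] := hphi k; exact.
apply: mustar_le; exists Phi; split.
- by move=> n; apply: (@cts_sum (fun k => phi k n)).
- by move=> n w; rewrite PE sumr_ge0.
- move=> n w; rewrite !PE big_ord_recr/=; apply: ler_wpDr => //.
  by apply: ler_sum => k _.
- move=> w [k _ Fkw] d d0; have [_ _ _ + _] := hphi k.
  move=> /(_ w Fkw d d0)[n hn]; exists (maxn k.+1 n).
  apply: lt_le_trans hn _; rewrite PE.
  have kk : (k < maxn k.+1 n)%N by exact: leq_maxl.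
  rewrite (bigD1 (Ordinal kk))//= ler_wpDr ?sumr_ge0//.
  apply: (phi_mono (hi k)); exact: leq_maxr.
- move=> n; rewrite /Phi (lin_sum (f := fun k => phi k n) n (fun k => hc k n)).
  apply: le_trans (_ : \sum_(k < n) (mustar (F k) + e / 2 ^+ k.+1) <= _).
    by apply: ler_sum => k _; have [_ _ _ _ +] := hphi k; exact.
  rewrite big_split/= lerD ?sum_geom_le ?(ltW e0)//.
  rewrite -lee_fin -SE -sumEFin -(big_mkord xpredT (fun k => (mustar (F k))%:E)).
  by apply: nneseries_lim_ge => k _ _; rewrite lee_fin mustar_ge0.
Qed.

Lemma mustar_closed A X : closed A ->
  mustar (X `&` A) + mustar (X `&` ~` A) <= mustar X.
Proof.
move=> cA; have [v [vc v01 vd v1 v0]] := closed_indicator_approx cA.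
apply: mustar_ge => B [phi [c p i s h]]; apply/ler_addgt0Pr => e e0.
pose f n w := phi n w - (if n is m.+1 then phi m w else 0).
have f0 n w : 0 <= f n w.
  by rewrite /f; case: n => [|n]; rewrite ?subr0// subr_ge0.
have fc n : continuous (f n).
  by case: n => [|n]; apply: ctsB => //; exact: ctsC.
have phiE n : phi n = \sum_(k < n.+1) f k.
  elim: n => [|n IH].
    by rewrite big_ord_recr big_ord0/= add0r; apply/funext => w; rewrite /f subr0.
  rewrite big_ord_recr/= -IH; apply/funext => w.
  by rewrite -[RHS]/(phi n w + (phi n.+1 w - phi n w)) addrC subrK.
pose l k := inf [set L (fun w => f k w * v n w) | n in setT].
have fv k n : continuous (fun w => f k w * v n w) by apply: ctsM.
have fv0 k n w : 0 <= f k w * v n w by apply: mulr_ge0 => //; case/andP: (v01 n w).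
have ls k : has_inf [set L (fun w => f k w * v n w) | n in setT].
  split; first by exists (L (fun w => f k w * v 0%N w)); exists 0%N.
  by exists 0 => _ [n _ <-]; apply: Lpos.
have e2 k : 0 < e / 2 ^+ k.+1 by rewrite divr_gt0// exprn_gt0.
have /choice[K hK] : forall k, exists n, L (fun w => f k w * v n w) <= l k + e / 2 ^+ k.+1.
  by move=> k; have [_ [n _ <-] hn] := inf_adherent (e2 k) (ls k); exists n; exact: ltW.
pose psi n : Om -> R := \sum_(k < n.+1) (fun w => f k w * v (K k) w).
pose chi n w := phi n w * (1 - v n w).
have psiE n w : psi n w = \sum_(k < n.+1) f k w * v (K k) w by rewrite /psi fct_sumE.
have Lpsi n : L (psi n) <= \sum_(k < n.+1) l k + e.
  rewrite (lin_sum (f := fun k w => f k w * v (K k) w) n.+1 (fun k => fv k (K k))).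
  apply: le_trans (_ : \sum_(k < n.+1) (l k + e / 2 ^+ k.+1) <= _).
    by apply: ler_sum => k _.
  by rewrite big_split/= lerD2l sum_geom_le// ltW.
have Lchi n : L (chi n) <= B - \sum_(k < n.+1) l k.
  pose Sn : Om -> R := \sum_(k < n.+1) (fun w => f k w * v n w).
  have cSn : continuous Sn by apply: (cts_sum (f := fun k w => f k w * v n w)).
  have -> : chi n = (fun w => phi n w - Sn w).
    apply/funext => w; rewrite /Sn fct_sumE /chi mulrBr mulr1; congr (_ - _).
    by rewrite phiE fct_sumE mulr_suml.
  rewrite (LB (c n) cSn).
  apply: lerB; first exact: h.
  rewrite /Sn (lin_sum (f := fun k w => f k w * v n w) n.+1 (fun k => fv k n)); apply: ler_sum => k _.
  by apply: (ge_inf (proj2 (ls k))); exists n.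
pose s1 := sup [set \sum_(k < n.+1) l k | n in setT].
have l0 k : 0 <= l k.
  by apply: (lb_le_inf (proj1 (ls k))) => _ [n _ <-]; apply: Lpos.
have chi0 n w : 0 <= chi n w.
  by apply: mulr_ge0 => //; rewrite subr_ge0; case/andP: (v01 n w).
have chic n : continuous (chi n).
  by apply: ctsM => //; apply: ctsB => //; exact: ctsC.
have hs : has_sup [set \sum_(k < n.+1) l k | n in setT].
  split; first by exists (\sum_(k < 1) l k); exists 0%N.
  exists B => _ [n _ <-]; have := Lchi n.
  have := Lpos (chic n) (chi0 n); lra.
have chii n m w : (n <= m)%N -> chi n w <= chi m w.
  move=> nm; rewrite /chi; apply: ler_pM => //.
  - by rewrite subr_ge0; case/andP: (v01 n w).
  - exact: phi_mono.
  - by rewrite lerD2l lerN2 vd.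
have m1 : mustar (X `&` A) <= s1 + e.
  apply: mustar_le; exists psi; split.
  - by move=> n; apply: (cts_sum (f := fun k w => f k w * v (K k) w)) => k.
  - by move=> n w; rewrite psiE sumr_ge0.
  - by move=> n w; rewrite !psiE [leRHS]big_ord_recr/= ler_wpDr.
  - move=> w [Xw Aw] d d0; have [n hn] := s w Xw d d0; exists n.
    rewrite psiE (eq_bigr (fun k : 'I_n.+1 => f k w)); last by move=> k _; rewrite v1// mulr1.
    by move: hn; rewrite phiE fct_sumE.
  - move=> n; apply: le_trans (Lpsi n) _; rewrite lerD2r.
    by apply: ub_le_sup; [exact: hs.2|exists n].
have m2 : mustar (X `&` ~` A) <= B - s1.
  apply: mustar_le; exists chi; split => //.
  - by move=> n w; exact: chii.
  - move=> w [Xw nAw] d d0; have [n hn] := s w Xw d d0; have [m hm] := v0 w nAw.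
    exists (maxn n m); apply: lt_le_trans hn _.
    have -> : chi (maxn n m) w = phi (maxn n m) w.
      rewrite /chi (_ : v _ w = 0) ?subr0 ?mulr1//; apply/eqP; rewrite eq_le.
      by have /andP[-> _] := v01 (maxn n m) w; rewrite -hm vd// leq_maxr.
    by apply: (phi_mono i); exact: leq_maxl.
  - move=> n; rewrite lerBrDr -lerBrDl; apply: ge_sup; first exact: hs.1.
    move=> _ [m _ <-]; rewrite lerBrDl -lerBrDr.
    apply: le_trans (_ : L (chi (maxn n m)) <= _).
      by apply: lin_le => // w; apply: chii; exact: leq_maxl.
    apply: le_trans (Lchi _) _; rewrite lerD2l lerN2.
    rewrite -!(big_mkord xpredT l) [leRHS](@big_cat_nat _ _ _ m.+1)//= ?ltnS ?leq_maxr//.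
    by rewrite lerDl sumr_ge0.
lra.
Qed.

End Riesz.

Section BorelMeasure.
Context {R : realType} {Om : pseudoPMetricType R}.

Lemma closed_borel (A : set Om) : closed A -> measurable (A : set (Borel Om)).
Proof.
move=> cA; rewrite -[A]setCK; apply: measurableC.
by apply: sub_gen_smallest; exact: closed_openC.
Qed.

Lemma open_borel (A : set Om) : open A -> measurable (A : set (Borel Om)).
Proof. by move=> oA; exact: sub_gen_smallest. Qed.

Lemma cts_borel (f : Om -> R) : continuous f ->
  measurable_fun [set: Borel Om] (f : Borel Om -> R).
Proof.
move=> /continuousP cf; apply: (measurability _ (RGenOpens.measurableE R)).
move=> _ [_ [a [b ->] <-]]; rewrite setTI; apply: open_borel.
by apply: cf; exact: interval_open.
Qed.

Lemma cts_borel_map (h : Om -> Om) : continuous h ->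
  measurable_fun [set: Borel Om] (h : Borel Om -> Borel Om).
Proof.
move=> /continuousP ch; apply: (@measurability _ _ (Borel Om) (Borel Om) setT h (@open Om) erefl).
by move=> _ [A oA <-]; rewrite setTI; apply: open_borel; exact: ch.
Qed.

Section Integral.
Hypothesis cptOm : compact [set: Om].
Variable m : probability (Borel Om) R.

Lemma cts_integrable (A : set (Borel Om)) (f : Om -> R) : measurable A -> continuous f ->
  m.-integrable A (EFin \o (f : Borel Om -> R)).
Proof.
move=> mA cf; apply: measurable_bounded_integrable => //.
- by apply: le_lt_trans (probability_le1 m mA) _; rewrite ltry.
- by apply: measurable_funTS; exact: cts_borel.
- have [M _ HM] := cts_bounded cptOm cf.
  exists M; split; first exact: num_real.
  move=> x /ltW Mx y _; exact: le_trans (HM y) Mx.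
Qed.

Lemma integral_lin (A : set (Borel Om)) : measurable A ->
  lin cts (fun f : Om -> R => Rintegral m A (f : Borel Om -> R)).
Proof.
move=> mA; split=> [f g cf cg|k f cf].
  by rewrite -RintegralD//; exact: cts_integrable.
by rewrite -RintegralZl//; exact: cts_integrable.
Qed.

Lemma integral_fine (A : set (Borel Om)) (f : Om -> R) : measurable A -> continuous f ->
  (\int[m]_(w in A) (f w)%:E)%E = (Rintegral m A (f : Borel Om -> R))%:E.
Proof.
by move=> mA cf; rewrite /Rintegral fineK//; apply: integrable_fin_num (cts_integrable mA cf).
Qed.

Lemma integral_pos (A : set (Borel Om)) (f : Om -> R) : measurable A -> continuous f ->
  (forall w, 0 <= f w) -> 0 <= Rintegral m A (f : Borel Om -> R).
Proof. by move=> mA cf f0; apply: Rintegral_ge0. Qed.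

Lemma integral_cst1 (A : set (Borel Om)) : measurable A ->
  Rintegral m A (fun=> 1) = fine (m A).
Proof. by move=> mA; rewrite Rintegral_cst// mul1r. Qed.

Lemma integral_setIC (A : set (Borel Om)) (f : Om -> R) : measurable A -> continuous f ->
  Rintegral m setT (f : Borel Om -> R) =
  Rintegral m A (f : Borel Om -> R) + Rintegral m (~` A) (f : Borel Om -> R).
Proof.
move=> mA cf; rewrite -(setUv A) Rintegral_setU//.
- exact: measurableC.
- by rewrite setUv; apply: cts_integrable.
- by apply/disj_setPLR; rewrite setCK.
Qed.

Lemma Rintegral_invariant (A : set (Borel Om)) (f : Om -> R) (h : Om -> Om) :
  measurable A -> continuous f -> continuous h ->
  (forall B : set (Borel Om), measurable B -> m (h @^-1` B) = m B) -> h @^-1` A = A ->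
  Rintegral m A (fun w => f (h w)) = Rintegral m A (f : Borel Om -> R).
Proof.
move=> mA cf ch minv hA; congr fine.
have mh := cts_borel_map ch.
rewrite -[X in (\int[_]_(_ in X) _)%E = _]hA.
rewrite -(@integral_pushforward _ _ (Borel Om) (Borel Om) _ h mh m A (fun w => (f w)%:E))//.
- by apply: eq_measure_integral => B mB _ /=; rewrite /pushforward minv.
- by apply/measurable_EFinP; exact: cts_borel.
- rewrite hA; apply: (cts_integrable (f := fun w => f (h w))) => //.
  exact: cts_comp.
Qed.

Lemma integral_sup_ge (A : set (Borel Om)) (phi : nat -> Om -> R) (b : R) : measurable A ->
  (forall n, continuous (phi n)) -> (forall n w, 0 <= phi n w) ->
  (forall n w, phi n w <= phi n.+1 w) ->
  (forall w, A w -> forall e, 0 < e -> exists n, 1 - e < phi n w) ->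
  (forall n, Rintegral m A (phi n : Borel Om -> R) <= b) -> (m A <= b%:E)%E.
Proof.
move=> mA c p i s hb.
pose g n (w : Borel Om) := (phi n w)%:E.
have gi w : {homo g^~ w : n k / (n <= k)%N >-> (n <= k)%E}.
  by move=> n k nk; rewrite lee_fin; exact: (phi_mono i).
have gm n : measurable_fun A (g n).
  by apply/measurable_EFinP; apply: measurable_funTS; exact: cts_borel.
have g0 n w : A w -> (0 <= g n w)%E by rewrite lee_fin.
have MC := monotone_convergence m mA gm g0 (fun w _ => gi w).
have lo : (m A <= \int[m]_(w in A) limn (g^~ w))%E.
  have -> : m A = (\int[m]_(w in A) 1)%E by rewrite integral_cst// mul1e.
  apply: ge0_le_integral => //.
  - by apply: (@emeasurable_fun_cvg _ _ _ A g) => // w Aw; apply: ereal_nondecreasing_is_cvgn; exact: gi.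
  - move=> w Aw; apply/lee_addgt0Pr => e e0.
    have [n hn] := s w Aw e e0.
    rewrite -leeBlDr//; apply: (@le_trans _ _ (g n w)).
      by rewrite -EFinB lee_fin ltW.
    apply: lime_ge; first by apply: ereal_nondecreasing_is_cvgn; exact: gi.
    by exists n => // k nk; exact: gi.
apply: le_trans lo _; rewrite MC; apply: lime_le.
  apply: ereal_nondecreasing_is_cvgn => n k nk; apply: ge0_le_integral => //.
  - by move=> w Aw; exact: g0.
  - by move=> w Aw; exact: gi.
by near=> n; rewrite (integral_fine mA (c n)) lee_fin.
Unshelve. all: by end_near. Qed.

End Integral.

Variable L : (Om -> R) -> R.
Hypothesis cptOm : compact [set: Om].
Hypothesis Llin : lin cts L.
Hypothesis Lpos : forall f : Om -> R, continuous f -> (forall w, 0 <= f w) -> 0 <= L f.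
Hypothesis L1 : L (fun=> 1) = 1.

Lemma riesz_measure : exists m : probability (Borel Om) R,
  forall A, m A = (mustar L A)%:E.
Proof.
pose muE (A : set Om) := (mustar L A)%:E.
have mu0 : muE set0 = 0%E by rewrite /muE (mustar0 Llin Lpos L1).
have muge A : (0 <= muE A)%E by rewrite lee_fin; exact: mustar_ge0.
have mumono : {homo muE : A B / A `<=` B >-> (A <= B)%E}.
  by move=> A B AB; rewrite lee_fin; exact: mustar_mono.
have musig : sigma_subadditive muE by exact: mustar_sigma.
pose mo : {outer_measure set Om -> \bar R} :=
  HB.pack muE (isOuterMeasure.Build R Om muE mu0 muge mumono musig).
have car A : (measurable (A : set (Borel Om)) -> mo.-caratheodory A)%classic.
  move: A; apply: smallest_sub.
    split; first exact: caratheodory_measurable_set0.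
      by move=> A cA; rewrite setTD; exact: caratheodory_measurable_setC.
    exact: caratheodory_measurable_bigcup.
  move=> A oA; rewrite -[A]setCK; apply: caratheodory_measurable_setC.
  apply: le_caratheodory_measurable => X; rewrite -EFinD lee_fin.
  by apply: mustar_closed => //; exact: open_closedC.
pose nu (A : set (Borel Om)) : \bar R := muE A.
have nus : semi_sigma_additive nu.
  move=> F mF tF mU.
  exact: (@caratheodory_measure_sigma_additive R _ mo F (fun i => car _ (mF i)) tF (car _ mU)).
have nuT : nu setT = 1%E by rewrite /nu /muE mustarT.
pose mnu := isMeasure.Build _ _ _ nu mu0 muge nus.
pose nuM : {measure set (Borel Om) -> \bar R} := HB.pack nu mnu.
pose P : probability (Borel Om) R :=
  HB.pack (Measure.sort nuM) (Measure_isProbability.Build _ (Borel Om) R nuM nuT).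
by exists P.
Qed.

End BorelMeasure.

Section Representation.
Context {R : realType} {Om : pseudoPMetricType R}.
Variable L : (Om -> R) -> R.
Hypothesis cptOm : compact [set: Om].
Hypothesis Llin : lin cts L.
Hypothesis Lpos : forall f : Om -> R, continuous f -> (forall w, 0 <= f w) -> 0 <= L f.
Hypothesis L1 : L (fun=> 1) = 1.
Variable m : probability (Borel Om) R.
Hypothesis mE : forall A, m A = (mustar L A)%:E.

Let I (f : Om -> R) : R := Rintegral m setT (f : Borel Om -> R).
Let Ilin : lin cts I. Proof. exact: integral_lin. Qed.
Let Ipos (f : Om -> R) : continuous f -> (forall w, 0 <= f w) -> 0 <= I f.
Proof. exact: integral_pos. Qed.
Let I1 : I (fun=> 1) = 1.
Proof. by rewrite /I integral_cst1// probability_setT. Qed.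

Let layer (N : nat) (f : Om -> R) (i : nat) (w : Om) : R :=
  Num.max 0 (Num.min 1 (N%:R * f w - i%:R)).

Let layer_cts N (f : Om -> R) i : continuous f -> continuous (layer N f i).
Proof.
move=> cf; apply: ctsmax; first exact: ctsC.
apply: ctsmin; first exact: ctsC.
by apply: ctsB; [apply: ctsM => //; exact: ctsC|exact: ctsC].
Qed.

Let layer_ge0 N f i w : 0 <= layer N f i w.
Proof. by rewrite /layer le_max lexx. Qed.

Let layer_le1 N f i w : layer N f i w <= 1.
Proof. by rewrite /layer ge_max ler01 ge_min lexx. Qed.

Let layer_sum N (f : Om -> R) w : (forall w, 0 <= f w <= 1) ->
  \sum_(i < N) layer N f i w = N%:R * f w.
Proof.
move=> f01; have [f0 f1] := andP (f01 w).
suff H n : \sum_(i < n) layer N f i w = Num.min (N%:R * f w) n%:R.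
  by rewrite H; apply/min_idPl; rewrite -[leRHS]mulr1 ler_wpM2l.
have y0 : 0 <= N%:R * f w by rewrite mulr_ge0.
elim: n => [|n IH]; first by rewrite big_ord0 min_r.
rewrite big_ord_recr/= IH /layer -natr1; set y := _ * _ in y0 *.
have n0 : (0 : R) <= n%:R by [].
by case: (leP y n%:R) => h1; case: (leP 1 (y - n%:R)) => h2;
  case: (leP y (n%:R + 1)) => h3; case: leP => h4; lra.
Qed.

(* The sets [f >= (i+1)/N] interlace the layers: their measure dominates the
   integral of layer [i+1] and is at most the functional of layer [i]. *)
Let layer_le N (f : Om -> R) i : continuous f -> I (layer N f i.+1) <= L (layer N f i).
Proof.
move=> cf; pose A : set (Borel Om) := [set w | i.+1%:R <= N%:R * f w].
have mA : measurable A.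
  apply: closed_borel; apply: (@preimage_closed _ _ (fun w => N%:R * f w) [set x | i.+1%:R <= x]).
    by move=> w _; apply: ctsM => //; exact: ctsC.
  exact: closed_ge.
apply: (@le_trans _ _ (fine (m A))); last first.
  rewrite mE; apply: mustar_le => //; apply: coverable_fun => //; first exact: layer_cts.
  move=> w; rewrite /A/= -natr1 => h; rewrite /layer le_max le_min lexx/=; apply/orP; right; lra.
rewrite /I (@integral_setIC _ _ cptOm m A)//; last exact: layer_cts.
have -> : Rintegral m (~` A) (layer N f i.+1 : Borel Om -> R) = 0.
  transitivity (Rintegral m (~` A) (fun=> 0)); last first.
    by rewrite Rintegral_cst ?mul0r//; exact: measurableC.
  apply: eq_Rintegral => w.
  rewrite inE/= => /negP; rewrite -ltNge => h; rewrite /layer; apply/max_idPl.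
  by rewrite ge_min; apply/orP; right; lra.
rewrite addr0 -integral_cst1//; apply: le_Rintegral => //.
- by apply: cts_integrable => //; exact: layer_cts.
- by apply: (@cts_integrable _ _ cptOm m A (fun=> 1)) => //; exact: ctsC.
- by move=> w _; exact: layer_le1.
Qed.

Let I_le_01 (f : Om -> R) : continuous f -> (forall w, 0 <= f w <= 1) -> I f <= L f.
Proof.
move=> cf f01; apply/ler_addgt0Pr => e e0.
pose N := (Num.truncn e^-1).+1.
have N0 : (0 : R) < N%:R by rewrite ltr0n.
have eN : N%:R^-1 <= e.
  rewrite -[leRHS]invrK lef_pV2 ?posrE ?invr_gt0//.
  have g1 : 0 <= e^-1 by rewrite invr_ge0 ltW.
  by have /andP[_ /ltW] := truncn_itv g1.
have fE (J : (Om -> R) -> R) : lin cts J -> N%:R * J f = \sum_(i < N) J (layer N f i).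
  move=> Jl; rewrite -(lin_sum Jl N (fun i => layer_cts (N := N) (i := i) cf)) -Jl.2//.
  by congr J; apply/funext => w; rewrite fct_sumE layer_sum.
rewrite -(ler_pM2l N0) mulrDr fE// (fE L)//.
apply: (@le_trans _ _ (1 + \sum_(i < N) L (layer N f i))); last first.
  by rewrite addrC lerD2l -ler_pdivrMl// mulr1.
rewrite /N [leLHS]big_ord_recl/= -I1; apply: lerD.
  apply: lin_le => //; [exact: layer_cts|exact: ctsC].
rewrite [leRHS]big_ord_recr/= -[leLHS]addr0; apply: lerD.
  by apply: ler_sum => i _; exact: layer_le.
by apply: Lpos => //; exact: layer_cts.
Qed.

Lemma riesz_representation (f : Om -> R) : continuous f -> I f = L f.
Proof.
move=> cf; have [M M0 HM] := cts_bounded cptOm cf.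
pose g w := (2 * M)^-1 * (f w + M).
have cg : continuous g.
  by apply: ctsM; [exact: ctsC|apply: ctsD => //; exact: ctsC].
have g01 w : 0 <= g w <= 1.
  have := HM w; rewrite ler_norml => /andP[h1 h2]; rewrite /g.
  have M2 : 0 < 2 * M by lra.
  have M3 : 0 <= (2 * M)^-1 by rewrite invr_ge0 ltW.
  by rewrite ler_pdivrMl// mulr1; apply/andP; split; [apply: mulr_ge0 => //; lra|lra].
have h1 := I_le_01 cg g01.
have cC (k : R) : continuous (fun _ : Om => k) by exact: ctsC.
have h2 : I (fun w => 1 - g w) <= L (fun w => 1 - g w).
  apply: I_le_01; first exact: ctsB.
  by move=> w; have := g01 w => /andP[a b]; apply/andP; split; lra.
have sub (J : (Om -> R) -> R) : lin cts J -> J (fun=> 1) = 1 ->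
    J (fun w => 1 - g w) = 1 - J g.
  move=> Jl J1; rewrite -[X in _ = X - _]J1 -(@linB _ _ cts) //.
  by move=> k h ch; exact: (ctsM (@ctsC _ _ k)).
rewrite !sub// in h2.
have gE : I g = L g by apply/eqP; rewrite eq_le h1/=; lra.
have fE (J : (Om -> R) -> R) : lin cts J -> J (fun=> 1) = 1 -> J f = 2 * M * J g - M.
  move=> Jl J1.
  have -> : f = ((2 * M) *: g) + ((- M) *: (fun=> 1)).
    apply/funext => w; rewrite -[RHS]/(2 * M * ((2 * M)^-1 * (f w + M)) + (- M) * 1).
    by field; rewrite gt_eqF.
  have c1 : continuous ((2 * M) *: g) by exact: (ctsM (@ctsC _ _ (2 * M)) cg).
  have c2 : continuous ((- M) *: (fun=> 1) : Om -> R) by exact: (ctsM (@ctsC _ _ (- M))).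
  by rewrite (Jl.1 _ _ c1 c2) (Jl.2 _ _ cg) (Jl.2 _ _ (cC 1)) J1 mulr1.
by rewrite (fE I)// (fE L)// gE.
Qed.

End Representation.

(** * Uniform ergodic averages *)

Section RintLemmas.
Context {R : realType}.
Implicit Types (f g : R -> R) (s t : R).

Lemma deriv_lip f (df : R -> R) (M a b : R) : (forall r : R, is_derive r 1 f (df r)) ->
  (forall r, `|df r| <= M) -> `|f a - f b| <= M * `|a - b|.
Proof.
move=> Hf HM; wlog ab : a b / a <= b => [hw|].
  have [/hw//|/ltW/hw] := leP a b; by rewrite distrC (distrC b).
rewrite distrC (distrC a) (ger0_norm (_ : 0 <= b - a)) ?subr_ge0// ler_norml.
have dl (k r : R) : is_derive r 1 (fun t : R => k * t) k.
  by apply: is_derive_eq (is_derive_scalef k (is_derive_idf r)) _; rewrite mulr1.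
have h1 := @deriv_le _ f (fun t => M * t) df (fun=> M) a b ab
  (fun r _ => Hf r) (fun r _ => dl M r).
have h2 := @deriv_le _ (fun t => (- M) * t) f (fun=> - M) df a b ab
  (fun r _ => dl (- M) r) (fun r _ => Hf r).
apply/andP; split.
  apply: le_trans (h2 _) => [|r _]; first lra.
  by have := HM r; rewrite ler_norml => /andP[].
by apply: le_trans (h1 _) _ => [r _|]; [exact: le_trans (ler_norm _) (HM r)|lra].
Qed.

Lemma RintD f g s t : s <= t -> continuous f -> continuous g ->
  Rint s t (fun r => f r + g r) = Rint s t f + Rint s t g.
Proof.
move=> st cf cg; rewrite (primitiveE cf st) (primitiveE cg st).
transitivity ((primitive f t + primitive g t) - (primitive f s + primitive g s)); last by ring.
apply: (Rint_primitive (H := fun r => primitive f r + primitive g r) st).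
  exact: ctsD.
by move=> r _; apply: is_derive_addf; exact: is_derive_primitive.
Qed.

Lemma RintZ (k : R) f s t : s <= t -> continuous f ->
  Rint s t (fun r => k * f r) = k * Rint s t f.
Proof.
move=> st cf; rewrite (primitiveE cf st).
transitivity (k * primitive f t - k * primitive f s); last by ring.
apply: (Rint_primitive (H := fun r => k * primitive f r) st).
  by apply: ctsM => //; exact: ctsC.
by move=> r _; apply: is_derive_scalef; exact: is_derive_primitive.
Qed.

Lemma Rint_cst (k s t : R) : s <= t -> Rint s t (fun=> k) = k * (t - s).
Proof.
move=> st; transitivity (k * t - k * s); last by ring.
apply: (Rint_primitive (H := fun r => k * r) st).
  exact: ctsC.
move=> r _; apply: is_derive_eq (is_derive_scalef k (is_derive_idf r)) _.
by rewrite mulr1.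
Qed.

Lemma le_Rint f g s t : s <= t -> continuous f -> continuous g ->
  (forall r, f r <= g r) -> Rint s t f <= Rint s t g.
Proof.
move=> st cf cg fg; rewrite (primitiveE cf st) (primitiveE cg st).
by apply: (deriv_le st) => r _; [exact: is_derive_primitive|exact: is_derive_primitive|].
Qed.

End RintLemmas.

Section Ergodic.
Context {R : realType} {Om : pseudoPMetricType R}.
Variable sig : R -> Om -> Om.
Hypothesis cptOm : compact [set: Om].
Hypothesis sigF : is_flow sig.

Lemma flow_cts2 : continuous (fun p : R * Om => sig p.1 p.2).
Proof. by case: sigF. Qed.

Lemma flow_cts t : continuous (sig t).
Proof.
apply: (cts_comp (h := fun p : R * Om => sig p.1 p.2) (k := fun w => (t, w))).
  exact: flow_cts2.
by apply: cts_pair => w; [exact: cvg_cst|exact: cvg_id].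
Qed.

Lemma orbit_cts w : continuous (sig ^~ w).
Proof.
apply: (cts_comp (h := fun p : R * Om => sig p.1 p.2) (k := fun t => (t, w))).
  exact: flow_cts2.
by apply: cts_pair => t; [exact: cvg_id|exact: cvg_cst].
Qed.

Lemma orbit_fun_cts (f : Om -> R) w : continuous f -> continuous (fun t => f (sig t w)).
Proof. by move=> cf; apply: (cts_comp cf); exact: orbit_cts. Qed.

Inductive cob : (Om -> R) -> Prop :=
| cob_gen (chi : Om -> R) s : continuous chi -> cob (fun w => chi (sig s w) - chi w)
| cob_add b1 b2 : cob b1 -> cob b2 -> cob (b1 + b2)
| cob_scale k b : cob b -> cob (k *: b).

Lemma cob_cts b : cob b -> continuous b.
Proof.
elim=> [chi s cchi|b1 b2 _ c1 _ c2|k b1 _ c1].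
- by apply: ctsB => //; apply: (cts_comp cchi); exact: flow_cts.
- exact: ctsD.
- exact: (ctsM (@ctsC _ _ k)).
Qed.

Lemma cob0 : cob 0.
Proof.
rewrite -(scale0r (fun w => (0 : R) - 0 : R)); apply: cob_scale.
apply: (@cob_gen (fun=> 0) 0); exact: ctsC.
Qed.

Lemma cob_bound b : cob b -> exists C, forall w s t, s <= t ->
  `|Rint s t (fun r => b (sig r w))| <= C.
Proof.
elim=> [chi a cchi|b1 b2 cb1 [C1 h1] cb2 [C2 h2]|k b1 cb1 [C1 h1]].
- have [M M0 HM] := cts_bounded cptOm cchi.
  exists (M * `|a| + M * `|a|) => w s t st.
  have ch := @orbit_fun_cts chi w cchi.
  pose X := primitive (fun r => chi (sig r w)).
  have Xd (r : R) : is_derive r 1 X (chi (sig r w)) by exact: is_derive_primitive.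
  have lip x : `|X (x + a) - X x| <= M * `|a|.
    by rewrite (le_trans (deriv_lip _ _ Xd (fun r => HM _)))// addrC addKr.
  have -> : Rint s t (fun r => chi (sig a (sig r w)) - chi (sig r w)) =
      (X (t + a) - X t) - (X (s + a) - X s); last first.
    exact: le_trans (ler_normB _ _) (lerD (lip t) (lip s)).
  apply: (Rint_primitive (H := fun r => X (r + a) - X r) st).
  + apply: ctsB => //; apply: (orbit_fun_cts (f := fun w => chi (sig a w))).
    by apply: (cts_comp cchi); exact: flow_cts.
  + move=> r _; apply: is_derive_subf => //.
    have [_ [_ sD]] := sigF; rewrite -sD addrC; exact: is_derive_shiftf.
- exists (C1 + C2) => w s t st.
  rewrite (@RintD _ (fun r => b1 (sig r w)) (fun r => b2 (sig r w)))//.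
  + exact: le_trans (ler_normD _ _) (lerD (h1 _ _ _ st) (h2 _ _ _ st)).
  + by apply: orbit_fun_cts; exact: cob_cts.
  + by apply: orbit_fun_cts; exact: cob_cts.
- exists (`|k| * C1) => w s t st.
  rewrite (@RintZ _ k (fun r => b1 (sig r w)))//; last first.
    by apply: orbit_fun_cts; exact: cob_cts.
  by rewrite normrM ler_wpM2l// h1.
Qed.

Lemma cob_average (f b : Om -> R) (M : R) : continuous f -> cob b ->
  (forall w, f w + b w <= M) -> exists C, forall w s t, s <= t ->
  Rint s t (fun r => f (sig r w)) <= M * (t - s) + C.
Proof.
move=> cf cb fb; have [C hC] := cob_bound cb; exists C => w s t st.
have cfo := @orbit_fun_cts f w cf; have cbo := @orbit_fun_cts b w (cob_cts cb).
have : Rint s t (fun r => f (sig r w) + b (sig r w)) <= M * (t - s).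
  rewrite -Rint_cst//; apply: le_Rint => //; [exact: ctsD|exact: ctsC].
rewrite RintD//; have := hC w s t st; rewrite ler_norml => /andP[h1 h2]; lra.
Qed.

Definition cob_set (f : Om -> R) : set R :=
  [set M | exists2 b, cob b & forall w, f w + b w <= M].

Definition cob_sup (f : Om -> R) : R := inf (cob_set f).

Let cob_set0 f : continuous f -> cob_set f !=set0.
Proof.
move=> cf; have [K _ HK] := cts_bounded cptOm cf.
exists K, 0; first exact: cob0.
by move=> w; rewrite -[_ + _]/(f w + 0) addr0 (le_trans (ler_norm _)).
Qed.

Lemma cob_set_lb f (K M : R) : continuous f -> (forall w, - K <= f w) -> cob_set f M ->
  - K <= M.
Proof.
move=> cf HK [b cb fb]; have [C hC] := cob_average cf cb fb.
rewrite leNgt; apply/negP => MK.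
have e0 : 0 < - K - M by rewrite subr_gt0.
pose T := (`|C| + 1) / (- K - M).
have T0 : 0 <= T by rewrite divr_ge0 ?(ltW e0)// addr_ge0.
have h1 := hC point 0 T T0.
have h2 : (- K) * (T - 0) <= Rint 0 T (fun r => f (sig r point)).
  by rewrite -Rint_cst//; apply: le_Rint => //; [exact: ctsC|exact: orbit_fun_cts].
have h3 : (- K - M) * T = `|C| + 1 by rewrite /T mulrC divfK// gt_eqF.
have := ler_norm C; lra.
Qed.

Let cob_set_has_lb f : continuous f -> has_lbound (cob_set f).
Proof.
move=> cf; have [K _ HK] := cts_bounded cptOm cf.
exists (- K) => M; apply: cob_set_lb => // w.
by have := HK w; rewrite ler_norml => /andP[].
Qed.

Lemma cob_sup_le f M b : continuous f -> cob b -> (forall w, f w + b w <= M) ->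
  cob_sup f <= M.
Proof.
move=> cf cb h; rewrite /cob_sup; apply: (ge_inf (cob_set_has_lb cf)).
by exists b.
Qed.

Lemma cob_sup_le0 f M : continuous f -> (forall w, f w <= M) -> cob_sup f <= M.
Proof.
move=> cf h; apply: (cob_sup_le cf cob0) => w.
by rewrite -[_ + _]/(f w + 0) addr0.
Qed.

Lemma ctsZ (k : R) (f : Om -> R) : continuous f -> continuous (k *: f).
Proof. exact: (ctsM (@ctsC _ _ k)). Qed.

Lemma ctsDf (f g : Om -> R) : continuous f -> continuous g -> continuous (f + g).
Proof. exact: ctsD. Qed.

Lemma cob_sup_sublin : sublin cts cob_sup.
Proof.
apply: (@sublin_inf _ _ cts ctsDf ctsZ _ cob_set) => //.
- move=> f g y z cf cg [b cb hb] [b' cb' hb'].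
  exists (y + z) => //; exists (b + b'); first exact: cob_add.
  by move=> w; have := hb w; have := hb' w;
     rewrite -[(f + g) w]/(f w + g w) -[(b + b') w]/(b w + b' w); lra.
- move=> k f y k0 cf [b cb hb]; exists (k *: b); first exact: cob_scale.
  move=> w; rewrite -[(k *: f) w]/(k * f w) -[(k *: b) w]/(k * b w) -mulrDr.
  by rewrite ler_pM2l.
Qed.

Lemma below_cob_sup (J : (Om -> R) -> R) : lin cts J ->
  (forall f : Om -> R, continuous f -> (forall w, 0 <= f w) -> 0 <= J f) ->
  J (fun=> 1) = 1 ->
  (forall (f : Om -> R) s, continuous f -> J (fun w => f (sig s w)) = J f) ->
  below cts J cob_sup.
Proof.
move=> Jl Jp J1 Ji f cf.
have Jb b : cob b -> J b = 0.
  elim=> [chi s cchi|b1 b2 cb1 h1 cb2 h2|k b1 cb1 h1].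
  - have c1 : continuous (fun w => chi (sig s w)).
      by apply: (cts_comp cchi); exact: flow_cts.
    by rewrite (linB ctsZ Jl c1 cchi) Ji// subrr.
  - by rewrite (Jl.1 _ _ (cob_cts cb1) (cob_cts cb2)) h1 h2 addr0.
  - by rewrite (Jl.2 _ _ (cob_cts cb1)) h1 mulr0.
apply: (lb_le_inf (cob_set0 cf)) => M [b cb hb].
have -> : J f = J (f + b) by rewrite (Jl.1 _ _ cf (cob_cts cb)) (Jb b cb) addr0.
have <- : J (M *: (fun=> 1)) = M by rewrite Jl.2 ?J1 ?mulr1//; exact: ctsC.
apply: (lin_le Jl Jp) => //; [exact: ctsD (cob_cts cb)|exact: (ctsZ (@ctsC _ _ 1))|].
by move=> w; rewrite -[leRHS]/(M * 1) mulr1; exact: hb.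
Qed.

Section ExtremalForm.
Variable L : (Om -> R) -> R.
Hypothesis Llin : lin cts L.
Hypothesis Lp : below cts L cob_sup.
Hypothesis Lext : forall L1 L2 (th : R), lin cts L1 -> lin cts L2 ->
  below cts L1 cob_sup -> below cts L2 cob_sup -> 0 < th < 1 ->
  below cts (fun f => th * L1 f + (1 - th) * L2 f) L -> below cts L1 L.

Let Lpos (f : Om -> R) : continuous f -> (forall w, 0 <= f w) -> 0 <= L f.
Proof.
move=> cf f0; have := Lp (ctsN cf); rewrite (linN Llin cf).
have : cob_sup (fun w => - f w) <= 0 by apply: cob_sup_le0 => [|w]; [exact: ctsN|rewrite oppr_le0].
lra.
Qed.

Let L1 : L (fun=> 1) = 1.
Proof.
have c1 : continuous (fun _ : Om => 1 : R) by exact: ctsC.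
have h1 := Lp c1. have h2 : cob_sup (fun=> 1) <= 1 by apply: cob_sup_le0.
have := Lp (ctsN c1); rewrite (linN Llin c1).
have h3 : cob_sup (fun=> - 1) <= - 1 by apply: cob_sup_le0 => //; exact: ctsC.
by move=> h4; apply/eqP; rewrite eq_le; apply/andP; split; lra.
Qed.

Let Linv (f : Om -> R) s : continuous f -> L (fun w => f (sig s w)) = L f.
Proof.
move=> cf; have cfs : continuous (fun w => f (sig s w)).
  by apply: (cts_comp cf); exact: flow_cts.
have H (k : R) : k * (L (fun w => f (sig s w)) - L f) <= 0.
  have cc : cob (fun w => f (sig s w) - f w) by exact: cob_gen.
  rewrite -(linB ctsZ Llin cfs cf) -(Llin.2 _ _ (cob_cts cc)).
  apply: le_trans (Lp (ctsZ (cob_cts cc))) _.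
  apply: (@cob_sup_le _ _ ((- k) *: (fun w => f (sig s w) - f w))).
  - exact: ctsZ (cob_cts cc).
  - exact: cob_scale.
  - by move=> w; rewrite -[_ + _]/(k * _ + - k * _) mulNr subrr.
by have := H 1; have := H (- 1); move=> a b; apply/eqP; rewrite eq_le; apply/andP; split; lra.
Qed.

Lemma extremal_ergodic : exists2 m : probability (Borel Om) R, erg_measure sig m &
  forall f : Om -> R, continuous f -> Rintegral m setT (f : Borel Om -> R) = L f.
Proof.
have [m mE] := riesz_measure cptOm Llin Lpos L1.
have IL (f : Om -> R) : continuous f -> Rintegral m setT (f : Borel Om -> R) = L f.
  exact: (riesz_representation cptOm Llin Lpos L1 mE).
exists m => //.
have minv t (A : set (Borel Om)) : measurable A -> m ((sig t) @^-1` A) = m A.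
  move=> mA; rewrite !mE; congr EFin.
  have cov s (A' : set Om) B : coverable L A' B -> coverable L ((sig s) @^-1` A') B.
    move=> [phi [c p i h l]]; exists (fun n w => phi n (sig s w)); split => //.
    - by move=> n; apply: (cts_comp (c n)); exact: flow_cts.
    - by move=> w Aw e e0; exact: h.
    - by move=> n; rewrite Linv.
  have [_ [s0 sD]] := sigF.
  apply/eqP; rewrite eq_le; apply/andP; split.
    by apply: (mustar_ge L1) => B hB; apply: (mustar_le Lpos); exact: cov.
  apply: (mustar_ge L1) => B hB; apply: (mustar_le Lpos).
  have -> : A = (sig (- t)) @^-1` ((sig t) @^-1` A).
    by apply/seteqP; split => w /=; rewrite -sD subrr s0.
  exact: cov.
split=> // A mA Ainv.
have mA1 : (m A <= 1)%E by exact: probability_le1.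
have mA0 : (0 <= m A)%E by exact: measure_ge0.
have [al alE] : exists al : R, m A = al%:E.
  by exists (fine (m A)); rewrite fineK// ge0_fin_numE// (le_lt_trans mA1)// ltry.
rewrite alE; rewrite alE !lee_fin in mA0 mA1.
have [->|al0] := eqVneq al 0; first by left.
have [->|al1] := eqVneq al 1; first by right.
have a0 : 0 < al by rewrite lt_neqAle eq_sym al0.
have a1 : al < 1 by rewrite lt_neqAle al1.
have mC : measurable (~` A) by exact: measurableC.
have mCE : m (~` A) = (1 - al)%:E by rewrite probability_setC// alE.
pose J (A : set (Borel Om)) (k : R) (f : Om -> R) := k^-1 * Rintegral m A (f : Borel Om -> R).
have Jlin (B : set (Borel Om)) k : measurable B -> lin cts (J B k).
  move=> mB; have [hD hZ] := integral_lin cptOm m mB; split=> [f g cf cg|c f cf].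
    by rewrite /J hD// mulrDr.
  by rewrite /J hZ//; ring.
have Jbelow (B : set (Borel Om)) k : measurable B -> m B = k%:E -> 0 < k ->
    (forall t, (sig t) @^-1` B = B) -> below cts (J B k) cob_sup.
  move=> mB mBk k0 Binv; apply: below_cob_sup; first exact: Jlin.
  - move=> f cf f0; rewrite /J mulr_ge0 ?invr_ge0 ?(ltW k0)//.
    exact: (integral_pos m mB cf f0).
  - by rewrite /J integral_cst1// mBk mulVf// gt_eqF.
  - move=> f s cf; congr (_ * _); apply: (@Rintegral_invariant _ _ cptOm m B f (sig s)) => //.
    + exact: flow_cts.
    + by move=> B' mB'; exact: minv.
have Cinv t : sig t @^-1` (~` A) = ~` A by rewrite -preimage_setC Ainv.
have al01 : 0 < al < 1 by rewrite a0.
have comb : below cts (fun f => al * J A al f + (1 - al) * J (~` A) (1 - al) f) L.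
  move=> f cf; rewrite /J !mulrA !mulfV ?mul1r; [|by rewrite gt_eqF ?subr_gt0|by rewrite gt_eqF].
  by rewrite -IL// -(integral_setIC cptOm m mA cf).
have JL : below cts (J A al) L.
  apply: (Lext (Jlin A al mA) (Jlin _ (1 - al) mC) _ _ al01 comb); first exact: Jbelow.
  by apply: Jbelow => //; rewrite subr_gt0.
suff : 1 <= al by rewrite leNgt a1.
have -> : al = mustar L A by have := alE; rewrite mE => -[].
apply: (mustar_ge L1) => B [phi [c p i s h]].
have := @integral_sup_ge _ _ cptOm m A phi (al * B) mA c p i s; rewrite alE lee_fin => hal.
suff : al * 1 <= al * B by rewrite ler_pM2l.
rewrite mulr1; apply: hal => n; rewrite -ler_pdivrMl//.
apply: le_trans (h n); exact: (JL _ (c n)).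
Qed.

End ExtremalForm.

Theorem ergodic_averages (u : nat -> Om -> R) (kap : R) :
  (forall n, continuous (u n)) -> (forall n w, u n.+1 w <= u n w) ->
  (forall m : probability (Borel Om) R, erg_measure sig m ->
     exists n, Rintegral m setT (u n : Borel Om -> R) < kap) ->
  exists n k' C, k' < kap /\ forall w s t, s <= t ->
    Rint s t (fun r => u n (sig r w)) <= k' * (t - s) + C.
Proof.
move=> cu du hm; apply: contrapT => nE.
have pu n : kap <= cob_sup (u n).
  rewrite leNgt; apply/negP => /inf_lt -/(_ (cob_set0 (cu n)))[M [b cb hb] Mk].
  by apply: nE; have [C hC] := cob_average (cu n) cb hb; exists n, M, C.
have mono n k w : (n <= k)%N -> u k w <= u n w.
  move=> nk; have h i v : - u i v <= - u i.+1 v by rewrite lerN2.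
  by have := phi_mono h w nk; rewrite lerN2.
have dec n k : (n <= k)%N -> cob_sup (u k - u n) <= 0.
  move=> nk; apply: cob_sup_le0; first exact: (ctsB (cu k) (cu n)).
  by move=> w; rewrite -[(u k - u n) w]/(u k w - u n w) subr_le0 mono.
have [L [Ll Lp Lk Lext]] :=
  exists_extremal (@cts0 R Om) ctsDf ctsZ cob_sup_sublin cu dec pu.
have [m erg mL] := extremal_ergodic Ll Lp Lext.
have [n] := hm m erg; by rewrite mL// ltNge Lk.
Qed.

End Ergodic.

(** * Gronwall inequalities and existence of solutions *)

Section Gronwall.
Context {R : realType}.
Implicit Types (u v z K : R -> R) (s t : R).

Lemma gronwall_le z dz K k s t : s <= t ->
  (forall r, s <= r <= t -> is_derive r 1 z (dz r)) ->
  (forall r, s <= r <= t -> is_derive r 1 K (k r)) ->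
  (forall r, s <= r <= t -> dz r <= k r * z r) ->
  z t <= z s * expR (K t - K s).
Proof.
move=> st Hz HK H.
have D r : s <= r <= t -> is_derive r 1 (fun r => - (z r * expR (- K r)))
    (- (z r * (- k r * expR (- K r)) + expR (- K r) * dz r)).
  move=> rst; apply: is_derive_oppf; apply: is_derive_mulf; first exact: Hz.
  by apply: is_derive_expf; apply: is_derive_oppf; exact: HK.
have h : - (z s * expR (- K s)) <= - (z t * expR (- K t)).
  apply: (deriv_ge0_le st D) => r rst.
  have e0 := expR_gt0 (- K r); have := H r rst; rewrite -subr_ge0 => h.
  by have := mulr_ge0 (ltW e0) h; lra.
rewrite lerN2 in h; have := ler_wpM2r (expR_ge0 (K t)) h.
by rewrite -!mulrA -!expRD addNr expR0 mulr1 (addrC (- K s)).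
Qed.

Lemma gronwall_ge z dz K k s t : s <= t ->
  (forall r, s <= r <= t -> is_derive r 1 z (dz r)) ->
  (forall r, s <= r <= t -> is_derive r 1 K (k r)) ->
  (forall r, s <= r <= t -> k r * z r <= dz r) ->
  z s * expR (K t - K s) <= z t.
Proof.
move=> st Hz HK H.
have := @gronwall_le (fun r => - z r) (fun r => - dz r) K k s t st.
rewrite mulNr lerN2; apply => // r rst; first by apply: is_derive_oppf; exact: Hz.
by rewrite mulrN lerN2 H.
Qed.

Lemma is_derive_linear (k r : R) : is_derive r 1 (fun t : R => k * t) k.
Proof. by apply: is_derive_eq (is_derive_scalef k (is_derive_idf r)) _; rewrite mulr1. Qed.

Let pos_eq0 (x c : R) : Num.max x 0 ^+ 2 <= 0 * c -> x <= 0.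
Proof.
rewrite mul0r; have [//|x0] := leP x 0; rewrite expr2 => h.
by have := mulr_gt0 x0 x0; lra.
Qed.

Let max0_eq (x : R) : x <= 0 -> Num.max x 0 ^+ 2 = 0.
Proof. by move=> x0; rewrite max_r// expr0n. Qed.

Lemma comparison_fwd u v du dv L s t : s <= t ->
  (forall r, s <= r <= t -> is_derive r 1 u (du r)) ->
  (forall r, s <= r <= t -> is_derive r 1 v (dv r)) ->
  (forall r, s <= r <= t -> dv r - du r <= L * `|v r - u r|) ->
  v s <= u s -> v t <= u t.
Proof.
move=> st Hu Hv H vus.
pose E r := Num.max (v r - u r) 0 ^+ 2.
have := @gronwall_le E (fun r => (dv r - du r) * (2 * Num.max (v r - u r) 0))
  (fun r => 2 * L * r) (fun=> 2 * L) s t st.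
rewrite /E (max0_eq (_ : v s - u s <= 0)) ?subr_le0// => h.
rewrite -subr_le0; apply: pos_eq0 (h _ _ _) => r rst.
- apply: (is_derive_compf (u := fun x => Num.max x 0 ^+ 2) (v := fun r => v r - u r)).
    exact: is_derive_pos_sqr.
  by apply: is_derive_subf; [exact: Hv|exact: Hu].
- exact: is_derive_linear.
- have := H r rst; case: (leP (v r - u r) 0) => h0; first by rewrite expr2 !mulr0.
  rewrite ger0_norm; last exact: ltW.
  by rewrite -(ler_pM2r h0) expr2; lra.
Qed.

Lemma comparison_bwd u v du dv L s t : s <= t ->
  (forall r, s <= r <= t -> is_derive r 1 u (du r)) ->
  (forall r, s <= r <= t -> is_derive r 1 v (dv r)) ->
  (forall r, s <= r <= t -> dv r - du r <= L * `|v r - u r|) ->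
  u t <= v t -> u s <= v s.
Proof.
move=> st Hu Hv H uvt.
have := @comparison_fwd (fun r => v (- r)) (fun r => u (- r)) (fun r => - dv (- r))
  (fun r => - du (- r)) L (- t) (- s).
rewrite !opprK lerN2; apply => // r /andP[h1 h2].
- by apply: is_derive_refl; apply: Hv; apply/andP; split; lra.
- by apply: is_derive_refl; apply: Hu; apply/andP; split; lra.
- have := H (- r); rewrite [`|u _ - _|]distrC opprK addrC; apply.
  by apply/andP; split; lra.
Qed.

Lemma gronwall_sqr u v du dv L d s t : s <= t -> 0 <= L ->
  (forall r, s <= r <= t -> is_derive r 1 u (du r)) ->
  (forall r, s <= r <= t -> is_derive r 1 v (dv r)) ->
  (forall r, s <= r <= t -> `|du r - dv r| <= L * `|u r - v r| + d) ->
  (u t - v t) ^+ 2 <= ((u s - v s) ^+ 2 + d ^+ 2) * expR ((2 * L + 1) * (t - s)) /\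
  (u s - v s) ^+ 2 <= ((u t - v t) ^+ 2 + d ^+ 2) * expR ((2 * L + 1) * (t - s)).
Proof.
move=> st L0 Hu Hv H.
pose E r := (u r - v r) * (u r - v r) + d ^+ 2.
pose dE r := ((u r - v r) * (du r - dv r) + (u r - v r) * (du r - dv r)) + 0.
have HE r : s <= r <= t -> is_derive r 1 E (dE r).
  move=> rst; have Hx := is_derive_subf (Hu r rst) (Hv r rst).
  exact: is_derive_addf (is_derive_mulf Hx Hx) (is_derive_cstf _ _).
have bound r : s <= r <= t -> `|dE r| <= (2 * L + 1) * E r.
  move=> rst; have := H r rst; rewrite /dE /E; set x := u r - v r; set y := du r - dv r.
  rewrite addr0 -mulr2n normrMn normrM => h.
  have x0 : 0 <= `|x| by []. have y0 : 0 <= `|y| by [].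
  have -> : x * x = `|x| * `|x| by rewrite -normrM ger0_norm// -expr2 sqr_ge0.
  have h1 : `|x| * `|y| <= `|x| * (L * `|x| + d) by rewrite ler_wpM2l.
  have h2 : 0 <= (`|x| - d) ^+ 2 by rewrite sqr_ge0.
  have h3 : 0 <= L * d ^+ 2 by rewrite mulr_ge0// sqr_ge0.
  by rewrite mulr2n; move: h1 h2 h3; rewrite !expr2; nra.
have kd (k : R) r : s <= r <= t -> is_derive r 1 (fun r => k * r) k.
  by move=> _; exact: is_derive_linear.
have d0 : 0 <= d ^+ 2 by rewrite sqr_ge0.
split.
  have := @gronwall_le E dE (fun r => (2 * L + 1) * r) _ s t st HE (kd (2 * L + 1)).
  rewrite -mulrBr /E -!expr2 => h; apply: le_trans (_ : (u t - v t) ^+ 2 + d ^+ 2 <= _).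
    by rewrite lerDl.
  by apply: h => r rst; apply: le_trans (ler_norm _) (bound r rst).
have := @gronwall_ge E dE (fun r => (- (2 * L + 1)) * r) _ s t st HE (kd (- (2 * L + 1))).
rewrite -mulrBr /E -!expr2 => h.
apply: le_trans (_ : (u s - v s) ^+ 2 + d ^+ 2 <= _); first by rewrite lerDl.
rewrite -ler_pdivrMr ?expR_gt0// -expRN -mulNr; apply: h => r rst.
have := bound r rst; rewrite ler_norml => /andP[h1 _]; move: h1; rewrite /E -expr2; lra.
Qed.

End Gronwall.

Section Picard.
Context {R : realType}.

Lemma half_pow_small (x c : R) : (forall n : nat, `|x| <= c / 2 ^+ n) -> x = 0.
Proof.
move=> H; apply/eqP; rewrite -normr_eq0 eq_le normr_ge0 andbT leNgt; apply/negP => x0.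
pose n := (Num.truncn (c / `|x|)).+1.
have c0 : 0 <= c by have := H 0%N; rewrite expr0 divr1; exact: le_trans.
have p0 : (0 : R) < 2 ^+ n by rewrite exprn_gt0.
have : c < `|x| * 2 ^+ n.
  rewrite -ltr_pdivrMl// mulrC.
  have /andP[_ h] := truncn_itv (divr_ge0 c0 (normr_ge0 x)).
  apply: lt_le_trans h _; rewrite -natrX ler_nat; exact: ltnW (ltn_expl _ _).
by rewrite ltNge -ler_pdivlMr// H.
Qed.

Lemma geometric_limit (y : nat -> R) (c : R) :
  (forall n, `|y n.+1 - y n| <= c / 2 ^+ n) ->
  exists l, forall n, `|l - y n| <= 2 * c / 2 ^+ n.
Proof.
move=> H.
have c0 : 0 <= c by have := H 0%N; rewrite expr0 divr1; exact: le_trans.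
pose a n := y n - 2 * c / 2 ^+ n; pose b n := y n + 2 * c / 2 ^+ n.
have step n : 2 * c / 2 ^+ n = 2 * (c / 2 ^+ n) /\ 2 * c / 2 ^+ n.+1 = c / 2 ^+ n.
  by split; rewrite ?exprS; have : (2 : R) ^+ n != 0 by [rewrite expf_neq0|rewrite expf_neq0];
     move=> h; field.
have am n k : a n <= a (n + k)%N.
  elim: k => [|k IH]; first by rewrite addn0.
  apply: le_trans IH _; rewrite addnS /a; have [-> ->] := step (n + k)%N.
  by have := H (n + k)%N; rewrite ler_norml => /andP[h1 h2]; lra.
have bm n k : b (n + k)%N <= b n.
  elim: k => [|k IH]; first by rewrite addn0.
  apply: le_trans IH; rewrite addnS /b; have [-> ->] := step (n + k)%N.
  by have := H (n + k)%N; rewrite ler_norml => /andP[h1 h2]; lra.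
have ab n m : a n <= b m.
  apply: le_trans (am n m) _; apply: le_trans (bm m n); rewrite addnC /a /b.
  by rewrite lerD2l (@le_trans _ _ 0)// ?oppr_le0 divr_ge0// ?mulr_ge0// exprn_ge0.
exists (sup [set a n | n in setT]) => n.
have hs : has_ubound [set a n | n in setT] by exists (b 0%N) => _ [k _ <-].
have s1 : a n <= sup [set a n | n in setT] by apply: ub_le_sup => //; exists n.
have s2 : sup [set a n | n in setT] <= b n.
  by apply: ge_sup; [exists (a 0%N); exists 0%N|move=> _ [k _ <-]].
by rewrite ler_norml; move: s1 s2; rewrite /a /b; lra.
Qed.

Variables (F : R -> R -> R) (L B : R).
Hypothesis Fc : forall u : R -> R, continuous u -> continuous (fun t => F t (u t)).
Hypothesis L0 : 0 < L.
Hypothesis Flip : forall t x y, `|F t x - F t y| <= L * `|x - y|.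
Hypothesis FB : forall t x, `|F t x| <= B.

Let weighted (u du : R -> R) (s c t : R) : u s = 0 -> 0 <= c ->
  (forall r : R, is_derive r 1 u (du r)) ->
  (forall r, `|du r| <= L * (c * expR (2 * L * `|r - s|))) ->
  `|u t| <= c / 2 * expR (2 * L * `|t - s|).
Proof.
move=> us c0 Hu H.
have c2 : 0 <= c / 2 by rewrite divr_ge0.
have [st|ts] := leP s t.
  have D : forall r : R, is_derive r 1 (fun r => c / 2 * expR (2 * L * (r - s)))
      (c / 2 * (2 * L * (1 - 0) * expR (2 * L * (r - s)))).
    move=> r; exact: is_derive_scalef (is_derive_expf (is_derive_scalef _
      (is_derive_subf (is_derive_idf r) (is_derive_cstf s r)))).
  have B1 r : s <= r <= t -> `|du r| <= c / 2 * (2 * L * (1 - 0) * expR (2 * L * (r - s))).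
    move=> /andP[sr _]; have := H r; rewrite (ger0_norm (_ : 0 <= r - s)) ?subr_ge0//; lra.
  have e0 : 0 <= c / 2 * expR (2 * L * (s - s)) by rewrite mulr_ge0// expR_ge0.
  rewrite (ger0_norm (_ : 0 <= t - s)) ?subr_ge0// ler_norml; apply/andP; split.
    have := @deriv_le _ (fun r => - u r) _ (fun r => - du r) _ s t st
       (fun r _ => is_derive_oppf (Hu r)) (fun r _ => D r).
    move=> h; have := h _; rewrite us => h'.
    suff : - u t - - 0 <= c / 2 * expR (2 * L * (t - s)) - c / 2 * expR (2 * L * (s - s)) by lra.
    apply: h' => r rst; apply: le_trans (B1 r rst).
    by rewrite -normrN ler_norm.
  have := @deriv_le _ u _ du _ s t st (fun r _ => Hu r) (fun r _ => D r).
  rewrite us => h.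
  suff : u t - 0 <= c / 2 * expR (2 * L * (t - s)) - c / 2 * expR (2 * L * (s - s)) by lra.
  by apply: h => r rst; apply: le_trans (B1 r rst); rewrite ler_norm.
have {}ts := ltW ts.
have D : forall r : R, is_derive r 1 (fun r => - (c / 2 * expR (2 * L * (s - r))))
    (- (c / 2 * (2 * L * (0 - 1) * expR (2 * L * (s - r))))).
  move=> r; exact: is_derive_oppf (is_derive_scalef _ (is_derive_expf (is_derive_scalef _
    (is_derive_subf (is_derive_cstf s r) (is_derive_idf r))))).
have B1 r : t <= r <= s -> `|du r| <= - (c / 2 * (2 * L * (0 - 1) * expR (2 * L * (s - r)))).
  move=> /andP[_ rs]; have := H r; rewrite distrC (ger0_norm (_ : 0 <= s - r)) ?subr_ge0//; lra.
have e0 : 0 <= c / 2 * expR (2 * L * (s - s)) by rewrite mulr_ge0// expR_ge0.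
rewrite distrC (ger0_norm (_ : 0 <= s - t)) ?subr_ge0// ler_norml; apply/andP; split.
  have := @deriv_le _ u _ du _ t s ts (fun r _ => Hu r) (fun r _ => D r).
  rewrite us => h.
  suff : 0 - u t <= - (c / 2 * expR (2 * L * (s - s))) - - (c / 2 * expR (2 * L * (s - t))) by lra.
  by apply: h => r rst; apply: le_trans (B1 r rst); rewrite ler_norm.
have := @deriv_le _ (fun r => - u r) _ (fun r => - du r) _ t s ts
   (fun r _ => is_derive_oppf (Hu r)) (fun r _ => D r).
rewrite us => h.
suff : - 0 - - u t <= - (c / 2 * expR (2 * L * (s - s))) - - (c / 2 * expR (2 * L * (s - t))) by lra.
by apply: h => r rst; apply: le_trans (B1 r rst); rewrite -normrN ler_norm.
Qed.

Theorem picard (s x0 : R) : exists u : R -> R,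
  u s = x0 /\ forall t : R, is_derive t 1 u (F t (u t)).
Proof.
pose step (y : R -> R) t := x0 + (primitive (fun r => F r (y r)) t - primitive (fun r => F r (y r)) s).
have stepd y : continuous y -> forall t : R, is_derive t 1 (step y) (F t (y t)).
  move=> cy t; apply: is_derive_eq (is_derive_addf (is_derive_cstf _ _) (is_derive_subf
    (is_derive_primitive (Fc cy) t) (is_derive_cstf _ _))) _.
  by rewrite add0r subr0.
have steps y : step y s = x0 by rewrite /step subrr addr0.
pose y n := iter n step (fun=> x0).
have yc n : continuous (y n).
  elim: n => [|n IH]; first exact: ctsC.
  by move=> t; apply: is_derive_cont (stepd _ IH t).
have yd : forall n (t : R), is_derive t 1 (y n.+1) (F t (y n t)) by move=> n t; apply: stepd.
have B0 : 0 <= B by apply: le_trans (FB 0 0).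
pose D := B / (2 * L).
have D0 : 0 <= D by rewrite divr_ge0// mulr_ge0// ltW.
have dist n t : `|y n.+1 t - y n t| <= (D * expR (2 * L * `|t - s|)) / 2 ^+ n.
  elim: n t => [|n IH] t.
    rewrite expr0 divr1; apply: le_trans (_ : B * `|t - s| <= _).
      have := deriv_lip t s (yd 0%N) (fun r => FB _ _).
      by rewrite /y/= steps.
    have := expR_ge1Dx (2 * L * `|t - s|) => h.
    rewrite /D -mulrA; apply: ler_wpM2l => //.
    by rewrite [leRHS]mulrC ler_pdivlMr ?mulr_gt0//; lra.
  have -> : D * expR (2 * L * `|t - s|) / 2 ^+ n.+1 = D / 2 ^+ n / 2 * expR (2 * L * `|t - s|).
    by rewrite exprS; have : (2 : R) ^+ n != 0 by [rewrite expf_neq0]; move=> h; field.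
  have H1 : forall r : R, is_derive r 1 (fun r => y n.+2 r - y n.+1 r) (F r (y n.+1 r) - F r (y n r)).
    by move=> r; exact: is_derive_subf (yd n.+1 r) (yd n r).
  apply: (@weighted (fun r => y n.+2 r - y n.+1 r) _ s (D / 2 ^+ n) t _ _ H1).
  - by rewrite /y/= !steps subrr.
  - by rewrite divr_ge0// exprn_ge0.
  - move=> r; apply: le_trans (Flip _ _ _) _; rewrite ler_pM2l//.
    by apply: le_trans (IH r) _; rewrite mulrAC.
have /choice[u hu] : forall t, exists l, forall n,
    `|l - y n t| <= 2 * (D * expR (2 * L * `|t - s|)) / 2 ^+ n.
  by move=> t; apply: (@geometric_limit (y ^~ t)) => n; exact: dist.
have ulip t t' : `|u t - u t'| <= B * `|t - t'|.
  rewrite -subr_le0 leNgt; apply/negP => h0.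
  pose e := `|u t - u t'| - B * `|t - t'|; rewrite -/e in h0.
  have /half_pow_small e00 : forall n, `|e| <=
      (2 * (D * expR (2 * L * `|t - s|)) + 2 * (D * expR (2 * L * `|t' - s|))) * 2 / 2 ^+ n.
    move=> n; rewrite (gtr0_norm h0) /e.
    have ly : `|y n.+1 t - y n.+1 t'| <= B * `|t - t'|.
      exact: (deriv_lip _ _ (yd n) (fun r => FB _ _)).
    have h1 := hu t n.+1; have h2 := hu t' n.+1.
    have h3 : `|u t - u t'| <= `|u t - y n.+1 t| + `|y n.+1 t - y n.+1 t'| + `|u t' - y n.+1 t'|.
      have -> : u t - u t' = (u t - y n.+1 t) + (y n.+1 t - y n.+1 t') - (u t' - y n.+1 t') by ring.
      apply: le_trans (ler_normB _ _) _; rewrite lerD2r; exact: ler_normD.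
    have p0 : (0 : R) <= (2 ^+ n)^-1 by rewrite invr_ge0 exprn_ge0.
    have e1 : 0 <= D * expR (2 * L * `|t - s|) / 2 ^+ n.+1.
      by rewrite divr_ge0 ?exprn_ge0// mulr_ge0// expR_ge0.
    have e2 : 0 <= D * expR (2 * L * `|t' - s|) / 2 ^+ n.+1.
      by rewrite divr_ge0 ?exprn_ge0// mulr_ge0// expR_ge0.
    have -> : (2 * (D * expR (2 * L * `|t - s|)) + 2 * (D * expR (2 * L * `|t' - s|))) * 2 / 2 ^+ n
      = 4 * (2 * (D * expR (2 * L * `|t - s|)) / 2 ^+ n.+1 + 2 * (D * expR (2 * L * `|t' - s|)) / 2 ^+ n.+1).
      by rewrite exprS; have : (2 : R) ^+ n != 0 by [rewrite expf_neq0]; move=> h; field.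
    lra.
  by rewrite e00 ltxx in h0.
have uc : continuous u.
  move=> t; apply/cvgrPdist_le => e e0.
  have B1 : 0 < B + 1 by lra.
  apply: (nearR (divr_gt0 e0 B1)) => t' htt'.
  apply: le_trans (ulip _ _) _; rewrite distrC.
  have := htt'; rewrite ltr_pdivlMr// => h; have : 0 <= `|t' - t| by []; nra.
have uE : u = step u.
  apply/funext => t; apply/eqP; rewrite -subr_eq0; apply/eqP.
  apply: (@half_pow_small _ (2 * (D * expR (2 * L * `|t - s|)))) => n.
  have h1 := hu t n.+1.
  have h2 : `|step u t - y n.+1 t| <= (2 * D / 2 ^+ n) / 2 * expR (2 * L * `|t - s|).
    have H1 : forall r : R, is_derive r 1 (fun r => step u r - y n.+1 r) (F r (u r) - F r (y n r)).
      by move=> r; exact: is_derive_subf (stepd _ uc r) (yd n r).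
    apply: (@weighted (fun r => step u r - y n.+1 r) _ s (2 * D / 2 ^+ n) t _ _ H1).
    - by rewrite steps /y/= steps subrr.
    - by rewrite divr_ge0 ?exprn_ge0// mulr_ge0.
    - move=> r; apply: le_trans (Flip _ _ _) _; rewrite ler_pM2l//.
      apply: le_trans (hu r n) _; have : (2 : R) ^+ n != 0 by rewrite expf_neq0.
      by move=> h; rewrite le_eqVlt; apply/orP; left; apply/eqP; field.
  have h3 : `|u t - step u t| <= `|u t - y n.+1 t| + `|step u t - y n.+1 t|.
    have -> : u t - step u t = (u t - y n.+1 t) - (step u t - y n.+1 t) by ring.
    exact: ler_normB.
  apply: le_trans h3 _; apply: le_trans (lerD h1 h2) _.
  have : (2 : R) ^+ n != 0 by rewrite expf_neq0.
  by move=> h; rewrite exprS le_eqVlt; apply/orP; left; apply/eqP; field.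
exists u; split; first by rewrite uE steps.
move=> t; rewrite [X in is_derive _ _ X _]uE; exact: stepd.
Qed.

End Picard.

Section DecayingLinear.
Context {R : realType}.
Implicit Types (K k p w : R -> R).

Lemma exp_small (A g e : R) : 0 <= A -> 0 < g -> 0 < e ->
  exists2 T : R, 0 < T & forall t, T <= t -> A * expR (- (g * t)) <= e.
Proof.
move=> A0 g0 e0; exists ((A + 1) / (g * e)).
  by rewrite divr_gt0 ?mulr_gt0//; lra.
move=> t; rewrite ler_pdivrMr ?mulr_gt0// => h.
rewrite expRN ler_pdivrMr ?expR_gt0//.
have h1 := expR_ge1Dx (g * t).
have h2 : e * (1 + g * t) <= e * expR (g * t) by rewrite ler_pM2l.
have : t * (g * e) = e * (g * t) by ring.
lra.
Qed.

(* [K] is a primitive of [k]; the growth bound says that [w' = k w] is exponentially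
   stable, uniformly in the initial time. *)
Definition decays K (C g : R) := forall s t, s <= t -> K t - K s <= C - g * (t - s).

Lemma decay_le0 K k w dw C g W : 0 < g -> decays K C g ->
  (forall t : R, is_derive t 1 K (k t)) -> (forall t : R, is_derive t 1 w (dw t)) ->
  (forall t, w t <= W) -> (forall t, dw t <= k t * w t) -> forall t, w t <= 0.
Proof.
move=> g0 dK HK Hw bw H t; apply/ler_addgt0Pr => e e0; rewrite add0r.
have [T T0 HT] := @exp_small (`|W| * expR C) g e (mulr_ge0 (normr_ge0 _) (expR_ge0 _)) g0 e0.
have st : t - T <= t by lra.
have h := @gronwall_le _ w dw K k (t - T) t st (fun r _ => Hw r) (fun r _ => HK r) (fun r _ => H r).
apply: le_trans h _; apply: le_trans (HT T (lexx _)).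
apply: (@le_trans _ _ (`|W| * expR (K t - K (t - T)))).
  by rewrite ler_wpM2r ?expR_ge0// (le_trans (bw _))// ler_norm.
rewrite -mulrA ler_wpM2l// -expRD ler_expR.
by have := dK (t - T) t st; lra.
Qed.

Lemma bounded_forcing K k (q : R -> R) (C g Q : R) : 0 < g -> decays K C g ->
  (forall t : R, is_derive t 1 K (k t)) -> continuous q -> (forall t, 0 <= q t <= Q) ->
  exists p Cp, [/\ forall t : R, is_derive t 1 p (k t * p t + q t), 0 <= Cp &
    forall t, 0 <= p t <= Cp].
Proof.
move=> g0 dK HK cq q01.
have Q0 : 0 <= Q by have /andP[] := q01 0; exact: le_trans.
have cK : continuous K by move=> t; apply: is_derive_cont (HK t).
have ce : continuous (fun r => expR (- K r) * q r).
  apply: ctsM => //.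
  by apply: (cts_comp (h := expR)); [exact: continuous_expR|exact: ctsN].
pose J := primitive (fun r => expR (- K r) * q r).
have HJ : forall t : R, is_derive t 1 J (expR (- K t) * q t) by exact: is_derive_primitive.
have Jm s t : s <= t -> J s <= J t.
  move=> st; apply: (deriv_ge0_le st (fun r _ => HJ r)) => r _.
  by rewrite mulr_ge0 ?expR_ge0//; case/andP: (q01 r).
have Jb s t : s <= t -> J t - J s <= Q * expR (C - K t) / g.
  move=> st.
  have HW : forall r : R, is_derive r 1 (fun r => Q / g * expR (C - K t - g * (t - r)))
      (Q / g * ((0 - g * (0 - 1)) * expR (C - K t - g * (t - r)))).
    move=> r; exact: is_derive_scalef (is_derive_expf (is_derive_subf (is_derive_cstf _ _)
      (is_derive_scalef _ (is_derive_subf (is_derive_cstf t r) (is_derive_idf r))))).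
  have := deriv_le st (fun r _ => HJ r) (fun r _ => HW r).
  rewrite subrr mulr0 subr0 => h; apply: le_trans (h _) _.
    move=> r /andP[sr rt]; rewrite mulrA.
    have -> : Q / g * (0 - g * (0 - 1)) = Q by field; rewrite gt_eqF.
    have /andP[a1 a2] := q01 r; rewrite mulrC; apply: ler_pM => //; rewrite ?expR_ge0//.
    by rewrite ler_expR; have := dK r t rt; lra.
  rewrite mulrAC gerBl mulr_ge0 ?expR_ge0// divr_ge0// ltW//.
pose S := [set J s | s in setT].
have lbS t : lbound S (J t - Q * expR (C - K t) / g).
  move=> _ [s _ <-]; have [st|/ltW ts] := leP s t; first by have := Jb s t st; lra.
  have := Jm t s ts; have : 0 <= Q * expR (C - K t) / g.
    by rewrite divr_ge0 ?mulr_ge0 ?expR_ge0// ltW.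
  lra.
have S0 : S !=set0 by exists (J 0); exists 0.
pose j := inf S.
have hlb : has_lbound S by exists (J 0 - Q * expR (C - K 0) / g); exact: lbS.
have jJ t : j <= J t by apply: (ge_inf hlb); exists t.
have Jj t : J t - j <= Q * expR (C - K t) / g.
  by have := lb_le_inf S0 (lbS t); rewrite -/j; lra.
exists (fun t => expR (K t) * (J t - j)), (Q * expR C / g); split.
- move=> t; apply: is_derive_eq (is_derive_mulf (is_derive_expf (HK t))
    (is_derive_subf (HJ t) (is_derive_cstf j t))) _.
  by rewrite subr0 mulrA -expRD subrr expR0; ring.
- by rewrite divr_ge0 ?mulr_ge0 ?expR_ge0// ltW.
- move=> t; rewrite mulr_ge0 ?expR_ge0 ?subr_ge0//=.
  have := ler_wpM2l (expR_ge0 (K t)) (Jj t).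
  have -> : expR (K t) * (Q * expR (C - K t) / g) = Q * (expR (K t) * expR (C - K t)) / g by ring.
  by rewrite -expRD (_ : K t + (C - K t) = C)//; ring.
Qed.

Lemma bounded_forcing1 K k C g : 0 < g -> decays K C g ->
  (forall t : R, is_derive t 1 K (k t)) ->
  exists p Cp, [/\ forall t : R, is_derive t 1 p (k t * p t + 1), 0 <= Cp & forall t, 0 <= p t <= Cp].
Proof.
move=> g0 dK HK.
apply: (@bounded_forcing K k (fun=> 1) C g 1 g0 dK HK); first exact: ctsC.
by move=> t; rewrite ler01 lexx.
Qed.

Lemma grow_le0 K k w (dw : R -> R) (C g W : R) : 0 < g -> (forall s t, s <= t -> g * (t - s) - C <= K t - K s) ->
  (forall t : R, is_derive t 1 K (k t)) -> (forall t : R, is_derive t 1 w (dw t)) ->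
  (forall t, w t <= W) -> (forall t, k t * w t <= dw t) -> forall t, w t <= 0.
Proof.
move=> g0 dK HK Hw bw hw t.
have H1 : forall t : R, is_derive t 1 (fun t => K (- t)) (- k (- t)).
  by move=> r; exact: is_derive_refl (HK (- r)).
have H2 : forall t : R, is_derive t 1 (fun t => w (- t)) (- dw (- t)).
  by move=> r; exact: is_derive_refl (Hw (- r)).
have d1 : decays (fun t => K (- t)) C g.
  by move=> r r' rr; have := dK (- r') (- r); rewrite lerN2 => /(_ rr); lra.
have := @decay_le0 _ _ _ _ C g W g0 d1 H1 H2 (fun t => bw (- t)) _ (- t).
by rewrite opprK; apply => r; rewrite mulNr lerN2.
Qed.

End DecayingLinear.

Section ScalarEquation.
Context {R : realType}.
Implicit Types (h hx : R -> R -> R) (u v a b : R -> R) (lam s t x : R).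

Definition peqn h lam : R -> R -> R := fun t x => h t x + lam.

Record regular h hx : Prop := Regular {
  reg_d : forall t x : R, is_derive x 1 (h t) (hx t x);
  reg_c : forall u : R -> R, continuous u -> continuous (fun t => h t (u t));
  reg_cx : forall u : R -> R, continuous u -> continuous (fun t => hx t (u t));
  reg_b : forall M, exists B, forall t x, `|x| <= M -> `|h t x| <= B /\ `|hx t x| <= B;
  reg_u : forall M e, 0 < e -> exists2 d, 0 < d & forall t x y, `|x| <= M -> `|y| <= M ->
    `|x - y| <= d -> `|hx t x - hx t y| <= e }.

Definition lower_sol h lam v := exists dv : R -> R,
  [/\ forall t : R, is_derive t 1 v (dv t), forall t, dv t <= h t (v t) + lam &
      exists M, forall t, `|v t| <= M].

Section Regular.
Variables (h hx : R -> R -> R).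
Hypothesis reg : regular h hx.

Lemma slope_itv M t x y : `|x| <= M -> `|y| <= M -> x < y ->
  exists2 c, x < c < y & h t y - h t x = hx t c * (y - x) /\ `|c| <= M.
Proof.
rewrite !ler_norml => /andP[x1 x2] /andP[y1 y2] xy.
have [c /andP[c1 c2] E] := MVT_point xy (reg_d reg t).
by exists c; rewrite ?c1 ?c2//; split => //; rewrite ler_norml; lra.
Qed.

Lemma reg_lip M : exists2 L, 0 < L & forall t x y, `|x| <= M -> `|y| <= M ->
  `|h t x - h t y| <= L * `|x - y|.
Proof.
have [B HB] := reg_b reg M; exists (`|B| + 1); first by rewrite ltr_wpDl.
move=> t x y; wlog xy : x y / x < y => [hw xM yM|xM yM].
  have [xy|yx|->] := ltgtP x y; first exact: hw.
    by rewrite distrC (distrC x); exact: hw.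
  by rewrite !subrr normr0 mulr0.
have [c _ [E cM]] := slope_itv t xM yM xy.
rewrite distrC E normrM (distrC x) ler_wpM2r//.
by have := (HB t c cM).2; have := ler_norm B; lra.
Qed.

Lemma der_bounded_itv u (du : R -> R) s t : s <= t ->
  (forall r, s <= r <= t -> is_derive r 1 u (du r)) ->
  exists M, forall r, s <= r <= t -> `|u r| <= M.
Proof.
move=> st Hu; have cu : {within `[s, t], continuous u}.
  apply: continuous_in_subspaceT => r; rewrite inE/= in_itv/= => rst.
  exact: is_derive_cont (Hu _ rst).
have [c _ Hc] := EVT_max st cu; have [d _ Hd] := EVT_min st cu.
exists (Num.max `|u c| `|u d|) => r rst.
have h1 := Hc r; have h2 := Hd r; rewrite in_itv/= rst in h1 h2.
have {}h1 := h1 isT; have {}h2 := h2 isT.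
have h3 := ler_norm (u c); have h4 := ler_norm (- u d); rewrite normrN in h4.
have h5 : `|u c| <= Num.max `|u c| `|u d| by rewrite le_max lexx.
have h6 : `|u d| <= Num.max `|u c| `|u d| by rewrite le_max lexx orbT.
by rewrite ler_norml; apply/andP; split; lra.
Qed.

Lemma compare_lip lam u v (du dv : R -> R) s t : s <= t ->
  (forall r, s <= r <= t -> is_derive r 1 u (du r)) ->
  (forall r, s <= r <= t -> is_derive r 1 v (dv r)) ->
  (forall r, s <= r <= t -> h r (u r) + lam <= du r) ->
  (forall r, s <= r <= t -> dv r <= h r (v r) + lam) ->
  exists L, forall r, s <= r <= t -> dv r - du r <= L * `|v r - u r|.
Proof.
move=> st Hu Hv U V.
have [M1 h1] := der_bounded_itv st Hu; have [M2 h2] := der_bounded_itv st Hv.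
have [L L0 HL] := reg_lip (Num.max M1 M2).
exists L => r rst.
have := HL r (v r) (u r); rewrite !le_max h1// h2// orbT => /(_ isT isT).
have := U r rst; have := V r rst; have := ler_norm (h r (v r) - h r (u r)); lra.
Qed.

Lemma compare_fwd lam u v (du dv : R -> R) s t : s <= t ->
  (forall r, s <= r <= t -> is_derive r 1 u (du r)) ->
  (forall r, s <= r <= t -> is_derive r 1 v (dv r)) ->
  (forall r, s <= r <= t -> h r (u r) + lam <= du r) ->
  (forall r, s <= r <= t -> dv r <= h r (v r) + lam) ->
  v s <= u s -> v t <= u t.
Proof.
move=> st Hu Hv U V; have [L HL] := compare_lip st Hu Hv U V.
exact: comparison_fwd st Hu Hv HL.
Qed.

Lemma compare_bwd lam u v (du dv : R -> R) s t : s <= t ->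
  (forall r, s <= r <= t -> is_derive r 1 u (du r)) ->
  (forall r, s <= r <= t -> is_derive r 1 v (dv r)) ->
  (forall r, s <= r <= t -> h r (u r) + lam <= du r) ->
  (forall r, s <= r <= t -> dv r <= h r (v r) + lam) ->
  u t <= v t -> u s <= v s.
Proof.
move=> st Hu Hv U V; have [L HL] := compare_lip st Hu Hv U V.
exact: comparison_bwd st Hu Hv HL.
Qed.

Lemma sol_order lam u v s t :
  (forall r, Num.min s t <= r <= Num.max s t -> is_derive r 1 u (h r (u r) + lam)) ->
  (forall r, Num.min s t <= r <= Num.max s t -> is_derive r 1 v (h r (v r) + lam)) ->
  u s <= v s -> u t <= v t.
Proof.
have [st|/ltW ts] := leP s t => Hu Hv.
  exact: (compare_fwd (lam := lam) st Hv Hu (fun r _ => lexx _) (fun r _ => lexx _)).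
exact: (compare_bwd (lam := lam) ts Hu Hv (fun r _ => lexx _) (fun r _ => lexx _)).
Qed.

Lemma bsol_der lam u : bounded_solution (peqn h lam) u ->
  forall t : R, is_derive t 1 u (h t (u t) + lam).
Proof. by move=> [Hu _] t; exact: Hu. Qed.

Lemma bsol_le lam u v s t : bounded_solution (peqn h lam) u ->
  bounded_solution (peqn h lam) v -> u s <= v s -> u t <= v t.
Proof. by move=> /bsol_der Hu /bsol_der Hv; apply: sol_order => r _. Qed.

Lemma bsol_lt lam u v s t : bounded_solution (peqn h lam) u ->
  bounded_solution (peqn h lam) v -> u s < v s -> u t < v t.
Proof. by move=> Hu Hv; rewrite !ltNge; apply: contra => hl; exact: (bsol_le s Hv Hu hl). Qed.

Lemma bsol_lower lam lam' u : lam <= lam' -> bounded_solution (peqn h lam) u ->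
  lower_sol h lam' u.
Proof.
move=> ll Hu; exists (fun t => h t (u t) + lam); split; first exact: bsol_der.
  by move=> t; rewrite lerD2l.
by case: Hu.
Qed.

Definition clamp (K x : R) : R := Num.max (- K) (Num.min K x).

Lemma clamp_id K x : `|x| <= K -> clamp K x = x.
Proof. by rewrite ler_norml => /andP[h1 h2]; rewrite /clamp min_r// max_r. Qed.

Lemma clamp_bound K x : 0 <= K -> `|clamp K x| <= K.
Proof.
by move=> K0; rewrite /clamp ler_norml le_max lexx/= ge_max ge_min lexx/= andbT; lra.
Qed.

Lemma clamp_lip K x y : `|clamp K x - clamp K y| <= `|x - y|.
Proof.
have h1 (a z w : R) : `|Num.max a z - Num.max a w| <= `|z - w|.
  have := ler_norm (z - w); have := ler_norm (w - z); rewrite distrC => k1 k2.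
  rewrite ler_norml; move: (`|z - w|) k1 k2 => n k1 k2.
  by have [l1|l1] := leP a z; have [l2|l2] := leP a w; apply/andP; split; lra.
apply: le_trans (h1 _ _ _) _.
have := ler_norm (x - y); have := ler_norm (y - x); rewrite distrC => k1 k2.
rewrite ler_norml; move: (`|x - y|) k1 k2 => n k1 k2.
by have [l1|l1] := leP K x; have [l2|l2] := leP K y; apply/andP; split; lra.
Qed.

Lemma trunc_sol K lam s x : 0 <= K -> exists2 u, u s = x &
  forall t : R, is_derive t 1 u (h t (clamp K (u t)) + lam).
Proof.
move=> K0; have [L L0 HL] := reg_lip K; have [B HB] := reg_b reg K.
have cc (u : R -> R) : continuous u -> continuous (fun t => clamp K (u t)).
  by move=> cu; apply: ctsmax; [exact: ctsC|apply: ctsmin => //; exact: ctsC].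
have [||||u [us Hu]] := @picard R (fun t x => h t (clamp K x) + lam) L (B + `|lam|) _ _ _ _ s x.
- by move=> u cu; apply: ctsD; [exact: (reg_c reg (cc u cu))|exact: ctsC].
- by [].
- move=> t y z; rewrite opprD addrACA subrr addr0.
  apply: le_trans (HL _ _ _ (clamp_bound _ K0) (clamp_bound _ K0)) _.
  by rewrite ler_pM2l// clamp_lip.
- move=> t y; apply: le_trans (ler_normD _ _) _; rewrite lerD2r.
  by have [] := HB t _ (clamp_bound y K0).
by exists u.
Qed.

Lemma trunc_bsol K lam u : (forall t : R, is_derive t 1 u (h t (clamp K (u t)) + lam)) ->
  (forall t, `|u t| <= K) -> bounded_solution (peqn h lam) u.
Proof.
move=> Hu bu; split; last by exists K.
by move=> t _; rewrite /peqn -[X in h t X](clamp_id (bu t)); exact: Hu.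
Qed.

Lemma closed_sol N lam x : 0 <= N ->
  (forall e, 0 < e -> exists lam' u, [/\ `|lam' - lam| <= e, bounded_solution (peqn h lam') u,
     forall t, `|u t| <= N & `|u 0 - x| <= e]) ->
  exists u, [/\ bounded_solution (peqn h lam) u, forall t, `|u t| <= N, u 0 = x &
    forall t, exists2 k, 0 <= k & forall lam' v, bounded_solution (peqn h lam') v ->
      (forall r, `|v r| <= N) -> (u t - v t) ^+ 2 <= k * ((x - v 0) ^+ 2 + (lam - lam') ^+ 2)].
Proof.
move=> N0 H; have [u u0 Hu] := @trunc_sol N lam 0 x N0.
have [L L0 HL] := reg_lip N.
have key t : exists2 k, 0 <= k & forall lam' v, bounded_solution (peqn h lam') v ->
      (forall r, `|v r| <= N) -> (u t - v t) ^+ 2 <= k * ((x - v 0) ^+ 2 + (lam - lam') ^+ 2).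
  exists (expR ((2 * L + 1) * `|t|)); first exact: expR_ge0.
  move=> lam' v /bsol_der Hv bv; rewrite mulrC -u0.
  have bnd r : `|h r (clamp N (u r)) + lam - (h r (v r) + lam')| <=
      L * `|u r - v r| + `|lam - lam'|.
    have -> : h r (clamp N (u r)) + lam - (h r (v r) + lam') =
      (h r (clamp N (u r)) - h r (clamp N (v r))) + (lam - lam').
      by rewrite (clamp_id (bv r)); ring.
    apply: le_trans (ler_normD _ _) _; rewrite lerD2r.
    apply: le_trans (HL _ _ _ (clamp_bound _ N0) (clamp_bound _ N0)) _.
    by rewrite ler_pM2l// clamp_lip.
  have sq : `|lam - lam'| ^+ 2 = (lam - lam') ^+ 2 by rewrite real_normK// num_real.
  have [t0|/ltW t0] := leP 0 t.
    have [+ _] := gronwall_sqr t0 (ltW L0) (fun r _ => Hu r) (fun r _ => Hv r) (fun r _ => bnd r).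
    by rewrite sq subr0 (ger0_norm t0).
  have [_ +] := gronwall_sqr t0 (ltW L0) (fun r _ => Hu r) (fun r _ => Hv r) (fun r _ => bnd r).
  by rewrite sq sub0r (ler0_norm t0).
have bu t : `|u t| <= N.
  have [k k0 hk] := key t; apply/ler_addgt0Pr => e e0.
  have k1 : 0 < k * 2 + 1 by lra.
  pose d := Num.min 1 (e ^+ 2 / (k * 2 + 1)).
  have d0 : 0 < d by rewrite lt_min ltr01/= divr_gt0// exprn_gt0.
  have [lam' [v [h1 h2 h3 h4]]] := H d d0.
  have d1 : d <= 1 by rewrite ge_min lexx.
  have d2 : d * (k * 2 + 1) <= e ^+ 2 by rewrite -ler_pdivlMr// ge_min lexx orbT.
  have sqd (y : R) : `|y| <= d -> y ^+ 2 <= d.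
    move=> hy; rewrite -(real_normK (num_real y)) expr2.
    by apply: le_trans (ler_pM _ _ hy hy) _ => //; rewrite -[leRHS]mulr1 ler_pM2l.
  have q := hk lam' v h2 h3.
  have q1 : (x - v 0) ^+ 2 <= d by apply: sqd; rewrite distrC.
  have q2 : (lam - lam') ^+ 2 <= d by apply: sqd; rewrite distrC.
  have q3 : k * ((x - v 0) ^+ 2 + (lam - lam') ^+ 2) <= k * (d + d) by rewrite ler_wpM2l// lerD.
  have q4 : `|u t - v t| <= e.
    rewrite -(ler_pXn2r (n := 2))// ?nnegrE ?(ltW e0)// real_normK ?num_real//; lra.
  have -> : u t = v t + (u t - v t) by ring.
  by apply: le_trans (ler_normD _ _) (lerD (h3 t) q4).
by exists u; split => //; exact: trunc_bsol bu.
Qed.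

End Regular.
End ScalarEquation.

(** * Bounded solutions of concave scalar equations *)

Section Reflection.
Context {R : realType}.
Implicit Types (f h hx : R -> R -> R) (u v : R -> R) (lam s t x : R).

(* The symmetry (t, x) -> (-t, -x) preserves concavity in x and the sign of lam, and
   exchanges upper and lower bounded solutions, attraction and repulsion. *)
Definition refl_eq f : R -> R -> R := fun t x => f (- t) (- x).
Definition refl_dx hx : R -> R -> R := fun t x => - hx (- t) (- x).
Definition refl u : R -> R := fun t => - u (- t).

Lemma refl_eqK f : refl_eq (refl_eq f) = f.
Proof. by apply/funext => t; apply/funext => x; rewrite /refl_eq !opprK. Qed.

Lemma reflK u : refl (refl u) = u.
Proof. by apply/funext => t; rewrite /refl !opprK. Qed.

Lemma refl_der u (d : R) t : is_derive (- t) 1 u d -> is_derive t 1 (refl u) d.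
Proof.
by move=> H; apply: is_derive_eq (is_derive_oppf (is_derive_refl H)) _; rewrite opprK.
Qed.

Lemma refl_bsol f u : bounded_solution f u -> bounded_solution (refl_eq f) (refl u).
Proof.
move=> [Hu [M HM]]; split; last by exists M => t; rewrite normrN.
by move=> t _; rewrite /refl_eq opprK; apply: refl_der; exact: Hu.
Qed.

Lemma refl_bsolE f u : bounded_solution (refl_eq f) u -> bounded_solution f (refl u).
Proof. by move/refl_bsol; rewrite refl_eqK. Qed.

Lemma refl_upper f a : upper_bounded_solution (refl_eq f) a ->
  lower_bounded_solution f (refl a).
Proof.
move=> [Ha Hm]; split; first exact: refl_bsolE.
by move=> v /refl_bsol/Hm h t; have := h (- t); rewrite /refl opprK; lra.
Qed.

Lemma refl_open (al be : \bar R) t :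
  (- be < t%:E < - al)%E -> (al < (- t)%:E < be)%E.
Proof.
by move=> /andP[h1 h2]; rewrite EFinN; apply/andP; split; [rewrite lteNr|rewrite lteNl].
Qed.

Lemma refl_open' (al be : \bar R) t :
  (al < t%:E < be)%E -> (- be < (- t)%:E < - al)%E.
Proof. by move=> h; apply: refl_open; rewrite !oppeK. Qed.

Lemma refl_maximal f s x (al be : \bar R) u : is_maximal_solution (refl_eq f) s x al be u ->
  is_maximal_solution f (- s) (- x) (- be)%E (- al)%E (refl u).
Proof.
move=> [sab [us [Hu Hm]]]; split; first exact: refl_open'.
split; first by rewrite /refl opprK us.
split.
  move=> t /refl_open ht; have := Hu _ ht; rewrite /refl_eq opprK => h.
  exact: refl_der.
move=> a' b' v sab' vs Hv.
have [] := Hm (- b')%E (- a')%E (refl v).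
- by rewrite -[s]opprK; exact: refl_open'.
- by rewrite /refl vs opprK.
- move=> t /refl_open ht; rewrite /refl_eq opprK; apply: refl_der; exact: Hv.
by move=> h1 h2; split; [rewrite leeNl|rewrite leeNr].
Qed.

Lemma refl_blowup_right (al be : \bar R) u :
  blowup_right (- be)%E (- al)%E (refl u) -> blowup_left al be u.
Proof.
move=> H M; have [t0 [h1 h2]] := H M; exists (- t0); split; first exact: refl_open.
move=> t at_ tt0; have := h2 (- t); rewrite /refl opprK ltrN2; apply; first lra.
by rewrite EFinN lteN2.
Qed.

Lemma refl_blowup_left (al be : \bar R) u :
  blowup_left (- be)%E (- al)%E (refl u) -> blowup_right al be u.
Proof.
move=> H M; have [t0 [h1 h2]] := H M; exists (- t0); split; first exact: refl_open.
move=> t tt0 tb; have := h2 (- t); rewrite /refl opprK => h.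
have := h _ _; rewrite EFinN lteN2 => /(_ tb) h'; have : M < - u t by apply: h'; lra.
lra.
Qed.

Lemma refl_conv (al be : \bar R) u v :
  conv_plus_infty (- be)%E (- al)%E (refl u) (refl v) -> conv_minus_infty al be u v.
Proof.
move=> [h0 H]; split; first by rewrite -[al]oppeK h0.
move=> e e0; have [T [h1 h2]] := H e e0; exists (- T); split.
  by rewrite EFinN lteNl.
move=> t tT; have := h2 (- t); rewrite /refl opprK opprK addrC distrC; apply.
lra.
Qed.

Lemma refl_convV (al be : \bar R) u v :
  conv_minus_infty al be u v -> conv_plus_infty (- be)%E (- al)%E (refl u) (refl v).
Proof.
move=> [h0 H]; split; first by rewrite h0.
move=> e e0; have [T [h1 h2]] := H e e0; exists (- T); split.
  by rewrite EFinN lteN2.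
move=> t tT; have -> : refl u t - refl v t = - (u (- t) - v (- t)) by rewrite /refl; ring.
by rewrite normrN; apply: h2; lra.
Qed.

Lemma refl_blowup_leftV (al be : \bar R) u :
  blowup_right al be u -> blowup_left (- be)%E (- al)%E (refl u).
Proof.
move=> h; apply: refl_blowup_right; rewrite !oppeK reflK; exact: h.
Qed.

End Reflection.

Section ConcaveEquation.
Context {R : realType}.
Implicit Types (h hx : R -> R -> R) (u v a b : R -> R) (lam s t x : R).

Record concave_eq h hx : Prop := ConcaveEq {
  ce_reg : regular h hx;
  ce_def : forall M kap : R, 0 < kap -> exists (P E : R -> R) (C : R),
    [/\ forall t : R, is_derive t 1 P (E t),
        forall t x y, - M <= x -> x <= y -> y <= M -> hx t y - hx t x <= E t &
        forall s t, s <= t -> P t - P s <= kap * (t - s) + C];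
  ce_ap : forall lam, exists N : R, forall lam' u, lam' <= lam ->
    bounded_solution (peqn h lam') u -> forall t, `|u t| <= N;
  ce_low : forall lam v s, lower_sol h lam v ->
    exists2 u, bounded_solution (peqn h lam) u & u s = v s;
  ce_none : exists lam, forall lam', lam' < lam -> forall u, ~ bounded_solution (peqn h lam') u;
  ce_R : forall lam s x (al be : \bar R) u, is_maximal_solution (peqn h lam) s x al be u ->
    blowup_right al be u \/ be = +oo%E /\ exists M, forall t, s <= t -> `|u t| <= M;
  ce_L : forall lam s x (al be : \bar R) u, is_maximal_solution (peqn h lam) s x al be u ->
    blowup_left al be u \/ al = -oo%E /\ exists M, forall t, t <= s -> `|u t| <= M }.

Lemma regular_refl h hx : regular h hx -> regular (refl_eq h) (refl_dx hx).
Proof.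
have cr (f : R -> R -> R) : (forall u : R -> R, continuous u -> continuous (fun t => f t (u t))) ->
    forall u : R -> R, continuous u -> continuous (fun t => f (- t) (- u t)).
  move=> cf u cu.
  have co : continuous (fun t : R => - t) by move=> t; exact: cvgN.
  have c1 : continuous (fun t => - u (- t)) by apply: ctsN; exact: cts_comp cu co.
  have := cts_comp (cf _ c1) co; apply: cont_ext => t /=; by rewrite opprK.
move=> [rd rc rcx rb ru]; split.
- by move=> t x; apply: is_derive_refl; exact: rd.
- exact: cr.
- by move=> u cu; apply: ctsN; exact: (cr hx).
- move=> M; have [B HB] := rb M; exists B => t x xM.
  by rewrite /refl_eq /refl_dx normrN; apply: HB; rewrite normrN.
- move=> M e e0; have [d d0 Hd] := ru M e e0; exists d => // t x y xM yM xy.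
  rewrite /refl_dx -opprD normrN; apply: Hd; rewrite ?normrN//.
  by rewrite -opprD normrN.
Qed.

Lemma lower_sol_refl h lam v : lower_sol (refl_eq h) lam v -> lower_sol h lam (refl v).
Proof.
move=> [dv [Hv dvb [M HM]]]; exists (fun t => dv (- t)); split.
- by move=> t; apply: refl_der; exact: Hv.
- by move=> t; have := dvb (- t); rewrite /refl_eq opprK.
- by exists M => t; rewrite normrN.
Qed.

Lemma concave_eq_refl h hx : concave_eq h hx -> concave_eq (refl_eq h) (refl_dx hx).
Proof.
move=> H; split.
- exact: regular_refl (ce_reg H).
- move=> M kap k0; have [P [E [C [HP HE HC]]]] := ce_def H M k0.
  exists (refl P), (fun t => E (- t)), C; split.
  + by move=> t; apply: refl_der; exact: HP.
  + move=> t x y Mx xy yM; have := HE (- t) (- y) (- x); rewrite /refl_dx => h1.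
    have : hx (- t) (- x) - hx (- t) (- y) <= E (- t) by apply: h1; lra.
    lra.
  + by move=> s t st; have := HC (- t) (- s); rewrite /refl lerN2 => /(_ st); lra.
- move=> lam; have [N HN] := ce_ap H lam; exists N => lam' u ll Hu t.
  by have := HN lam' _ ll (refl_bsolE Hu) (- t); rewrite normrN opprK.
- move=> lam v s Hv; have [u Hu us] := ce_low H (- s) (lower_sol_refl Hv).
  exists (refl u); first exact: (refl_bsol Hu).
  by rewrite /refl us /refl !opprK.
- have [lam Hl] := ce_none H; exists lam => lam' ll u Hu.
  exact: Hl ll _ (refl_bsolE (f := peqn h lam') Hu).
- move=> lam s x al be u Hm0; have Hm := refl_maximal (f := peqn h lam) Hm0.
  have [/refl_blowup_left|[h0 [M HM]]] := ce_L H Hm; [by left|right].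
  split; first by rewrite -[be]oppeK h0.
  by exists M => t st; have := HM (- t); rewrite /refl opprK normrN lerN2; exact.
- move=> lam s x al be u Hm0; have Hm := refl_maximal (f := peqn h lam) Hm0.
  have [/refl_blowup_right|[h0 [M HM]]] := ce_R H Hm; [by left|right].
  split; first by rewrite -[al]oppeK h0.
  by exists M => t st; have := HM (- t); rewrite /refl opprK normrN lerN2; exact.
Qed.

Definition hypA hx u := exists K C g,
  [/\ forall t : R, is_derive t 1 K (hx t (u t)), 0 < g & decays K C g].

Definition hypR hx u := exists K C g, [/\ forall t : R, is_derive t 1 K (hx t (u t)), 0 < g &
  forall s t, s <= t -> g * (t - s) - C <= K t - K s].

Lemma hypA_refl hx u : hypA (refl_dx hx) (refl u) <-> hypR hx u.
Proof.
split=> -[K [C [g [HK g0 d]]]]; exists (fun t => K (- t)), C, g; split => //.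
- move=> t; apply: is_derive_eq (is_derive_refl (HK (- t))) _.
  by rewrite /refl_dx /refl !opprK.
- by move=> s t st; have := d (- t) (- s); rewrite lerN2 => /(_ st); lra.
- move=> t; apply: is_derive_eq (is_derive_refl (HK (- t))) _.
  by rewrite /refl_dx /refl opprK.
- by move=> s t st; have := d (- t) (- s); rewrite lerN2 => /(_ st); lra.
Qed.

Definition upper_of h lam : R -> R :=
  xget (fun=> 0) [set a | upper_bounded_solution (peqn h lam) a].

Definition solvable h lam := exists u, bounded_solution (peqn h lam) u.

Definition lam0 h : R := inf [set lam | solvable h lam].

Section Upper.
Variables (h hx : R -> R -> R).
Hypothesis H : concave_eq h hx.
Let reg := ce_reg H.

Lemma ap_ge0 lam : exists2 N, 0 <= N & forall lam' u, lam' <= lam ->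
  bounded_solution (peqn h lam') u -> forall t, `|u t| <= N.
Proof.
have [N HN] := ce_ap H lam; exists (`|N|) => // lam' u ll Hu t.
by apply: le_trans (HN _ _ ll Hu t) (ler_norm _).
Qed.

Lemma ex_upper lam : solvable h lam -> exists a, upper_bounded_solution (peqn h lam) a.
Proof.
move=> [u0 Hu0]; have [N N0 HN] := ap_ge0 lam.
pose S := [set u 0 | u in [set u | bounded_solution (peqn h lam) u]].
have S0 : S !=set0 by exists (u0 0); exists u0.
have Sb : has_ubound S.
  exists N => _ [u /= Hu <-]; exact: le_trans (ler_norm _) (HN _ _ (lexx _) Hu 0).
have [e e0|a [Ha _ a0 _]] := @closed_sol _ h hx reg N lam (sup S) N0.
  have [_ [u /= Hu <-] us] := sup_adherent e0 (conj S0 Sb).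
  exists lam, u; rewrite subrr normr0; split => //; [exact: ltW|exact: HN|].
  have := ub_le_sup Sb (ex_intro2 _ _ u Hu erefl : S (u 0)).
  by rewrite ler_norml; lra.
exists a; split => // v Hv t; apply: (@bsol_le _ h hx reg lam v a 0 t Hv Ha); rewrite a0.
by apply: (ub_le_sup Sb); exists v.
Qed.

Lemma upper_ofP lam : solvable h lam -> upper_bounded_solution (peqn h lam) (upper_of h lam).
Proof. by move=> /ex_upper; exact: xgetPex. Qed.

Lemma upper_bsol lam : solvable h lam -> bounded_solution (peqn h lam) (upper_of h lam).
Proof. by case/upper_ofP. Qed.

Lemma lower_solvable lam v : lower_sol h lam v -> solvable h lam.
Proof. by move=> /(ce_low H 0)[u]; exists u. Qed.

Lemma solvable_up lam lam' : lam <= lam' -> solvable h lam -> solvable h lam'.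
Proof. by move=> ll [u Hu]; exact: lower_solvable (bsol_lower ll Hu). Qed.

Lemma lower_le_upper lam v t : lower_sol h lam v -> v t <= upper_of h lam t.
Proof.
move=> Hv; have [u Hu <-] := ce_low H t Hv.
by have [_] := upper_ofP (ex_intro _ u Hu); exact.
Qed.

Lemma upper_mono lam lam' t : solvable h lam -> lam <= lam' ->
  upper_of h lam t <= upper_of h lam' t.
Proof. by move=> /upper_bsol Ha ll; exact: lower_le_upper (bsol_lower ll Ha). Qed.

Lemma const_lower M : exists lam, forall lam', lam <= lam' -> lower_sol h lam' (fun=> M).
Proof.
have [B HB] := reg_b reg `|M|; exists B => lam' ll; exists (fun=> 0); split.
- by move=> t; exact: is_derive_cstf.
- by move=> t; have := (HB t M (lexx _)).1; rewrite ler_norml; lra.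
- by exists `|M|.
Qed.

Let L0ne : [set lam | solvable h lam] !=set0.
Proof.
by have [lam Hl] := const_lower 0; exists lam; exact: lower_solvable (Hl _ (lexx _)).
Qed.

Let L0lb : has_lbound [set lam | solvable h lam].
Proof.
have [lam Hl] := ce_none H; exists lam => l [u Hu]; rewrite leNgt; apply/negP => ll.
exact: (Hl _ ll _ Hu).
Qed.

Lemma below_lam0 lam : lam < lam0 h -> ~ solvable h lam.
Proof. by move=> ll Hl; have := ge_inf L0lb Hl; rewrite leNgt ll. Qed.

Lemma above_lam0 lam : lam0 h < lam -> solvable h lam.
Proof.
by move=> ll; have [l Hl /ltW hl] := inf_lt L0ne ll; exact: solvable_up Hl.
Qed.

Lemma lam0_limit : exists u, bounded_solution (peqn h (lam0 h)) u /\
  forall t e, 0 < e -> exists2 d, 0 < d & forall lam, lam0 h < lam -> lam < lam0 h + d ->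
    `|upper_of h lam t - u t| <= e.
Proof.
have [N N0 HN] := ap_ge0 (lam0 h + 1).
pose S := [set upper_of h lam 0 | lam in [set lam | lam0 h < lam <= lam0 h + 1]].
have S0 : S !=set0 by exists (upper_of h (lam0 h + 1) 0); exists (lam0 h + 1) => //=; lra.
have bnd lam t : lam0 h < lam <= lam0 h + 1 -> `|upper_of h lam t| <= N.
  by move=> /andP[l1 l2]; apply: HN l2 _ _; exact: upper_bsol (above_lam0 l1).
have Sb : has_lbound S.
  exists (- N) => _ [lam /= hl <-]; have := bnd lam 0 hl; rewrite ler_norml; lra.
have near_inf e : 0 < e -> exists2 d, 0 < d & forall lam, lam0 h < lam -> lam < lam0 h + d ->
    [/\ lam0 h < lam <= lam0 h + 1, `|lam - lam0 h| <= e & `|upper_of h lam 0 - inf S| <= e].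
  move=> e0; have [_ [l1 /= /andP[l1a l1b] <-] l1s] := inf_adherent e0 (conj S0 Sb).
  have dp : 0 < l1 - lam0 h by rewrite subr_gt0.
  exists (Num.min e (l1 - lam0 h)); first by rewrite lt_min e0.
  move=> lam hl; rewrite -ltrBlDl lt_min => /andP[d1 d2].
  have hl1 : lam0 h < lam <= lam0 h + 1 by apply/andP; split; lra.
  split => //; first by rewrite ler_norml; lra.
  have h1 : upper_of h lam 0 <= upper_of h l1 0.
    by apply: upper_mono; [exact: above_lam0|lra].
  have h2 : inf S <= upper_of h lam 0 by apply: (ge_inf Sb); exists lam.
  by rewrite ler_norml; lra.
have [e e0|u [Hu bu u0 key]] := @closed_sol _ h hx reg N (lam0 h) (inf S) N0.
  have [d d0 hd] := near_inf e e0.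
  have [||h1 h2 h3] := hd (lam0 h + d / 2); try lra.
  exists (lam0 h + d / 2), (upper_of h (lam0 h + d / 2)); split => //.
    by apply: upper_bsol; apply: above_lam0; lra.
  by move=> t; exact: bnd.
exists u; split => // t e e0; have [k k0 hk] := key t.
pose e1 := Num.min 1 (e ^+ 2 / (k * 2 + 1)).
have k1 : 0 < k * 2 + 1 by lra.
have e10 : 0 < e1 by rewrite lt_min ltr01/= divr_gt0// exprn_gt0.
have [d d0 hd] := near_inf e1 e10; exists d => // lam l1 l2.
have [b1 b2 b3] := hd lam l1 l2.
have d1 : e1 <= 1 by rewrite ge_min lexx.
have d2 : e1 * (k * 2 + 1) <= e ^+ 2 by rewrite -ler_pdivlMr// ge_min lexx orbT.
have sqd (y : R) : `|y| <= e1 -> y ^+ 2 <= e1.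
  move=> hy; rewrite -(real_normK (num_real y)) expr2.
  by apply: le_trans (ler_pM _ _ hy hy) _ => //; rewrite -[leRHS]mulr1 ler_pM2l.
have q := hk lam _ (upper_bsol (above_lam0 l1)) (fun r => bnd lam r b1).
have q1 : (inf S - upper_of h lam 0) ^+ 2 <= e1 by apply: sqd; rewrite distrC.
have q2 : (lam0 h - lam) ^+ 2 <= e1 by apply: sqd; rewrite distrC.
have q3 : k * ((inf S - upper_of h lam 0) ^+ 2 + (lam0 h - lam) ^+ 2) <= k * (e1 + e1).
  by rewrite ler_wpM2l// lerD.
rewrite distrC -(ler_pXn2r (n := 2))// ?nnegrE ?(ltW e0)// real_normK ?num_real//; lra.
Qed.

Lemma solvable_lam0 : solvable h (lam0 h).
Proof. by have [u [Hu _]] := lam0_limit; exists u. Qed.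

Lemma solvableP lam : lam0 h <= lam -> solvable h lam.
Proof. by move=> ll; exact: solvable_up ll solvable_lam0. Qed.

Lemma upper_cvg t e : 0 < e -> exists2 d, 0 < d & forall lam, lam0 h < lam ->
  lam < lam0 h + d -> `|upper_of h lam t - upper_of h (lam0 h) t| <= e.
Proof.
move=> e0; have [u [Hu Hl]] := lam0_limit; have [d d0 hd] := Hl t e e0.
exists d => // lam l1 l2; have := hd lam l1 l2; rewrite !ler_norml => /andP[h1 h2].
have h3 := upper_mono t solvable_lam0 (ltW l1).
have [_ /(_ u Hu t) h4] := upper_ofP solvable_lam0.
by apply/andP; split; lra.
Qed.

Lemma upper_gap lam lam' : solvable h lam -> lam < lam' ->
  exists2 e, 0 < e & forall t, upper_of h lam t + e <= upper_of h lam' t.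
Proof.
move=> sl ll; have sl' := solvable_up (ltW ll) sl.
have [N N0 HN] := ap_ge0 lam'.
have Ha := upper_bsol sl; have Ha' := upper_bsol sl'.
have [L L0 HL] := reg_lip reg N.
exists ((lam' - lam) / L); first by rewrite divr_gt0// subr_gt0.
pose z t := (lam' - lam) / L - (upper_of h lam' t - upper_of h lam t).
have Hz : forall t : R, is_derive t 1 z (0 - ((h t (upper_of h lam' t) + lam') - (h t (upper_of h lam t) + lam))).
  move=> t; exact: is_derive_subf (is_derive_cstf _ _)
    (is_derive_subf (bsol_der Ha' t) (bsol_der Ha t)).
have dK : decays (fun t : R => - L * t) 0 L by move=> s t st; rewrite -mulrBr; lra.
have bz t : z t <= (lam' - lam) / L.
  by rewrite /z gerBl subr_ge0; apply: upper_mono => //; exact: ltW.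
suff zz t : z t <= 0 by move=> t; have := zz t; rewrite /z; lra.
apply: (decay_le0 L0 dK (is_derive_linear _) Hz bz) => {}t.
have := HL t (upper_of h lam' t) (upper_of h lam t) (HN _ _ (lexx _) Ha' t) (HN _ _ (ltW ll) Ha t).
rewrite (ger0_norm (_ : 0 <= upper_of h lam' t - upper_of h lam t)); last first.
  by rewrite subr_ge0; apply: upper_mono => //; exact: ltW.
rewrite ler_norml => /andP[h1 _].
have : L * z t = (lam' - lam) - L * (upper_of h lam' t - upper_of h lam t).
  by rewrite /z mulrBr mulrC divfK// gt_eqF.
rewrite mulNr; lra.
Qed.

Section Slopes.
Variables (M : R) (E : R -> R).
Hypothesis HE : forall t x y, - M <= x -> x <= y -> y <= M -> hx t y - hx t x <= E t.

Lemma slope_bounds t x y : `|x| <= M -> `|y| <= M -> x <= y ->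
  (hx t y - E t) * (y - x) <= h t y - h t x <= (hx t x + E t) * (y - x).
Proof.
move=> xM yM; rewrite le_eqVlt => /predU1P[->|xy]; first by rewrite !subrr !mulr0 lexx.
have [c /andP[c1 c2] [-> _]] := slope_itv reg t xM yM xy.
move: xM yM; rewrite !ler_norml => /andP[x1 x2] /andP[y1 y2].
have h1 := HE t x1 (ltW c1) (le_trans (ltW c2) y2).
have h2 := HE t (le_trans x1 (ltW c1)) (ltW c2) y2.
have yx : 0 < y - x by rewrite subr_gt0.
by rewrite !ler_pM2r//; apply/andP; split; lra.
Qed.

Lemma slope_three t (b u a : R) : `|b| <= M -> `|a| <= M -> b <= u -> u <= a ->
  (h t a - h t u) * (u - b) - (h t u - h t b) * (a - u) <= E t * (a - u) * (u - b).
Proof.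
move=> bM aM; rewrite le_eqVlt => /predU1P[->|bu]; first by rewrite !subrr !(mulr0, mul0r) subrr.
rewrite le_eqVlt => /predU1P[->|ua]; first by rewrite !subrr !(mulr0, mul0r) subrr.
have uM : `|u| <= M by move: bM aM; rewrite !ler_norml => /andP[b1 b2] /andP[a1 a2]; lra.
have [c /andP[c1 c2] [-> _]] := slope_itv reg t uM aM ua.
have [d /andP[d1 d2] [-> _]] := slope_itv reg t bM uM bu.
move: bM aM; rewrite !ler_norml => /andP[b1 b2] /andP[a1 a2].
have h1 : hx t c - hx t d <= E t by apply: HE; lra.
have p : 0 <= (a - u) * (u - b) by rewrite mulr_ge0 ?subr_ge0 ?ltW.
have := ler_wpM2r p h1; lra.
Qed.

End Slopes.

Lemma gap_hypA lam lam' u b e : bounded_solution (peqn h lam) u ->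
  bounded_solution (peqn h lam') b -> lam' < lam -> 0 < e -> (forall t, b t + e <= u t) ->
  hypA hx u.
Proof.
move=> Hu Hb ll e0 gap; have [N N0 HN] := ap_ge0 lam.
have bu := HN _ _ (lexx _) Hu; have bb := HN _ _ (ltW ll) Hb.
pose Z := 2 * N + 1; have Z0 : 0 < Z by rewrite /Z; lra.
pose kap := (lam - lam') / Z / 2.
have k0 : 0 < kap by rewrite !divr_gt0// subr_gt0.
have [P [E [C [HP HE HC]]]] := ce_def H N k0.
have cu : continuous u by move=> t; exact: is_derive_cont (bsol_der Hu t).
pose K := primitive (fun t => hx t (u t)).
have HK : forall t : R, is_derive t 1 K (hx t (u t)).
  by apply: is_derive_primitive; exact: (reg_cx reg).
pose z t := u t - b t.
have z0 t : 0 < z t by have := gap t; rewrite /z; lra.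
have zZ t : z t <= Z.
  by have := bu t; have := bb t; rewrite !ler_norml /z /Z => /andP[h1 h2] /andP[h3 h4]; lra.
have Hz : forall t : R, is_derive t 1 z ((h t (u t) + lam) - (h t (b t) + lam')).
  by move=> t; exact: is_derive_subf (bsol_der Hu t) (bsol_der Hb t).
have Hl : forall t : R, is_derive t 1 (fun t => ln (z t))
    (((h t (u t) + lam) - (h t (b t) + lam')) / z t).
  by move=> t; exact: is_derive_lnf (z0 t) (Hz t).
exists K, (C + ln Z - ln e), kap; split => // s t st.
have Hr : forall r : R, is_derive r 1 (fun r => ln (z r) + P r - 2 * kap * r)
    (((h r (u r) + lam) - (h r (b r) + lam')) / z r + E r - 2 * kap).
  by move=> r; exact: is_derive_subf (is_derive_addf (Hl r) (HP r)) (is_derive_linear _ _).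
have := deriv_le st (fun r _ => HK r) (fun r _ => Hr r) => h0.
apply: le_trans (h0 _) _.
  move=> r _; rewrite -lerBlDr -lerBlDr opprK.
  rewrite ler_pdivlMr//.
  have ub : b r <= u r by have := gap r; lra.
  have /andP[h1 _] := slope_bounds HE r (bb r) (bu r) ub.
  have h2 : 2 * kap * z r <= lam - lam'.
    have -> : 2 * kap = (lam - lam') / Z by rewrite /kap; field; rewrite gt_eqF.
    by rewrite mulrAC ler_pdivrMr// ler_pM2l// subr_gt0.
  rewrite -/(z r) in h1; lra.
have h1 := HC s t st.
have h2 : ln (z t) <= ln Z by rewrite ler_ln ?posrE.
have h3 : ln e <= ln (z s) by rewrite ler_ln ?posrE//; have := gap s; rewrite /z; lra.
lra.
Qed.

Lemma upper_hypA lam : lam0 h < lam -> hypA hx (upper_of h lam).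
Proof.
move=> ll; have [e e0 he] := upper_gap solvable_lam0 ll.
exact: gap_hypA (upper_bsol (above_lam0 ll)) (upper_bsol solvable_lam0) ll e0 he.
Qed.

(* The correction [p] solves the linearised equation with constant forcing, so that
   [u - eta p] trades a fraction of [eta] against the parameter. *)
Lemma hypA_lower lam u : bounded_solution (peqn h lam) u -> hypA hx u ->
  forall e, 0 < e -> exists2 eta, 0 < eta & exists v,
    lower_sol h (lam - eta) v /\ forall t, u t - e <= v t.
Proof.
move=> Hu [K [C [g [HK g0 dK]]]] e e0.
have [p [Cp [Hp Cp0 bp]]] := bounded_forcing1 g0 dK HK.
have [_ [M HM]] := Hu.
have ep : 0 < 1 / (2 * (Cp + 1)) by rewrite divr_gt0//; lra.
have [d d0 Hd] := reg_u reg (M + 1) ep.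
pose m := Num.min (Num.min 1 d) e.
have m0 : 0 < m by rewrite !lt_min ltr01 d0.
pose eta0 := m / (Cp + 1).
have C1 : 0 < Cp + 1 by lra.
have eta00 : 0 < eta0 by rewrite divr_gt0.
have ebound t : 0 <= eta0 * p t <= m.
  have /andP[p0 p1] := bp t; rewrite mulr_ge0 ?(ltW eta00)//=.
  by rewrite /eta0 mulrAC ler_pdivrMr// ler_pM2l//; lra.
have m1 : m <= 1 by rewrite !ge_min lexx.
have m2 : m <= d by rewrite !ge_min lexx orbT.
have m3 : m <= e by rewrite ge_min lexx orbT.
exists (eta0 / 2); first by rewrite divr_gt0.
exists (fun t => u t - eta0 * p t); split; last first.
  by move=> t; have /andP[_] := ebound t; lra.
exists (fun t => (h t (u t) + lam) - eta0 * (hx t (u t) * p t + 1)); split.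
- move=> t; exact: is_derive_subf (bsol_der Hu t) (is_derive_scalef _ (Hp t)).
- move=> t; have /andP[e1 e2] := ebound t; have /andP[p0 p1] := bp t.
  have uM : `|u t| <= M + 1 by have := HM t; lra.
  have vM : `|u t - eta0 * p t| <= M + 1.
    apply: le_trans (ler_normB _ _) _; apply: lerD => //.
    by rewrite ger0_norm//; lra.
  have epp : 1 / (2 * (Cp + 1)) * p t <= 1 / 2.
    have -> : 1 / 2 = 1 / (2 * (Cp + 1)) * (Cp + 1) by field; rewrite gt_eqF.
    by rewrite ler_pM2l//; lra.
  suff : h t (u t) - h t (u t - eta0 * p t) <=
      (hx t (u t) + 1 / (2 * (Cp + 1))) * (eta0 * p t).
    have := ler_wpM2l (ltW eta00) epp; lra.
  move: e1; rewrite le_eqVlt => /predU1P[<-|e1]; first by rewrite subr0 subrr mulr0.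
  have vu : u t - eta0 * p t < u t by lra.
  have [c /andP[c1 c2] [-> cM]] := slope_itv reg t vM uM vu.
  rewrite (_ : u t - (u t - eta0 * p t) = eta0 * p t); last by ring.
  rewrite ler_pM2r//.
  have cd : `|c - u t| <= d by rewrite ler_norml; lra.
  by have := Hd t c (u t) cM uM cd; rewrite ler_norml => /andP[]; lra.
- exists (M + 1) => t; apply: le_trans (ler_normB _ _) _; apply: lerD => //.
  by have /andP[a1 a2] := ebound t; rewrite ger0_norm//; lra.
Qed.

Lemma lam0_not_hypA u : bounded_solution (peqn h (lam0 h)) u -> ~ hypA hx u.
Proof.
move=> Hu hu; have [eta eta0 [v [Hv _]]] := hypA_lower Hu hu ltr01.
by apply: (@below_lam0 (lam0 h - eta)); [lra|exact: lower_solvable Hv].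
Qed.

Lemma upper_right_cont lam : lam0 h < lam -> exists2 C, 0 <= C & forall lam',
  lam <= lam' -> lam' <= lam + 1 -> forall t,
  upper_of h lam' t - upper_of h lam t <= C * (lam' - lam).
Proof.
move=> ll; have [K [C [g [HK g0 dK]]]] := upper_hypA ll.
have [N N0 HN] := ap_ge0 (lam + 1).
have g2 : 0 < g / 2 by rewrite divr_gt0.
have [P [E [C2 [HP HE HC]]]] := ce_def H N g2.
have HKP : forall t : R, is_derive t 1 (fun t => K t + P t) (hx t (upper_of h lam t) + E t).
  by move=> t; exact: is_derive_addf (HK t) (HP t).
have dKP : decays (fun t => K t + P t) (C + C2) (g / 2).
  by move=> s t st; have := dK s t st; have := HC s t st; lra.
have [p [Cp [Hp Cp0 bp]]] := bounded_forcing1 g2 dKP HKP.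
exists Cp => // lam' l1 l2 t.
have Ha := upper_bsol (above_lam0 ll).
have Ha' := upper_bsol (solvable_up l1 (above_lam0 ll)).
pose z t := upper_of h lam' t - upper_of h lam t - (lam' - lam) * p t.
have Hz : forall t : R, is_derive t 1 z (((h t (upper_of h lam' t) + lam') -
    (h t (upper_of h lam t) + lam)) - (lam' - lam) * ((hx t (upper_of h lam t) + E t) * p t + 1)).
  move=> r; exact: is_derive_subf (is_derive_subf (bsol_der Ha' r) (bsol_der Ha r))
    (is_derive_scalef _ (Hp r)).
have B' := HN _ _ l2 Ha'; have B1 := HN _ _ (le_trans l1 l2) Ha.
have dl : 0 <= lam' - lam by rewrite subr_ge0.
have bz r : z r <= 2 * N.
  have := B' r; have := B1 r; rewrite !ler_norml /z => /andP[x1 x2] /andP[x3 x4].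
  have /andP[p0 _] := bp r; have := mulr_ge0 dl p0; lra.
have zz : z t <= 0.
  apply: (decay_le0 g2 dKP HKP Hz bz) => r.
  have h0 := upper_mono r (above_lam0 ll) l1.
  have /andP[_ h1] := slope_bounds HE r (B1 r) (B' r) h0.
  rewrite /z; lra.
have /andP[_ p1] := bp t; have := ler_wpM2l dl p1; move: zz; rewrite /z; lra.
Qed.

Lemma upper_cont lam e : lam0 h < lam -> 0 < e -> exists2 d, 0 < d & forall lam',
  lam0 h < lam' -> `|lam' - lam| < d -> forall t, `|upper_of h lam' t - upper_of h lam t| < e.
Proof.
move=> ll e0; have [C C0 HC] := upper_right_cont ll.
have Ha := upper_bsol (above_lam0 ll).
have e2 : 0 < e / 2 by rewrite divr_gt0.
have [eta eta0 [v [Hv bv]]] := hypA_lower Ha (upper_hypA ll) e2.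
have C1 : 0 < C + 1 by lra.
have eC : 0 < e / (C + 1) by rewrite divr_gt0.
exists (Num.min (Num.min 1 eta) (e / (C + 1))); first by rewrite !lt_min ltr01 eta0.
move=> lam' ll'; rewrite !lt_min => /andP[/andP[h1 h2] h3] t.
have [l|/ltW l] := leP lam lam'.
  have d0 : 0 <= lam' - lam by rewrite subr_ge0.
  rewrite (ger0_norm d0) in h1 h2 h3.
  rewrite ger0_norm ?subr_ge0 ?upper_mono//; last exact: above_lam0.
  have l2 : lam' <= lam + 1 by lra.
  have := HC lam' l l2 t; move: h3; rewrite ltr_pdivlMr//; nra.
have d0 : lam' - lam <= 0 by rewrite subr_le0.
rewrite (ler0_norm d0) in h1 h2 h3.
have mm := upper_mono t (above_lam0 ll') l.
rewrite ler0_norm ?subr_le0//.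
have [dv [dv1 dv2 dv3]] := Hv.
have Hv' : lower_sol h lam' v by exists dv; split => // r; have := dv2 r; lra.
by have := lower_le_upper t Hv'; have := bv t; lra.
Qed.

Section Maximal.
Variables (lam s x : R) (al be : \bar R) (u : R -> R).
Hypothesis Hm : is_maximal_solution (peqn h lam) s x al be u.

Lemma max_der t : (al < t%:E)%E -> (t%:E < be)%E -> is_derive t 1 u (h t (u t) + lam).
Proof. by move=> h1 h2; have [_ [_ [Hu _]]] := Hm; apply: Hu; apply/andP; split. Qed.

Lemma max_in r t : (al < t%:E)%E -> (t%:E < be)%E ->
  Num.min s t <= r <= Num.max s t -> (al < r%:E)%E /\ (r%:E < be)%E.
Proof.
have [/andP[s1 s2] _] := Hm; move=> t1 t2 /andP[r1 r2]; split.
  have hm : (al < (Num.min s t)%:E)%E by case: (leP s t).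
  by apply: lt_le_trans hm _; rewrite lee_fin.
have hm : ((Num.max s t)%:E < be)%E by case: (leP s t).
by apply: le_lt_trans hm; rewrite lee_fin.
Qed.

Lemma max_le v t : (forall r : R, is_derive r 1 v (h r (v r) + lam)) -> u s <= v s ->
  (al < t%:E)%E -> (t%:E < be)%E -> u t <= v t.
Proof.
move=> Hv us t1 t2; apply: (sol_order reg _ _ us) => r hr; last exact: Hv.
by have [] := max_in t1 t2 hr; exact: max_der.
Qed.

Lemma max_ge v t : (forall r : R, is_derive r 1 v (h r (v r) + lam)) -> v s <= u s ->
  (al < t%:E)%E -> (t%:E < be)%E -> v t <= u t.
Proof.
move=> Hv us t1 t2; apply: (sol_order reg _ _ us) => r hr; first exact: Hv.
by have [] := max_in t1 t2 hr; exact: max_der.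
Qed.

Lemma no_blowup_right v : bounded_solution (peqn h lam) v -> v s <= x -> ~ blowup_right al be u.
Proof.
move=> Hv vx B; have [_ [N HN]] := Hv; have [t0 [/andP[b1 b2] Hb]] := B N.
have [/andP[s1 s2] [us _]] := Hm.
have [t [t1 t2]] : exists t, Num.max t0 s < t /\ (t%:E < be)%E.
  have : ((Num.max t0 s)%:E < be)%E by case: (leP t0 s).
  case: (be) => [b|_|//]; last by exists (Num.max t0 s + 1); rewrite ltry; split => //; lra.
  rewrite lte_fin => hb; exists ((Num.max t0 s + b) / 2); rewrite lte_fin; split; lra.
move: t1; rewrite gt_max => /andP[tt0 st].
have h1 := Hb t tt0 t2.
have h2 : v t <= u t.
  apply: (max_ge (bsol_der Hv)) => //; first by rewrite us.
  by apply: lt_trans s1 _; rewrite lte_fin.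
have := HN t; rewrite ler_norml => /andP[]; lra.
Qed.

Lemma no_blowup_left v : bounded_solution (peqn h lam) v -> x <= v s -> ~ blowup_left al be u.
Proof.
move=> Hv vx B; have [_ [N HN]] := Hv; have [t0 [/andP[b1 b2] Hb]] := B N.
have [/andP[s1 s2] [us _]] := Hm.
have [t [t1 t2]] : exists t, t < Num.min t0 s /\ (al < t%:E)%E.
  have : (al < (Num.min t0 s)%:E)%E by case: (leP t0 s).
  case: (al) => [b|//|_]; last by exists (Num.min t0 s - 1); rewrite ltNyr; split => //; lra.
  rewrite lte_fin => hb; exists ((Num.min t0 s + b) / 2); rewrite lte_fin; split; lra.
move: t1; rewrite lt_min => /andP[tt0 st].
have h1 := Hb t t2 tt0.
have h2 : u t <= v t.
  apply: (max_le (bsol_der Hv)) => //; first by rewrite us.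
  by apply: lt_trans s2; rewrite lte_fin.
have := HN t; rewrite ler_norml => /andP[]; lra.
Qed.

Lemma max_global : ~ blowup_left al be u -> ~ blowup_right al be u ->
  bounded_solution (peqn h lam) u.
Proof.
move=> nl nr; have [//|[alE [M1 h1]]] := ce_L H Hm; have [//|[beE [M2 h2]]] := ce_R H Hm.
split; first by move=> t _; apply: max_der; rewrite ?alE ?beE ?ltNyr ?ltry.
exists (Num.max M1 M2) => t; rewrite le_max; have [/h2 ->|/ltW/h1 ->//] := leP s t.
by rewrite orbT.
Qed.

Lemma upper_blowup : solvable h lam -> blowup_left al be u <-> upper_of h lam s < x.
Proof.
move=> sl; have [Ha Hmax] := upper_ofP sl; have [_ [us _]] := Hm; split.
  by move=> B; rewrite ltNge; apply/negP => /(no_blowup_left Ha).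
move=> ax; apply: contrapT => nl.
have := Hmax _ (max_global nl (no_blowup_right Ha (ltW ax))) s.
by rewrite us leNgt ax.
Qed.

Lemma below_blowup : ~ solvable h lam -> blowup_left al be u \/ blowup_right al be u.
Proof.
move=> ns; have [|nl] := pselect (blowup_left al be u); first by left.
have [|nr] := pselect (blowup_right al be u); first by right.
by case: ns; exists u; exact: max_global.
Qed.

Lemma upper_attracts lam' b e : lam' < lam -> bounded_solution (peqn h lam') b -> b s <= x ->
  0 < e -> (forall t, b t + e <= upper_of h lam t) -> lam0 h < lam ->
  (exists2 r, bounded_solution (peqn h lam) r & r s <= x) ->
  conv_plus_infty al be u (upper_of h lam).
Proof.
move=> ll Hb bx e0 gap l0l [r0 Hr0 r0x].
have [/andP[s1 s2] [us _]] := Hm.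
have [/(no_blowup_right Hr0 r0x)//|[beE [Mu hMu]]] := ce_R H Hm; split => // ep ep0.
have sl := above_lam0 l0l; have Ha := upper_bsol sl.
set a := upper_of h lam in gap Ha *.
have Hu t : s <= t -> is_derive t 1 u (h t (u t) + lam).
  by move=> st; apply: max_der; [apply: lt_le_trans s1 _; rewrite lee_fin|rewrite beE ltry].
have [N N0 HN] := ap_ge0 lam.
have ba := HN _ _ (lexx _) Ha; have bb := HN _ _ (ltW ll) Hb.
have fin T0 : (forall t, s + T0 <= t -> s <= t -> `|u t - a t| < ep) ->
    exists T, (al < T%:E)%E /\ forall t, T < t -> `|u t - a t| < ep.
  move=> hT; exists (s + `|T0|); split.
    by apply: lt_le_trans s1 _; rewrite lee_fin lerDl.
  move=> t ht; have := ler_norm T0; have : 0 <= `|T0| by [].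
  by move=> q1 q2; apply: hT; lra.
have ep2 : 0 < ep / 2 by rewrite divr_gt0.
have [ax|/ltW xa] := leP (a s) x.
  have [K [C [g [HK g0 dK]]]] := upper_hypA l0l; rewrite -/a in HK.
  have g2 : 0 < g / 2 by rewrite divr_gt0.
  pose M := Num.max N Mu.
  have [P [E [C2 [HP HE HC]]]] := ce_def H M g2.
  have aM t : `|a t| <= M by rewrite le_max ba.
  have uM t : s <= t -> `|u t| <= M by move=> st; rewrite le_max (hMu t st) orbT.
  have au t : s <= t -> a t <= u t.
    move=> st; apply: (max_ge (bsol_der Ha)); rewrite ?us ?beE ?ltry//.
    by apply: lt_le_trans s1 _; rewrite lee_fin.
  have xa0 : 0 <= x - a s by rewrite subr_ge0.
  have [T T0 hT] := @exp_small _ ((x - a s) * expR (C + C2)) (g / 2) (ep / 2)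
    (mulr_ge0 xa0 (expR_ge0 _)) g2 ep2.
  apply: (fin T) => t tT st.
  rewrite ger0_norm ?subr_ge0 ?au//.
  have HD : forall r, s <= r <= t -> is_derive r 1 (fun t => u t - a t)
      ((h r (u r) + lam) - (h r (a r) + lam)).
    by move=> r /andP[sr _]; exact: is_derive_subf (Hu r sr) (bsol_der Ha r).
  have HKP : forall r, s <= r <= t -> is_derive r 1 (fun t => K t + P t) (hx r (a r) + E r).
    by move=> r _; exact: is_derive_addf (HK r) (HP r).
  have hg : u t - a t <= (x - a s) * expR (K t + P t - (K s + P s)).
    rewrite -us; apply: (gronwall_le st HD HKP) => r /andP[sr _].
    by have /andP[_] := slope_bounds HE r (aM r) (uM r sr) (au r sr); lra.
  apply: le_lt_trans hg _; apply: (@le_lt_trans _ _ (ep / 2)); last by lra.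
  apply: le_trans (hT (t - s) _); last by lra.
  rewrite -mulrA ler_wpM2l ?subr_ge0// -expRD ler_expR.
  by have := dK s t st; have := HC s t st; lra.
pose Y := 2 * N + 1; have Y0 : 0 < Y by rewrite /Y; lra.
pose y t := a t - b t.
have y0 t : 0 < y t by have := gap t; rewrite /y; lra.
have yY t : y t <= Y.
  by have := ba t; have := bb t; rewrite !ler_norml /y /Y => /andP[x1 x2] /andP[x3 x4]; lra.
pose kap := (lam - lam') / Y / 2.
have k0 : 0 < kap by rewrite !divr_gt0// subr_gt0.
have [P [E [C2 [HP HE HC]]]] := ce_def H N k0.
have ua t : s <= t -> u t <= a t.
  move=> st; apply: (max_le (bsol_der Ha)); rewrite ?us ?beE ?ltry//.
  by apply: lt_le_trans s1 _; rewrite lee_fin.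
have bu t : s <= t -> b t <= u t.
  move=> st; apply: (compare_fwd reg (lam := lam) st (du := fun r => h r (u r) + lam)
     (dv := fun r => h r (b r) + lam')) => [r /andP[sr _]|r _|r _|r _|]; rewrite ?us//.
  - exact: Hu.
  - exact: (bsol_der Hb r).
  - by rewrite lerD2l ltW.
have E0 t : 0 <= E t.
  by have := HE t 0 0; rewrite subrr; apply; rewrite ?oppr_le0.
have Hy : forall t : R, is_derive t 1 y ((h t (a t) + lam) - (h t (b t) + lam')).
  by move=> t; exact: is_derive_subf (bsol_der Ha t) (bsol_der Hb t).
pose kk r := ((h r (a r) + lam) - (h r (b r) + lam')) / y r + E r - 2 * kap.
have HKK : forall t : R, is_derive t 1 (fun t => ln (y t) + P t - 2 * kap * t) (kk t).
  move=> t; exact: is_derive_subf (is_derive_addf (is_derive_lnf (y0 t) (Hy t)) (HP t))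
    (is_derive_linear _ _).
have ax0 : 0 <= a s - x by rewrite subr_ge0.
have [T T0 hT] := @exp_small _ ((a s - x) * expR (ln Y - ln e + C2)) kap (ep / 2)
    (mulr_ge0 ax0 (expR_ge0 _)) k0 ep2.
apply: (fin T) => t tT st.
rewrite distrC ger0_norm ?subr_ge0 ?ua//.
have hg : a t - u t <= (a s - x) * expR (ln (y t) + P t - 2 * kap * t - (ln (y s) + P s - 2 * kap * s)).
  have HD : forall r, s <= r <= t -> is_derive r 1 (fun t => a t - u t)
      ((h r (a r) + lam) - (h r (u r) + lam)).
    by move=> r /andP[sr _]; exact: is_derive_subf (bsol_der Ha r) (Hu r sr).
  rewrite -us; apply: (gronwall_le st HD (fun r _ => HKK r)) => r /andP[sr _].
  + have y0r := y0 r; have q := slope_three HE r (bb r) (ba r) (bu r sr) (ua r sr).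
    rewrite -(ler_pM2r y0r).
    have -> : kk r * (a r - u r) * y r = (((h r (a r) + lam) - (h r (b r) + lam'))
        + (E r - 2 * kap) * y r) * (a r - u r).
      by rewrite /kk; field; rewrite gt_eqF.
    have k2 : 2 * kap * y r <= lam - lam'.
      have -> : 2 * kap = (lam - lam') / Y by rewrite /kap; field; rewrite gt_eqF.
      by rewrite mulrAC ler_pdivrMr// ler_pM2l// subr_gt0.
    have au0 : 0 <= a r - u r by rewrite subr_ge0 ua.
    have ub0 : 0 <= u r - b r by rewrite subr_ge0 bu.
    have q2 := ler_wpM2r au0 k2.
    have q3 : 0 <= E r * (a r - u r) * (a r - u r) by rewrite !mulr_ge0.
    move: q q2; rewrite /y; nra.
apply: le_lt_trans hg _; apply: (@le_lt_trans _ _ (ep / 2)); last by lra.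
apply: le_trans (hT (t - s) _); last by lra.
rewrite -[leRHS]mulrA ler_wpM2l// -expRD ler_expR.
have h2 : ln (y t) <= ln Y by rewrite ler_ln ?posrE.
have h3 : ln e <= ln (y s) by rewrite ler_ln ?posrE//; have := gap s; rewrite /y; lra.
have := HC s t st; lra.
Qed.

End Maximal.
End Upper.
End ConcaveEquation.

Section Bifurcation.
Context {R : realType}.
Implicit Types (u v a b : R -> R) (lam s t x : R).

Definition lower_of (h : R -> R -> R) lam : R -> R := refl (upper_of (refl_eq h) lam).

Lemma solvable_refl (h : R -> R -> R) lam : solvable (refl_eq h) lam <-> solvable h lam.
Proof.
split=> -[u Hu]; exists (refl u); first exact: (refl_bsolE (f := peqn h lam) Hu).
exact: (refl_bsol (f := peqn h lam) Hu).
Qed.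

Lemma lam0_refl (h : R -> R -> R) : lam0 (refl_eq h) = lam0 h.
Proof.
by congr inf; apply/seteqP; split => lam /=; rewrite solvable_refl.
Qed.

Section Hyperbolicity.
Variables (h hx : R -> R -> R).
Hypothesis reg : regular h hx.

Lemma fxE lam u : fx (peqn h lam) u = (fun r => hx r (u r)).
Proof.
apply/funext => r; rewrite /fx derive1E.
have D : is_derive (u r) 1 (peqn h lam r) (hx r (u r) + 0).
  exact: is_derive_addf (reg_d reg r (u r)) (is_derive_cstf _ _).
by rewrite (@derive_val _ _ _ _ _ _ _ D) addr0.
Qed.

Lemma attractiveP lam u : bounded_solution (peqn h lam) u ->
  attractive_hyperbolic (peqn h lam) u <-> hypA hx u.
Proof.
move=> Hu; have cu : continuous u by move=> t; exact: is_derive_cont (bsol_der Hu t).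
have ck := reg_cx reg cu; rewrite /attractive_hyperbolic fxE; split.
  move=> [k [gam [k1 [g0 hk]]]].
  exists (primitive (fun r => hx r (u r))), (ln k), gam; split => //.
    exact: is_derive_primitive.
  have k0 : 0 < k by lra.
  move=> s t st; rewrite -primitiveE//; have := hk s t st.
  by rewrite -{1}(lnK k0) -expRD ler_expR.
move=> [K [C [g [HK g0 dK]]]]; exists (expR `|C|), g; split; last split => //.
  by rewrite -expR0 ler_expR.
move=> s t st; rewrite (Rint_primitive st ck (fun r _ => HK r)) -expRD ler_expR.
by have := dK s t st; have := ler_norm C; lra.
Qed.

Lemma repulsiveP lam u : bounded_solution (peqn h lam) u ->
  repulsive_hyperbolic (peqn h lam) u <-> hypR hx u.
Proof.
move=> Hu; have cu : continuous u by move=> t; exact: is_derive_cont (bsol_der Hu t).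
have ck := reg_cx reg cu; rewrite /repulsive_hyperbolic fxE; split.
  move=> [k [gam [k1 [g0 hk]]]].
  exists (primitive (fun r => hx r (u r))), (ln k), gam; split => //.
    exact: is_derive_primitive.
  have k0 : 0 < k by lra.
  move=> s t st; rewrite -primitiveE//; have := hk t s st.
  by rewrite -{1}(lnK k0) -expRD ler_expR; lra.
move=> [K [C [g [HK g0 dK]]]]; exists (expR `|C|), g; split; last split => //.
  by rewrite -expR0 ler_expR.
move=> s t ts; rewrite (Rint_primitive ts ck (fun r _ => HK r)) -expRD ler_expR.
by have := dK t s ts; have := ler_norm C; lra.
Qed.

End Hyperbolicity.

Section Halves.
Variables (h hx : R -> R -> R).
Hypothesis H : concave_eq h hx.
Let reg := ce_reg H.
Let Hr := concave_eq_refl H.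

Lemma lower_ofP lam : solvable h lam -> lower_bounded_solution (peqn h lam) (lower_of h lam).
Proof.
move=> sl; apply: (refl_upper (f := peqn h lam)).
by apply: (upper_ofP Hr); apply/solvable_refl.
Qed.

Lemma lower_le_of lam v t : bounded_solution (peqn h lam) v -> lower_of h lam t <= v t.
Proof. by move=> Hv; have [_] := lower_ofP (ex_intro _ v Hv); exact. Qed.

Lemma lower_anti lam lam' t : solvable h lam -> lam <= lam' ->
  lower_of h lam' t <= lower_of h lam t.
Proof.
move=> sl ll; rewrite /lower_of /refl lerN2; apply: (upper_mono Hr) => //.
exact/solvable_refl.
Qed.

Lemma lower_upper_gap lam lam' : lam0 h <= lam -> lam < lam' ->
  exists2 e, 0 < e & forall t, lower_of h lam t + e <= upper_of h lam' t.
Proof.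
move=> l0 ll; have sl := solvableP H l0; have [e e0 he] := upper_gap H sl ll.
exists e => // t; apply: le_trans (he t); rewrite lerD2r.
exact: lower_le_of (upper_bsol H sl).
Qed.

Lemma attracts_iff lam s x (al be : \bar R) u : lam0 h < lam ->
  is_maximal_solution (peqn h lam) s x al be u ->
  conv_plus_infty al be u (upper_of h lam) <-> lower_of h lam s < x.
Proof.
move=> ll Hm; have sl := above_lam0 H ll; have [Hlo _] := lower_ofP sl.
have [/andP[s1 s2] [us _]] := Hm; split.
  move=> [beE hc]; rewrite ltNge; apply/negP => xr.
  have [e e0 he] : exists2 e, 0 < e & forall t, lower_of h lam t + e <= upper_of h lam t.
    have [e e0 he] := lower_upper_gap (lexx _) ll; exists e => // t.
    by apply: le_trans (he t); rewrite lerD2r; apply: lower_anti; [exact: (solvableP H (lexx _))|exact: ltW].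
  have [T [_ hT]] := hc e e0; pose t := Num.max T s + 1.
  have tT : T < t by rewrite /t; have : T <= Num.max T s by [rewrite le_max lexx]; lra.
  have ts : s <= t by rewrite /t; have : s <= Num.max T s by [rewrite le_max lexx orbT]; lra.
  have h1 := hT t tT; have h2 : u t <= lower_of h lam t.
    apply: (max_le H Hm (bsol_der Hlo)); rewrite ?us ?beE ?ltry//.
    by apply: lt_le_trans s1 _; rewrite lee_fin.
  by have := he t; move: h1; rewrite ltr_norml => /andP[]; lra.
move=> rx; have e0 : 0 < x - lower_of h lam s by rewrite subr_gt0.
have llr : lam0 (refl_eq h) < lam by rewrite lam0_refl.
have [d d0 hd] := upper_cont Hr llr e0.
pose lam' := Num.max (lam - d / 2) ((lam0 h + lam) / 2).
have l1 : lam0 h < lam' by rewrite /lam' lt_max; apply/orP; right; lra.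
have l2 : lam' < lam by rewrite /lam' gt_max; apply/andP; split; lra.
have l3 : `|lam' - lam| < d.
  rewrite ler0_norm; last by lra.
  have : lam - d / 2 <= lam' by rewrite /lam' le_max lexx.
  lra.
have l1r : lam0 (refl_eq h) < lam' by rewrite lam0_refl.
have := hd lam' l1r l3 (- s); rewrite ltr_norml => /andP[q1 q2].
have [e ee he] := lower_upper_gap (ltW l1) l2.
have [Hb _] := lower_ofP (above_lam0 H l1).
apply: (upper_attracts H Hm l2 Hb _ ee he ll).
  by move: q1 q2; rewrite /lower_of /refl; lra.
by exists (lower_of h lam) => //; exact: ltW.
Qed.

End Halves.

Lemma lower_of_refl (h : R -> R -> R) lam s : lower_of (refl_eq h) lam (- s) = - upper_of h lam s.
Proof. by rewrite /lower_of refl_eqK /refl opprK. Qed.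

Lemma refl_lower_of (h : R -> R -> R) lam : refl (lower_of h lam) = upper_of (refl_eq h) lam.
Proof. by rewrite /lower_of reflK. Qed.

Lemma refl_maximalV (h : R -> R -> R) lam s x (al be : \bar R) u :
  is_maximal_solution (peqn h lam) s x al be u ->
  is_maximal_solution (peqn (refl_eq h) lam) (- s) (- x) (- be)%E (- al)%E (refl u).
Proof.
move=> Hm; apply: (refl_maximal (f := refl_eq (peqn h lam))).
by rewrite refl_eqK.
Qed.

Section Main.
Variables (h hx : R -> R -> R).
Hypothesis H : concave_eq h hx.
Hypothesis sep : forall lam b1 b2 e, bounded_solution (peqn h lam) b1 ->
  bounded_solution (peqn h lam) b2 -> 0 < e -> (forall t, b1 t + e <= b2 t) -> hypA hx b2.
Let reg := ce_reg H.
Let Hr := concave_eq_refl H.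
Let l0 := lam0 h.

Theorem concave_prop_i : prop_i (peqn h) l0 (lower_of h) (upper_of h).
Proof.
split; last split; last split.
- move=> lam ll; have sl := solvableP H ll.
  by split; [exact: (lower_ofP H sl)|exact: (upper_ofP H sl)].
- move=> lam ll; have sl := above_lam0 H ll.
  have [e e0 he] : exists2 e, 0 < e & forall t, lower_of h lam t + e <= upper_of h lam t.
    have [e e0 he] := lower_upper_gap H (lexx _) ll; exists e => // t.
    apply: le_trans (he t); rewrite lerD2r; apply: (lower_anti H) => //; last exact: ltW.
    exact: (solvableP H (lexx _)).
  split; first by move=> t; have := he t; lra.
  split.
    exists e; split => // t; rewrite distrC; apply: le_trans (ler_norm _).
    by have := he t; lra.
  have [Hlo _] := lower_ofP H sl; split.
    apply/(repulsiveP reg Hlo); apply/hypA_refl; rewrite refl_lower_of.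
    by apply: (upper_hypA Hr); rewrite lam0_refl.
  by apply/(attractiveP reg (upper_bsol H sl)); exact: (upper_hypA H ll).
- split.
    move=> u Hu [/(attractiveP reg Hu)|/(repulsiveP reg Hu)]; first exact: (lam0_not_hypA H Hu).
    move=> /hypA_refl; apply: (lam0_not_hypA Hr); rewrite lam0_refl.
    exact: (refl_bsol (f := peqn h l0)).
  move=> u v; wlog uv : u v / u 0 < v 0 => [hw Hu Hv|Hu Hv [e [e0 he]]].
    have [uv|vu|uv] := ltgtP (u 0) (v 0); first exact: hw.
      by move=> [e [e0 he]]; apply: (hw v u vu Hv Hu); exists e; split => // t; rewrite distrC.
    by move=> [e [e0 he]]; have := he 0; rewrite uv subrr normr0 leNgt e0.
  apply: (lam0_not_hypA H Hv); apply: (sep Hu Hv e0) => t.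
  have := bsol_lt reg t Hu Hv uv; rewrite -subr_lt0 => d.
  by have := he t; rewrite ltr0_norm//; lra.
- move=> lam ll u Hu; apply: (below_lam0 H ll); by exists u.
Qed.

Theorem concave_prop_ii :
  [/\ (forall l, l0 < l -> forall e, 0 < e -> exists del, 0 < del /\
          forall l', l0 < l' -> `|l' - l| < del ->
            forall t, `|upper_of h l' t - upper_of h l t| < e /\
              `|(- lower_of h l' t) - (- lower_of h l t)| < e),
       (forall l1 l2, l0 < l1 -> l1 < l2 -> forall t,
          - lower_of h l1 t < - lower_of h l2 t /\ upper_of h l1 t < upper_of h l2 t),
       (forall t, (fun l => upper_of h l t) @ l0^'+ --> upper_of h l0 t),
       (forall t, (fun l => lower_of h l t) @ l0^'+ --> lower_of h l0 t) &
       (forall M, exists L, forall l, L < l -> forall t,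
          M < upper_of h l t /\ M < - lower_of h l t)].
Proof.
have gt (g gx : R -> R -> R) : concave_eq g gx -> forall l1 l2, lam0 g < l1 -> l1 < l2 ->
    forall t, upper_of g l1 t < upper_of g l2 t.
  move=> Hg l1 l2 a1 a2 t; have [e e0 he] := upper_gap Hg (above_lam0 Hg a1) a2.
  by have := he t; lra.
have big (g gx : R -> R -> R) : concave_eq g gx -> forall M, exists L, forall l, L < l ->
    forall t, M < upper_of g l t.
  move=> Hg M; have [L HL] := const_lower Hg (M + 1); exists L => l /ltW Ll t.
  by have := lower_le_upper Hg t (HL l Ll); lra.
have lr : lam0 (refl_eq h) = l0 by exact: lam0_refl.
have near0 (f : R -> R -> R) t : (forall e, 0 < e -> exists2 d, 0 < d & forall lam, l0 < lam ->
    lam < l0 + d -> `|f lam t - f l0 t| <= e) -> (fun l => f l t) @ l0^'+ --> f l0 t.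
  move=> hf; apply/cvgrPdist_le => e e0; have [d d0 hd] := hf e e0.
  near=> lam; rewrite distrC; apply: hd; near: lam; first exact: nbhs_right_gt.
  by apply: nbhs_right_lt; rewrite ltrDl.
split.
- move=> l ll e e0; have [d d0 hd] := upper_cont H ll e0.
  have llr : lam0 (refl_eq h) < l by rewrite lr.
  have [d' d0' hd'] := upper_cont Hr llr e0.
  exists (Num.min d d'); split; first by rewrite lt_min d0.
  move=> l' ll'; rewrite lt_min => /andP[h1 h2] t; split; first exact: hd.
  by rewrite /lower_of /refl !opprK; apply: hd' => //; rewrite lr.
- move=> l1 l2 a1 a2 t; split; last exact: gt H _ _ a1 a2 t.
  by rewrite /lower_of /refl !opprK; apply: (gt _ _ Hr) => //; rewrite lr.
- by move=> t; apply: near0 => e e0; exact: (upper_cvg H).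
- move=> t; apply: near0 => e e0; have [d d0 hd] := upper_cvg Hr (- t) e0.
  exists d => // lam a1 a2; rewrite /lower_of /refl -opprD normrN; rewrite -lr; apply: hd.
    by rewrite lr.
  by rewrite lr.
- move=> M; have [L1 h1] := big _ _ H M; have [L2 h2] := big _ _ Hr M.
  exists (Num.max L1 L2) => l; rewrite gt_max => /andP[a1 a2] t; split; first exact: h1.
  by rewrite /lower_of /refl opprK; exact: h2.
Unshelve. all: by end_near. Qed.

Theorem concave_prop_v :
  [/\ (forall l, l0 <= l -> forall s x (al be : \bar R) (u : R -> R),
          is_maximal_solution (peqn h l) s x al be u ->
          (blowup_left al be u <-> upper_of h l s < x) /\
          (blowup_right al be u <-> x < lower_of h l s)),
       (forall l, l0 < l -> forall s x (al be : \bar R) (u : R -> R),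
          is_maximal_solution (peqn h l) s x al be u ->
          (conv_minus_infty al be u (lower_of h l) <-> x < upper_of h l s) /\
          (conv_plus_infty al be u (upper_of h l) <-> lower_of h l s < x)) &
       (forall l, l < l0 -> forall s x (al be : \bar R) (u : R -> R),
          is_maximal_solution (peqn h l) s x al be u ->
          blowup_left al be u \/ blowup_right al be u)].
Proof.
split.
- move=> l ll s x al be u Hm; have sl := solvableP H ll.
  split; first exact: (upper_blowup H Hm sl).
  have slr : solvable (refl_eq h) l by apply/solvable_refl.
  have := upper_blowup Hr (refl_maximalV Hm) slr.
  have -> : (upper_of (refl_eq h) l (- s) < - x) = (x < lower_of h l s).
    by rewrite /lower_of /refl ltrNr.
  move=> [h1 h2]; split; first by move=> /refl_blowup_leftV.
  by move=> /h2 /refl_blowup_left.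
- move=> l ll s x al be u Hm; split; last exact: (attracts_iff H ll Hm).
  have llr : lam0 (refl_eq h) < l by rewrite lam0_refl.
  have := attracts_iff Hr llr (refl_maximalV Hm).
  rewrite lower_of_refl ltrN2 -refl_lower_of => -[h1 h2]; split.
    by move=> /refl_convV.
  by move=> /h2 /refl_conv.
- move=> l ll s x al be u Hm; apply: (below_blowup H Hm); exact: (below_lam0 H ll).
Qed.

End Main.
End Bifurcation.

Section Extension.
Context {R : realType}.
Implicit Types (u v : R -> R) (lam s t x : R).

Lemma bounded_extends (h hx : R -> R -> R) lam s x (al be : \bar R) u M : regular h hx ->
  is_maximal_solution (peqn h lam) s x al be u ->
  (forall t, s <= t -> (t%:E < be)%E -> `|u t| <= M) -> be = +oo%E.
Proof.
move=> reg Hm bu; have [/andP[s1 s2] [us [Hu Hmax]]] := Hm.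
case: be s2 Hm bu Hu Hmax => [b|//|//] s2 Hm bu Hu Hmax; exfalso.
rewrite lte_fin in s2.
have M0 : 0 <= M by apply: le_trans (bu s (lexx _) _); rewrite ?lte_fin.
have K0 : 0 <= M + 1 by lra.
have [v vs Hv] := @trunc_sol _ h hx reg (M + 1) lam s x K0.
have [L L0 HL] := reg_lip reg (M + 1).
have [B HB] := reg_b reg (M + 1).
have z0 : `|0 : R| <= M + 1 by rewrite normr0.
have B0 : 0 <= B by have [q _] := HB 0 0 z0; exact: le_trans (normr_ge0 _) q.
pose B1 := B + `|lam|.
have vlip t t' : `|v t - v t'| <= B1 * `|t - t'|.
  apply: (deriv_lip _ _ Hv) => r; apply: le_trans (ler_normD _ _) _; rewrite lerD2r.
  by have [] := HB r _ (clamp_bound (v r) K0).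
have uv t : s <= t -> t < b -> v t = u t.
  move=> st tb.
  have Hut : forall r, s <= r <= t -> is_derive r 1 u (h r (clamp (M + 1) (u r)) + lam).
    move=> r /andP[sr rt]; rewrite clamp_id; last first.
      by apply: le_trans (bu r sr _) _; rewrite ?lte_fin; lra.
    apply: Hu; apply/andP; split; last by rewrite lte_fin; lra.
    by apply: lt_le_trans s1 _; rewrite lee_fin.
  have lip r (y z : R) : h r (clamp (M + 1) y) + lam - (h r (clamp (M + 1) z) + lam) <= L * `|y - z|.
    rewrite opprD addrACA subrr addr0; apply: le_trans (ler_norm _) _.
    apply: le_trans (HL _ _ _ (clamp_bound _ K0) (clamp_bound _ K0)) _.
    by rewrite ler_pM2l// clamp_lip.
  apply/eqP; rewrite eq_le; apply/andP; split.
    apply: (comparison_fwd (L := L) st Hut (fun r _ => Hv r)); last by rewrite us vs.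
    by move=> r _; exact: lip.
  apply: (comparison_fwd (L := L) st (fun r _ => Hv r) Hut); last by rewrite us vs.
  by move=> r _; exact: lip.
have B10 : 0 <= B1 by rewrite addr_ge0.
pose d := 1 / (2 * (B1 + 1)).
have d0 : 0 < d by rewrite divr_gt0//; lra.
have dB : B1 * (2 * d) <= 1.
  have -> : 2 * d = 1 / (B1 + 1) by rewrite /d; field; rewrite gt_eqF//; lra.
  by rewrite mulrA mulr1 ler_pdivrMr; lra.
have vb t : s - d < t -> t < b + d -> `|v t| <= M + 1.
  move=> t1 t2; have [t' [q1 q2 q3]] : exists t', [/\ s <= t', t' < b & `|t - t'| <= 2 * d].
    have [ts|st] := leP t s.
      by exists s; split => //; rewrite ler_norml; apply/andP; split; lra.
    have [tb|bt] := ltP t b; first by exists t; rewrite subrr normr0 ltW//; split => //; lra.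
    exists (Num.max s (b - d)); split; first by rewrite le_max lexx.
      by rewrite gt_max s2; lra.
    have : b - d <= Num.max s (b - d) by rewrite le_max lexx orbT.
    have : Num.max s (b - d) < b by rewrite gt_max s2; lra.
    by move=> a1 a2; rewrite ler_norml; apply/andP; split; lra.
  have -> : v t = v t' + (v t - v t') by ring.
  apply: le_trans (ler_normD _ _) _; apply: lerD.
    by rewrite uv//; apply: bu => //; rewrite lte_fin.
  apply: le_trans (vlip _ _) _; apply: le_trans dB; exact: ler_wpM2l.
have [||_] := Hmax (s - d)%:E (b + d)%:E v _ vs _.
- by rewrite !lte_fin; apply/andP; split; lra.
- move=> t /andP[]; rewrite !lte_fin => t1 t2.
  by rewrite /peqn -[X in h t X](clamp_id (vb t t1 t2)); exact: Hv.
- by rewrite lee_fin; lra.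
Qed.

Lemma bounded_extends_left (h hx : R -> R -> R) lam s x (al be : \bar R) u M : regular h hx ->
  is_maximal_solution (peqn h lam) s x al be u ->
  (forall t, t <= s -> (al < t%:E)%E -> `|u t| <= M) -> al = -oo%E.
Proof.
move=> reg /refl_maximalV Hm bu; rewrite -[al]oppeK.
rewrite (bounded_extends (regular_refl reg) Hm (M := M))// => t st ta.
rewrite /refl normrN; apply: bu; first lra.
by rewrite EFinN lteNr.
Qed.

End Extension.

Section ParametricSup.
Context {R : realType} {Om Y : topologicalType}.
Variables (K : set Y) (F : Om * Y -> R).
Hypothesis cK : compact K.
Hypothesis K0 : K !=set0.
Hypothesis cF : continuous F.

Lemma near_unif w0 (e : R) : 0 < e -> \forall w \near w0, forall y, K y -> `|F (w, y) - F (w0, y)| <= e.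
Proof.
move=> e0; have /compact_near_coveringP := cK.
move=> /(_ Om (nbhs w0) (fun w y => `|F (w, y) - F (w0, y)| <= e) _); apply.
move=> y _; have e2 : 0 < e / 2 by rewrite divr_gt0.
have /cvgrPdist_lt/(_ _ e2) := @cF (w0, y).
move=> [[U V] [/= nU nV] UV].
exists (V, U `&` [set w | True]) => /=.
  by split => //; apply: filterI => //; exact: filterT.
move=> [y' w] [/= Vy' [Uw _]].
have h1 := UV (w, y') (conj Uw Vy').
have h2 := UV (w0, y') (conj (nbhs_singleton nU) Vy').
rewrite /= in h1 h2.
have -> : F (w, y') - F (w0, y') = (F (w0, y) - F (w0, y')) - (F (w0, y) - F (w, y')) by ring.
apply: le_trans (ler_normB _ _) _; lra.
Qed.

Definition psup (w : Om) : R := sup [set F (w, y) | y in K].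

Lemma psup_attained w : exists2 y, K y & psup w = F (w, y) /\ forall y', K y' -> F (w, y') <= F (w, y).
Proof.
have cFw : {within K, continuous (fun y => F (w, y))}.
  apply: continuous_subspaceT; apply: (cts_comp cF).
  by apply: cts_pair => y; [exact: cvg_cst|exact: cvg_id].
have [y yK ymax] := compact_EVT_max K0 cK cFw.
have h y' : K y' -> F (w, y') <= F (w, y) by move=> Ky'; apply: ymax; rewrite inE.
exists y; first by rewrite -inE.
have Ky : K y by rewrite -inE.
split => //; apply/eqP; rewrite eq_le; apply/andP; split.
  by apply: ge_sup; [exists (F (w, y)); exists y|move=> _ [y' Ky' <-]; exact: h].
apply: ub_le_sup; last by exists y.
by exists (F (w, y)) => _ [y' Ky' <-]; exact: h.
Qed.

Lemma psup_ge w y : K y -> F (w, y) <= psup w.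
Proof. by move=> Ky; have [y' _ [-> h]] := psup_attained w; exact: h. Qed.

Lemma psup_cts : continuous psup.
Proof.
move=> w0; apply/cvgrPdist_le => e e0.
near=> w.
have H : forall y, K y -> `|F (w, y) - F (w0, y)| <= e by near: w; exact: near_unif.
have [y Ky [E _]] := psup_attained w; have [y0 Ky0 [E0 _]] := psup_attained w0.
have h1 := H y Ky; have h2 := H y0 Ky0.
have h3 := psup_ge w0 Ky; have h4 := psup_ge w Ky0.
by move: h1 h2; rewrite !ler_norml => /andP[a1 a2] /andP[a3 a4]; apply/andP; split; lra.
Unshelve. all: by end_near. Qed.

End ParametricSup.

Section Squares.
Context {R : realType}.

Definition square (M : R) (f : R * R -> R) : set (R * R) :=
  [set p | [/\ `|p.1| <= M, `|p.2| <= M & 0 <= f p]].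

Lemma itv_compact (M : R) : compact [set x : R | `|x| <= M].
Proof.
have -> : [set x : R | `|x| <= M] = `[- M, M]%classic.
  by apply/seteqP; split => x /=; rewrite in_itv/= ler_norml.
exact: segment_compact.
Qed.

Lemma square_compact M f : continuous f -> compact (square M f).
Proof.
move=> cf; have cs := compact_setX (@itv_compact M) (@itv_compact M).
have -> : square M f = ([set x : R | `|x| <= M] `*` [set x : R | `|x| <= M]) `&` [set p | 0 <= f p].
  by apply/seteqP; split => p /= => [[a b c]|[[a b] c]].
apply: compact_closedI => //.
apply: (@preimage_closed _ _ f [set x | 0 <= x]); first by move=> p _; exact: cf.
exact: closed_ge.
Qed.

End Squares.

Section AlmostEverywhere.
Context {R : realType} {Om : pseudoPMetricType R}.
Hypothesis cptOm : compact [set: Om].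
Variable m : probability (Borel Om) R.

Lemma ae_zero_integral (A : set (Borel Om)) (f : Om -> R) : measurable A -> m A = 1%E ->
  continuous f -> (forall w, A w -> f w = 0) -> Rintegral m setT (f : Borel Om -> R) = 0.
Proof.
move=> mA mA1 cf fA; rewrite (integral_setIC cptOm m mA cf).
have -> : Rintegral m A (f : Borel Om -> R) = 0.
  transitivity (Rintegral m A (fun=> 0)); last by rewrite Rintegral_cst// mul0r.
  by apply: eq_Rintegral => w; rewrite inE => /fA.
have mC : measurable (~` A) by exact: measurableC.
have mC0 : fine (m (~` A)) = 0 by rewrite probability_setC// mA1 subee.
have [M M0 HM] := cts_bounded cptOm cf.
have ic (k : R) : m.-integrable (~` A) (EFin \o (fun=> k)).
  by apply: (@cts_integrable _ _ cptOm m (~` A) (fun=> k)) => //; exact: ctsC.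
have if_ := cts_integrable cptOm m mC cf.
have h1 : Rintegral m (~` A) (f : Borel Om -> R) <= M * 0.
  rewrite -mC0 -Rintegral_cst//; apply: le_Rintegral => // w _.
  by apply: le_trans (HM w); exact: ler_norm.
have h2 : (- M) * 0 <= Rintegral m (~` A) (f : Borel Om -> R).
  rewrite -mC0 -Rintegral_cst//; apply: le_Rintegral => // w _.
  by have := HM w; rewrite ler_norml => /andP[].
by rewrite add0r; apply/eqP; rewrite eq_le; apply/andP; split; lra.
Qed.

Lemma ae_pos_integral (A : set (Borel Om)) (f : Om -> R) : measurable A -> (0 < m A)%E ->
  continuous f -> (forall w, 0 <= f w) -> (forall w, A w -> 0 < f w) ->
  0 < Rintegral m setT (f : Borel Om -> R).
Proof.
move=> mA mA0 cf f0 fA; rewrite lt_neqAle integral_pos// andbT eq_sym; apply/eqP => I0.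
pose phi (n : nat) w := Num.min 1 (n%:R * f w).
have pc n : continuous (phi n).
  by apply: ctsmin; [exact: ctsC|apply: ctsM => //; exact: ctsC].
have : (m A <= 0%:E)%E; last by rewrite leNgt mA0.
apply: (@integral_sup_ge _ _ cptOm m A phi 0 mA pc).
- by move=> n w; rewrite le_min ler01 mulr_ge0.
- move=> n w; rewrite /phi le_min ge_min lexx/= ge_min; apply/orP; right.
  by rewrite ler_wpM2r// ler_nat.
- move=> w Aw e e0; exists (Num.truncn (f w)^-1).+1.
  have fw := fA w Aw; rewrite lt_min; apply/andP; split; first lra.
  apply: lt_le_trans (_ : 1 <= _); first lra.
  rewrite -ler_pdivrMr// mul1r ltW//.
  have g1 : 0 <= (f w)^-1 by rewrite invr_ge0 ltW.
  by have /andP[_] := truncn_itv g1.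
- move=> n; apply: (@le_trans _ _ (Rintegral m setT (phi n : Borel Om -> R))).
    rewrite (integral_setIC cptOm m mA (pc n)) lerDl; apply: integral_pos => //.
    + exact: measurableC.
    + by move=> w; rewrite le_min ler01 mulr_ge0.
  apply: (@le_trans _ _ (n%:R * Rintegral m setT (f : Borel Om -> R))); last by rewrite I0 mulr0.
  rewrite -RintegralZl//; last exact: cts_integrable.
  apply: le_Rintegral => //.
  + exact: (cts_integrable cptOm m measurableT (pc n)).
  + apply: (@cts_integrable _ _ cptOm m setT (fun w => n%:R * f w)) => //.
    by apply: ctsM => //; exact: ctsC.
  + by move=> w _; rewrite ge_min lexx orbT.
Qed.

End AlmostEverywhere.

(** * The equation along an orbit *)

Section ConcaveFunctions.
Context {R : realType}.

Lemma deriv_ge0_min (f : R -> R) (l : R) : is_derive (0 : R) 1 f l ->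
  (forall t, 0 < t < 1 -> f 0 <= f t) -> 0 <= l.
Proof.
move=> /is_derive1_caratheodory[G [fE cG G0]] hf; rewrite leNgt; apply/negP => l0.
have e0 : 0 < - l by rewrite oppr_gt0.
have /cvgrPdist_lt/(_ _ e0)/nbhs_ballP[r /= r0 hr] := cG.
pose t := Num.min (r / 2) (1 / 2).
have t0 : 0 < t by rewrite lt_min !divr_gt0.
have t1 : t < 1 by rewrite /t gt_min; apply/orP; right; lra.
have tr : ball (0 : R) r t.
  rewrite /ball/= sub0r normrN ger0_norm; last exact: ltW.
  by rewrite /t gt_min; apply/orP; left; lra.
have := hr t tr; rewrite G0 ltr_norml => /andP[h1 h2].
have := fE t; rewrite subr0; have := hf t; rewrite t0 t1 => /(_ isT) h3 h4.
have : G t * t < 0 by rewrite nmulr_rlt0//; lra.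
lra.
Qed.

Lemma concave_tangent (f df : R -> R) x y : concave f ->
  (forall z : R, is_derive z 1 f (df z)) -> x < y ->
  df y * (y - x) <= f y - f x <= df x * (y - x).
Proof.
move=> cf Hf xy.
have key (a b : R) : f b - f a <= df a * (b - a).
  pose phi t := f (a + t * (b - a)) - ((1 - t) * f a + t * f b).
  have Hphi : is_derive (0 : R) 1 phi ((1 * (b - a)) * df a - (f b - f a)).
    have D1 : is_derive (0 : R) 1 (fun t : R => a + t * (b - a)) (0 + (b - a)).
      have D0 : is_derive (0 : R) 1 (fun t : R => t * (b - a)) (b - a).
        by apply: is_derive_ext (is_derive_linear (b - a) 0) => t; exact: mulrC.
      exact: is_derive_addf (is_derive_cstf a 0) D0.
    have E0 : a + 0 * (b - a) = a by rewrite mul0r addr0.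
    have D2 : is_derive (0 : R) 1 (fun t : R => f (a + t * (b - a))) ((0 + (b - a)) * df a).
      by apply: is_derive_compf => //; rewrite E0; exact: Hf.
    have D3 : is_derive (0 : R) 1 (fun t : R => (1 - t) * f a + t * f b) (f b - f a).
      apply: (is_derive_ext (v := fun t => f a + (f b - f a) * t)); first by move=> t; ring.
      by apply: is_derive_eq (is_derive_addf (is_derive_cstf _ _) (is_derive_linear _ _)) _; rewrite add0r.
    by apply: is_derive_eq (is_derive_subf D2 D3) _; rewrite add0r mul1r.
  have := deriv_ge0_min Hphi; rewrite mul1r => h.
  suff : 0 <= (b - a) * df a - (f b - f a) by lra.
  apply: h => t /andP[t0 t1]; rewrite /phi mul0r addr0 subr0 mul1r mul0r addr0 subrr subr_ge0.
  have := cf b a t; rewrite (ltW t0) (ltW t1) => /(_ isT) q.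
  rewrite (_ : a + t * (b - a) = t * b + (1 - t) * a); last by ring.
  by rewrite addrC.
by have := key x y; have := key y x => h1 h2; apply/andP; split; lra.
Qed.

End ConcaveFunctions.

Definition field_of {R : realType} {Om : Type} (sig : R -> Om -> Om) (c d : Om -> R)
  (g : Om -> R -> R) (w : Om) : R -> R -> R :=
  fun t x => c (sig t w) + d (sig t w) * x + g (sig t w) x.

Definition field_dx {R : realType} {Om : Type} (sig : R -> Om -> Om) (d : Om -> R)
  (gx : Om -> R -> R) (w : Om) : R -> R -> R := fun t x => d (sig t w) + gx (sig t w) x.

Section Concrete.
Context {R : realType} {Om : pseudoPMetricType R}.
Variables (sig : R -> Om -> Om) (c d : Om -> R) (g gx : Om -> R -> R).
Hypothesis cptOm : compact [set: Om].
Hypothesis sigF : is_flow sig.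
Hypothesis cc : continuous c.
Hypothesis cd : continuous d.
Hypothesis cg : continuous (fun p : Om * R => g p.1 p.2).
Hypothesis gxP : forall w (x : R), is_derive x 1 (g w) (gx w x).
Hypothesis cgx : continuous (fun p : Om * R => gx p.1 p.2).
Hypothesis l2 : forall m : probability (Borel Om) R, erg_measure sig m ->
  0 < Rintegral m setT (d : Borel Om -> R).
Hypothesis l3 : forall M : R, exists X : R, forall w x, X < x -> d w * x + g w x < M.
Hypothesis l4le : forall w x, g w x <= 0.
Hypothesis l4eq : forall w x, x <= 0 -> g w x = 0.
Hypothesis l5 : forall m : probability (Borel Om) R, erg_measure sig m ->
  m [set w | concave (g w)] = 1%E.

Local Notation fld := (field_of sig c d g).
Local Notation fldx := (field_dx sig d gx).

Lemma param_bound (F : Om * R -> R) (M : R) : continuous F ->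
  exists B, forall w x, `|x| <= M -> `|F (w, x)| <= B.
Proof.
move=> cF.
have cK : compact ([set: Om] `*` [set x : R | `|x| <= M]) by apply: compact_setX => //; exact: itv_compact.
have /compact_bounded[B [_ HB]] : compact (F @` ([set: Om] `*` [set x : R | `|x| <= M])).
  by apply: continuous_compact => //; exact: continuous_subspaceT.
exists (`|B| + 1) => w x xM; apply: HB; last by exists (w, x).
by rewrite ltr_pwDr// ler_norm.
Qed.

Lemma param_unif (F : Om * R -> R) (M e : R) : continuous F -> 0 < e ->
  exists2 r, 0 < r & forall w x y, `|x| <= M -> `|x - y| <= r -> `|F (w, x) - F (w, y)| <= e.
Proof.
move=> cF e0.
have cK : compact ([set: Om] `*` [set x : R | `|x| <= M]) by apply: compact_setX => //; exact: itv_compact.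
have /compact_near_coveringP H := cK.
have e2 : 0 < e / 2 by rewrite divr_gt0.
have hn : \forall r \near (0 : R)^'+, ([set: Om] `*` [set x : R | `|x| <= M]) `<=`
    (fun p => forall y, `|p.2 - y| <= r -> `|F p - F (p.1, y)| <= e).
  apply: (H R ((0 : R)^'+) (fun r p => forall y, `|p.2 - y| <= r -> `|F p - F (p.1, y)| <= e)).
  move=> [w0 x0] _; have /cvgrPdist_lt/(_ _ e2) := @cF (w0, x0).
  move=> [[U V] [/= nU /nbhs_ballP[r /= r0 hV]] UV].
  have r2 : 0 < r / 2 by rewrite divr_gt0.
  exists (U `*` ball x0 (r / 2), [set q | q < r / 2]) => /=.
    split; first by exists (U, ball x0 (r / 2)) => //=; split => //; exact: nbhsx_ballx.
    exact: nbhs_right_lt.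
  move=> [[w x] q] [/= [Uw bx] qr] y xy.
  have Vx : V x by apply: hV; apply: le_ball bx; lra.
  have Vy : V y.
    apply: hV; rewrite /ball/= in bx *.
    have -> : x0 - y = (x0 - x) + (x - y) by ring.
    by apply: le_lt_trans (ler_normD _ _) _; lra.
  have h1 := UV (w, x) (conj Uw Vx); have h2 := UV (w, y) (conj Uw Vy).
  rewrite /= in h1 h2.
  have -> : F (w, x) - F (w, y) = (F (w0, x0) - F (w, y)) - (F (w0, x0) - F (w, x)) by ring.
  by apply: le_trans (ler_normB _ _) _; lra.
have [r [r0 hr]] := filter_ex (filterI (nbhs_right_gt (0 : R)) hn).
by exists r => // w x y xM xy; apply: (hr (w, x)).
Qed.

Lemma orbit_comp_cts (F : Om * R -> R) w (u : R -> R) : continuous F -> continuous u ->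
  continuous (fun t => F (sig t w, u t)).
Proof.
by move=> cF cu; apply: (cts_comp cF); apply: cts_pair => //; exact: (orbit_cts sigF).
Qed.

Lemma regular_field w : regular (fld w) (fldx w).
Proof.
have [_ [_ sD]] := sigF.
have cdo := @orbit_fun_cts _ _ sig sigF d w cd.
split.
- move=> t x.
  have D1 := is_derive_addf (is_derive_cstf (c (sig t w)) x) (is_derive_linear (d (sig t w)) x).
  by apply: is_derive_eq (is_derive_addf D1 (gxP (sig t w) x)) _; rewrite add0r.
- move=> u cu; apply: ctsD; last exact: (orbit_comp_cts cg).
  by apply: ctsD; [exact: (orbit_fun_cts sigF cc)|exact: ctsM].
- by move=> u cu; apply: ctsD => //; exact: (orbit_comp_cts cgx).
- move=> M; have [B1 h1] := param_bound M cg; have [B2 h2] := param_bound M cgx.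
  have [B3 _ h3] := cts_bounded cptOm cc; have [B4 B40 h4] := cts_bounded cptOm cd.
  exists (B3 + B4 * `|M| + `|B1| + B4 + `|B2|) => t x xM.
  have a1 := h1 (sig t w) x xM; have a2 := h2 (sig t w) x xM.
  have a3 := h3 (sig t w); have a4 := h4 (sig t w).
  have a5 : `|d (sig t w) * x| <= B4 * `|M|.
    by rewrite normrM ler_pM// (le_trans xM)// ler_norm.
  have b1 := ler_norm B1; have b2 := ler_norm B2.
  have c1 := normr_ge0 B1; have c2 := normr_ge0 B2; have c3 := normr_ge0 (c (sig t w)).
  have c4 : 0 <= B4 * `|M| by rewrite mulr_ge0// ltW.
  rewrite /= in a1 a2; split.
    apply: le_trans (ler_normD _ _) _; apply: le_trans (lerD (ler_normD _ _) (lexx _)) _; lra.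
  by apply: le_trans (ler_normD _ _) _; lra.
- move=> M e e0; have [r r0 hr] := param_unif M cgx e0; exists r => // t x y xM yM xy.
  rewrite /field_dx opprD addrACA subrr add0r; exact: (hr (sig t w) x y xM xy).
Qed.

Lemma average_d : exists2 gam, 0 < gam & exists C, forall w s t, s <= t ->
  gam * (t - s) - C <= Rint s t (fun r => d (sig r w)).
Proof.
have [||m erg|n [k [C [k0 hk]]]] :=
    @ergodic_averages _ _ sig cptOm sigF (fun _ w => - d w) 0.
- by move=> n; exact: ctsN.
- by [].
- exists 0%N; have := l2 erg; have [_ hZ] := integral_lin cptOm m measurableT.
  by have := hZ (- 1) d cd; rewrite scaleN1r mulN1r => ->; lra.
exists (- k); first lra; exists C => w s t st; have := hk w s t st.
have -> : Rint s t (fun r => - d (sig r w)) = - Rint s t (fun r => d (sig r w)); last by lra.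
rewrite -mulN1r -RintZ//; last exact: (orbit_fun_cts sigF cd).
by congr Defs.Rint; apply/funext => r; rewrite mulN1r.
Qed.

Definition concavity_defect (M : R) : Om -> R :=
  psup (square M (fun p => p.2 - p.1)) (fun q : Om * (R * R) => gx q.1 q.2.2 - gx q.1 q.2.1).

Lemma cts_fst {T U : topologicalType} : continuous (fun p : T * U => p.1).
Proof. by move=> p; exact: cvg_fst. Qed.

Lemma cts_snd {T U : topologicalType} : continuous (fun p : T * U => p.2).
Proof. by move=> p; exact: cvg_snd. Qed.

Lemma cts_arg1 (F : Om * R -> R) : continuous F -> continuous (fun q : Om * (R * R) => F (q.1, q.2.1)).
Proof.
move=> cF; apply: (cts_comp cF); apply: cts_pair; first exact: cts_fst.
by apply: (cts_comp (h := fun p : R * R => p.1)); [exact: cts_fst|exact: cts_snd].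
Qed.

Lemma cts_arg2 (F : Om * R -> R) : continuous F -> continuous (fun q : Om * (R * R) => F (q.1, q.2.2)).
Proof.
move=> cF; apply: (cts_comp cF); apply: cts_pair; first exact: cts_fst.
by apply: (cts_comp (h := fun p : R * R => p.2)); [exact: cts_snd|exact: cts_snd].
Qed.

Let cslope : continuous (fun q : Om * (R * R) => gx q.1 q.2.2 - gx q.1 q.2.1).
Proof. by apply: ctsB; [exact: (cts_arg2 cgx)|exact: (cts_arg1 cgx)]. Qed.

Let ctri (M : R) : compact (square M (fun p : R * R => p.2 - p.1)).
Proof. by apply: square_compact; apply: ctsB; [exact: cts_snd|exact: cts_fst]. Qed.

Let tri0 (M : R) : 0 <= M -> square M (fun p : R * R => p.2 - p.1) !=set0.
Proof. by move=> M0; exists (0, 0); split; rewrite /= ?normr0 ?subrr. Qed.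

Lemma defect_cts M : 0 <= M -> continuous (concavity_defect M).
Proof. by move=> M0; apply: psup_cts => //; exact: tri0. Qed.

Lemma defect_ge M w x y : 0 <= M -> - M <= x -> x <= y -> y <= M ->
  gx w y - gx w x <= concavity_defect M w.
Proof.
move=> M0 Mx xy yM.
refine (@psup_ge _ _ _ _ _ (@ctri M) (tri0 M0) cslope w (x, y) _).
by split; rewrite /= ?ler_norml ?subr_ge0//; apply/andP; split; lra.
Qed.

Lemma concave_gx w x y : concave (g w) -> x <= y -> gx w y <= gx w x.
Proof.
move=> cw; rewrite le_eqVlt => /predU1P[->//|xy].
have /andP[h1 h2] := concave_tangent cw (gxP w) xy.
have : gx w y * (y - x) <= gx w x * (y - x) by exact: le_trans h1 h2.
by rewrite ler_pM2r// subr_gt0.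
Qed.

Lemma defect0 M w : 0 <= M -> concave (g w) -> concavity_defect M w = 0.
Proof.
move=> M0 cw; apply/eqP; rewrite eq_le; apply/andP; split.
  have [[x y] [_ _ xy] [E _]] := @psup_attained _ _ _ _ _ (@ctri M) (tri0 M0) cslope w.
  rewrite /concavity_defect E; rewrite /= in xy *; rewrite subr_le0; by apply: concave_gx => //; rewrite -subr_ge0.
have := @defect_ge M w 0 0 M0; rewrite subrr; apply; rewrite ?oppr_le0//.
Qed.

Lemma concave_measurable : measurable ([set w | concave (g w)] : set (Borel Om)).
Proof.
apply: closed_borel.
have -> : [set w | concave (g w)] = \bigcap_(q in [set q : R * R * R | 0 <= q.2 <= 1])
    [set w | 0 <= g w (q.2 * q.1.1 + (1 - q.2) * q.1.2) - (q.2 * g w q.1.1 + (1 - q.2) * g w q.1.2)].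
  apply/seteqP; split => w /=.
    by move=> cw [[x y] t] /= t01; rewrite subr_ge0; exact: cw.
  by move=> h x y t t01; have := h (x, y, t) t01; rewrite /= subr_ge0.
apply: closed_bigI => -[[x y] t] _ /=.
have cgw (z : R) : continuous (fun w => g w z).
  apply: (cts_comp (h := fun p : Om * R => g p.1 p.2) (k := fun w => (w, z))) => //.
  by apply: cts_pair => w; [exact: cvg_id|exact: cvg_cst].
apply: (@preimage_closed _ _ (fun w => g w (t * x + (1 - t) * y) - (t * g w x + (1 - t) * g w y))
   [set z | 0 <= z]); last exact: closed_ge.
by move=> w _; apply: ctsB => //; apply: ctsD; apply: ctsM => //; exact: ctsC.
Qed.

Lemma average_defect M kap : 0 <= M -> 0 < kap -> exists C, forall w s t, s <= t ->
  Rint s t (fun r => concavity_defect M (sig r w)) <= kap * (t - s) + C.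
Proof.
move=> M0 k0; have [||m erg|n [k [C [kk hk]]]] :=
    @ergodic_averages _ _ sig cptOm sigF (fun _ => concavity_defect M) kap.
- by move=> n; exact: defect_cts.
- by [].
- exists 0%N; rewrite (ae_zero_integral cptOm concave_measurable (l5 erg))//.
    exact: defect_cts.
  by move=> w; exact: defect0.
exists C => w s t st; apply: le_trans (hk w s t st) _.
by rewrite lerD2r ler_wpM2r ?subr_ge0// ltW.
Qed.

Section Orbit.
Variable w : Om.
Let D := primitive (fun r => d (sig r w)).
Let cdo : continuous (fun r => d (sig r w)). Proof. exact: (orbit_fun_cts sigF cd). Qed.
Let HD : forall t : R, is_derive t 1 D (d (sig t w)). Proof. exact: is_derive_primitive. Qed.
Let Dgrow : exists2 gam, 0 < gam & exists C, forall s t, s <= t -> gam * (t - s) - C <= D t - D s.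
Proof.
have [gam g0 [C hC]] := average_d; exists gam => //; exists C => s t st.
by rewrite -primitiveE//; exact: hC.
Qed.

Lemma repelling_forcing (q : R -> R) Q : continuous q -> (forall t, 0 <= q t <= Q) ->
  exists y Cy, [/\ forall t : R, is_derive t 1 y (d (sig t w) * y t - q t), 0 <= Cy &
    forall t, 0 <= y t <= Cy].
Proof.
move=> cq q01; have [gam g0 [C hC]] := Dgrow.
have H1 : forall t : R, is_derive t 1 (fun t => D (- t)) (- d (sig (- t) w)).
  by move=> r; exact: is_derive_refl (HD (- r)).
have d1 : decays (fun t => D (- t)) C gam.
  by move=> r r' rr; have := hC (- r') (- r); rewrite lerN2 => /(_ rr); lra.
have co : continuous (fun t : R => - t) by move=> t; exact: cvgN.
have cq' : continuous (fun t => q (- t)) by exact: cts_comp cq co.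
have [p [Cp [Hp Cp0 bp]]] := bounded_forcing g0 d1 H1 cq' (fun t => q01 (- t)).
exists (fun t => p (- t)), Cp; split => // t.
apply: is_derive_eq (is_derive_refl (Hp (- t))) _.
by rewrite !opprK; ring.
Qed.

Lemma linear_bounded (q : R -> R) Q : continuous q -> (forall t, `|q t| <= Q) ->
  exists2 b, (forall t : R, is_derive t 1 b (d (sig t w) * b t + q t)) &
    exists M, forall t, `|b t| <= M.
Proof.
move=> cq bq; have Q0 : 0 <= Q by exact: le_trans (bq 0).
have [||y1 [C1 [H1 _ b1]]] := @repelling_forcing (fun t => Q - q t) (2 * Q).
- by apply: ctsB => //; exact: ctsC.
- by move=> t; have := bq t; rewrite ler_norml => /andP[]; lra.
have [||y2 [C2 [H2 _ b2]]] := @repelling_forcing (fun=> Q) Q.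
- exact: ctsC.
- by move=> t; rewrite Q0 lexx.
exists (fun t => y1 t - y2 t).
  by move=> t; apply: is_derive_eq (is_derive_subf (H1 t) (H2 t)) _; ring.
exists (C1 + C2) => t; have /andP[x1 x2] := b1 t; have /andP[x3 x4] := b2 t.
by rewrite ler_norml; apply/andP; split; lra.
Qed.

Lemma kappa_exists : exists kap k1 k2, [/\ 0 < k1,
  forall t : R, is_derive t 1 kap (d (sig t w) * kap t - 1) & forall t, k1 <= kap t <= k2].
Proof.
have [||y [Cy [Hy _ by_]]] := @repelling_forcing (fun=> 1) 1.
- exact: ctsC.
- by move=> t; rewrite ler01 lexx.
have [L L0 HL] := cts_bounded cptOm cd.
exists y, L^-1, Cy; split; rewrite ?invr_gt0// => t; have /andP[y0 ->] := by_ t; rewrite andbT.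
rewrite -subr_le0.
have Hw : forall t : R, is_derive t 1 (fun t => L^-1 - y t) (0 - (d (sig t w) * y t - 1)).
  by move=> r; exact: is_derive_subf (is_derive_cstf _ _) (Hy r).
have gr : forall s t : R, s <= t -> L * (t - s) - 0 <= L * t - L * s by move=> r r' _; lra.
apply: (grow_le0 L0 gr (is_derive_linear L) Hw (W := L^-1)) => r.
  by rewrite gerBl; case/andP: (by_ r).
have /andP[yr _] := by_ r; rewrite mulrBr mulfV ?gt_eqF//.
have := ler_wpM2r yr (le_trans (ler_norm _) (HL (sig r w))); lra.
Qed.

Lemma beta_exists lam : exists2 b,
  (forall t : R, is_derive t 1 b (c (sig t w) + d (sig t w) * b t + lam)) &
  exists M, forall t, `|b t| <= M.
Proof.
have [B _ HB] := cts_bounded cptOm cc.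
have [||b Hb bb] := @linear_bounded (fun t => c (sig t w) + lam) (B + `|lam|).
- by apply: ctsD; [exact: (orbit_fun_cts sigF cc)|exact: ctsC].
- by move=> t; apply: le_trans (ler_normD _ _) _; rewrite lerD2r.
by exists b => // t; apply: is_derive_eq (Hb t) _; ring.
Qed.

Lemma lower_ge_beta lam v b t : lower_sol (fld w) lam v ->
  (forall t : R, is_derive t 1 b (c (sig t w) + d (sig t w) * b t + lam)) ->
  (exists M, forall t, `|b t| <= M) -> b t <= v t.
Proof.
move=> [dv [Hv dvb [M HM]]] Hb [M' HM']; rewrite -subr_le0.
have [gam g0 [C hC]] := Dgrow.
have Hw : forall t : R, is_derive t 1 (fun t => b t - v t)
    ((c (sig t w) + d (sig t w) * b t + lam) - dv t).
  by move=> r; exact: is_derive_subf (Hb r) (Hv r).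
apply: (grow_le0 g0 hC HD Hw (W := M' + M)) => r.
  have := HM r; have := HM' r; rewrite !ler_norml => /andP[x1 x2] /andP[x3 x4]; lra.
by have := dvb r; have := l4le (sig r w) (v r); rewrite /field_of; lra.
Qed.

Lemma coercive lam : exists X, forall lam' t x, lam' <= lam -> X < x ->
  fld w t x + lam' <= - 1.
Proof.
have [B _ HB] := cts_bounded cptOm cc; have [X HX] := l3 (- (B + lam + 1)).
exists X => lam' t x ll Xx; have := HX (sig t w) x Xx.
have := ler_norm (c (sig t w)); have := HB (sig t w); rewrite /field_of; lra.
Qed.

Lemma bsol_le_coercive lam X lam' u t : (forall lam' t x, lam' <= lam -> X < x ->
  fld w t x + lam' <= - 1) -> lam' <= lam -> bounded_solution (peqn (fld w) lam') u -> u t <= X.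
Proof.
move=> HX ll Hu; rewrite leNgt; apply/negP => Xu.
have [_ [M HM]] := Hu; pose s := t - (`|M| + `|u t| + 1).
have st : s <= t by rewrite /s lerBlDr lerDl !addr_ge0.
have : u t + (t - s) <= u s.
  have D1 : forall r : R, is_derive r 1 (fun r => u t + (t - r)) (0 + (0 - 1)).
    move=> r; exact: is_derive_addf (is_derive_cstf _ _) (is_derive_subf (is_derive_cstf _ _) (is_derive_idf r)).
  apply: (compare_bwd (regular_field w) (lam := lam') (u := fun r => u t + (t - r)) st
    (fun r _ => D1 r) (fun r _ => bsol_der Hu r)); last by rewrite subrr addr0.
    by move=> r /andP[_ rt]; rewrite sub0r add0r; apply: HX => //; lra.
  by move=> r _; rewrite lexx.
have := HM s; rewrite ler_norml => /andP[_ h1].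
have := ler_norm M; have := ler_norm (- u t); rewrite normrN /s; lra.
Qed.

Lemma field_apriori lam : exists N, forall lam' u, lam' <= lam ->
  bounded_solution (peqn (fld w) lam') u -> forall t, `|u t| <= N.
Proof.
have [b Hb [M HM]] := beta_exists lam; have [X HX] := coercive lam.
exists (`|X| + M) => lam' u ll Hu t.
have h1 := bsol_le_coercive t HX ll Hu.
have h2 := lower_ge_beta t (bsol_lower ll Hu) Hb (ex_intro _ M HM).
have := HM t; have := ler_norm X; have : 0 <= `|X| by [].
by rewrite !ler_norml => x0 x1 /andP[x2 x3]; apply/andP; split; lra.
Qed.

Lemma field_lower lam v s : lower_sol (fld w) lam v ->
  exists2 u, bounded_solution (peqn (fld w) lam) u & u s = v s.
Proof.
move=> Hv; have [dv [Hdv dvb [Mv HMv]]] := Hv; have reg := regular_field w.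
have [b Hb [Mb HMb]] := beta_exists lam; have [X HX] := coercive lam.
have Mv0 : 0 <= Mv by exact: le_trans (HMv 0).
have Mb0 : 0 <= Mb by exact: le_trans (HMb 0).
pose K := Mv + Mb + `|X| + 1.
have X0 : 0 <= `|X| by []. have Xn := ler_norm X.
have K0 : 0 <= K by rewrite /K; lra.
have [u us Hu] := @trunc_sol _ _ _ reg K lam s (v s) K0.
have [L L0 HL] := reg_lip reg K.
have lip r (y z : R) : fld w r (clamp K y) - fld w r (clamp K z) <= L * `|y - z|.
  apply: le_trans (ler_norm _) _.
  apply: le_trans (HL _ _ _ (clamp_bound _ K0) (clamp_bound _ K0)) _.
  by rewrite ler_pM2l// clamp_lip.
have vK r : clamp K (v r) = v r by apply: clamp_id; have := HMv r; rewrite /K; lra.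
have bK r : clamp K (b r) = b r by apply: clamp_id; have := HMb r; rewrite /K; lra.
have KK : clamp K K = K by apply: clamp_id; rewrite ger0_norm.
have uv r : dv r - (fld w r (clamp K (u r)) + lam) <= L * `|v r - u r|.
  by have := lip r (v r) (u r); have := dvb r; rewrite vK; lra.
have ub r : (fld w r (clamp K (u r)) + lam) - (c (sig r w) + d (sig r w) * b r + lam) <= L * `|u r - b r|.
  have := lip r (u r) (b r); have := l4le (sig r w) (b r); rewrite bK {2}/field_of; lra.
have uK r : (fld w r (clamp K (u r)) + lam) - 0 <= L * `|u r - K|.
  have := lip r (u r) K; rewrite KK.
  have : fld w r K + lam <= - 1 by apply: HX => //; rewrite /K; lra.
  lra.
have bv := lower_ge_beta s Hv Hb (ex_intro _ Mb HMb).
exists u => //; apply: (trunc_bsol (K := K) Hu) => t.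
have := HMv t; have := HMb t; rewrite !ler_norml => /andP[x1 x2] /andP[x3 x4].
have [st|/ltW ts] := leP s t.
  have h1 : v t <= u t.
    apply: (comparison_fwd st (fun r _ => Hu r) (fun r _ => Hdv r) (fun r _ => uv r)).
    by rewrite us.
  have h2 : u t <= K.
    apply: (@comparison_fwd _ (fun=> K) u (fun=> 0) _ L s t st (fun r _ => is_derive_cstf K r)
      (fun r _ => Hu r) (fun r _ => uK r)).
    by rewrite us; have := HMv s; rewrite ler_norml /K => /andP[]; lra.
  by apply/andP; split; move: h1 h2; rewrite /K; lra.
have h1 : u t <= v t.
  apply: (comparison_bwd ts (fun r _ => Hu r) (fun r _ => Hdv r) (fun r _ => uv r)).
  by rewrite us.
have h2 : b t <= u t.
  apply: (comparison_bwd ts (fun r _ => Hb r) (fun r _ => Hu r) (fun r _ => ub r)).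
  by rewrite us.
by apply/andP; split; move: h1 h2; rewrite /K; lra.
Qed.

Lemma field_none : exists lam, forall lam', lam' < lam -> forall u,
  ~ bounded_solution (peqn (fld w) lam') u.
Proof.
have [b Hb [M HM]] := beta_exists 0; have [X HX] := coercive 0.
have [kap [k1 [k2 [k10 Hk bk]]]] := kappa_exists.
exists (Num.min 0 (- (M + `|X| + 1) / k1)) => lam'; rewrite lt_min => /andP[l0 l1] u Hu.
have h1 := bsol_le_coercive 0 HX (ltW l0) Hu.
have Hb' : forall t : R, is_derive t 1 (fun t => b t - lam' * kap t)
    (c (sig t w) + d (sig t w) * (b t - lam' * kap t) + lam').
  by move=> t; apply: is_derive_eq (is_derive_subf (Hb t) (is_derive_scalef lam' (Hk t))) _; ring.
have bb' : exists M', forall t, `|b t - lam' * kap t| <= M'.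
  exists (M + `|lam'| * k2) => t; apply: le_trans (ler_normB _ _) _; apply: lerD => //.
  have /andP[a1 a2] := bk t; rewrite normrM ler_wpM2l// ger0_norm//; lra.
have h2 := lower_ge_beta 0 (bsol_lower (lexx _) Hu) Hb' bb'.
have := HM 0; rewrite ler_norml => /andP[x1 x2].
have /andP[a1 a2] := bk 0.
rewrite ltr_pdivlMr// in l1.
have h3 : lam' * kap 0 <= lam' * k1 by rewrite ler_nM2l.
have := ler_norm X; lra.
Qed.

Lemma field_right lam s x (al be : \bar R) u : is_maximal_solution (peqn (fld w) lam) s x al be u ->
  blowup_right al be u \/ be = +oo%E /\ exists M, forall t, s <= t -> `|u t| <= M.
Proof.
move=> Hm; have [/andP[s1 s2] [us [Hu _]]] := Hm; have reg := regular_field w.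
have [X HX] := coercive lam; have [b Hb [Mb HMb]] := beta_exists lam.
have Mb0 : 0 <= Mb by exact: le_trans (HMb 0).
have [gam g0 [C hC]] := Dgrow.
have Hud t : s <= t -> (t%:E < be)%E -> is_derive t 1 u (fld w t (u t) + lam).
  move=> st tb; apply: Hu; apply/andP; split => //; apply: lt_le_trans s1 _; by rewrite lee_fin.
have sub r t : r <= t -> (t%:E < be)%E -> (r%:E < be)%E.
  by move=> rt; apply: le_lt_trans; rewrite lee_fin.
have upb t : s <= t -> (t%:E < be)%E -> u t <= Num.max (X + 1) x.
  move=> st tb; pose Kc := Num.max (X + 1) x.
  have XK : X < Kc by rewrite /Kc lt_max; apply/orP; left; lra.
  apply: (compare_fwd reg (lam := lam) (u := fun=> Kc) (du := fun=> 0)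
    (dv := fun r => fld w r (u r) + lam) st (fun r _ => is_derive_cstf Kc r)).
  - by move=> r /andP[sr rt]; apply: Hud => //; exact: sub rt tb.
  - by move=> r _; have := HX lam r Kc (lexx _) XK; lra.
  - by move=> r _; rewrite lexx.
  - by rewrite us /Kc le_max lexx orbT.
have [[M HM]|nb] := pselect (exists M, forall t, s <= t -> (t%:E < be)%E -> - M <= u t).
  right; pose M' := `|M| + `|Num.max (X + 1) x|.
  have bu t : s <= t -> (t%:E < be)%E -> `|u t| <= M'.
    move=> st tb; have := HM t st tb; have := upb t st tb.
    have := ler_norm M; have := ler_norm (Num.max (X + 1) x).
    have : 0 <= `|M| by []. have : 0 <= `|Num.max (X + 1) x| by [].
    by rewrite ler_norml /M' => q1 q2 q3 q4 q5 q6; apply/andP; split; lra.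
  have beE := bounded_extends reg Hm bu.
  by split => //; exists M' => t st; apply: bu => //; rewrite beE ltry.
left => M.
have [t1 [st1 t1b ut1]] : exists t1, [/\ s <= t1, (t1%:E < be)%E &
    u t1 < - (expR C * (`|M| + Mb + 1) + Mb)].
  apply: contrapT => nE; apply: nb; exists (expR C * (`|M| + Mb + 1) + Mb) => t st tb.
  by rewrite leNgt; apply/negP => h; apply: nE; exists t.
exists t1; split; first by apply/andP; split => //; apply: lt_le_trans s1 _; rewrite lee_fin.
move=> t t1t tb.
have Hz : forall r, t1 <= r <= t -> is_derive r 1 (fun r => b r - u r)
    ((c (sig r w) + d (sig r w) * b r + lam) - (fld w r (u r) + lam)).
  move=> r /andP[r1 r2]; apply: is_derive_subf (Hb r) (Hud r _ _); first exact: le_trans r1.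
  exact: sub r2 tb.
have hg : (b t1 - u t1) * expR (D t - D t1) <= b t - u t.
  apply: (gronwall_ge (ltW t1t) Hz (fun r _ => HD r)) => r _.
  have := l4le (sig r w) (u r); rewrite /field_of; lra.
have := HMb t; have := HMb t1; rewrite !ler_norml => /andP[x1 x2] /andP[x3 x4].
have w1 : expR C * (`|M| + Mb + 1) <= b t1 - u t1 by lra.
have e1 : expR (- C) <= expR (D t - D t1).
  rewrite ler_expR; have := hC t1 t (ltW t1t).
  have : 0 <= gam * (t - t1) by rewrite mulr_ge0 ?(ltW g0)// subr_ge0 ltW.
  lra.
have M1 : 0 <= `|M| + Mb + 1 by have : 0 <= `|M| by []; lra.
have : expR C * (`|M| + Mb + 1) * expR (- C) <= (b t1 - u t1) * expR (D t - D t1).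
  by apply: ler_pM => //; rewrite ?mulr_ge0 ?expR_ge0.
rewrite mulrAC -expRD subrr expR0 mul1r => e2.
have := ler_norm M; lra.
Qed.

Lemma field_left lam s x (al be : \bar R) u : is_maximal_solution (peqn (fld w) lam) s x al be u ->
  blowup_left al be u \/ al = -oo%E /\ exists M, forall t, t <= s -> `|u t| <= M.
Proof.
move=> Hm; have [/andP[s1 s2] [us [Hu _]]] := Hm; have reg := regular_field w.
have [X HX] := coercive lam; have [b Hb [Mb HMb]] := beta_exists lam.
have Mb0 : 0 <= Mb by exact: le_trans (HMb 0).
have [gam g0 [C hC]] := Dgrow.
have Hud t : t <= s -> (al < t%:E)%E -> is_derive t 1 u (fld w t (u t) + lam).
  move=> st tb; apply: Hu; apply/andP; split => //; apply: le_lt_trans s2; by rewrite lee_fin.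
have sub r t : t <= r -> (al < t%:E)%E -> (al < r%:E)%E.
  by move=> rt /lt_le_trans; apply; rewrite lee_fin.
have lob t : t <= s -> (al < t%:E)%E -> - (Mb + `|b s - x| * expR C) <= u t.
  move=> ts ta.
  have Hz : forall r, t <= r <= s -> is_derive r 1 (fun r => b r - u r)
      ((c (sig r w) + d (sig r w) * b r + lam) - (fld w r (u r) + lam)).
    by move=> r /andP[r1 r2]; apply: is_derive_subf (Hb r) (Hud r r2 (sub _ _ r1 ta)).
  have hg : (b t - u t) * expR (D s - D t) <= b s - u s.
    apply: (gronwall_ge ts Hz (fun r _ => HD r)) => r _.
    have := l4le (sig r w) (u r); rewrite /field_of; lra.
  have h1 : b t - u t <= `|b s - x| * expR C.
    have e1 : expR (- (D s - D t)) <= expR C.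
      rewrite ler_expR; have := hC t s ts.
      have : 0 <= gam * (s - t) by rewrite mulr_ge0 ?(ltW g0)// subr_ge0.
      lra.
    have : b t - u t <= (b s - u s) * expR (- (D s - D t)).
      by rewrite expRN -ler_pdivrMr ?invr_gt0 ?expR_gt0// invrK.
    move=> h; apply: le_trans h _; rewrite us; apply: le_trans (ler_norm _) _.
    by rewrite normrM ler_wpM2l// ger0_norm ?expR_ge0.
  by have := HMb t; rewrite ler_norml => /andP[]; lra.
have [[M HM]|nb] := pselect (exists M, forall t, t <= s -> (al < t%:E)%E -> u t <= M).
  right; pose M' := `|M| + (Mb + `|b s - x| * expR C).
  have p0 : 0 <= `|b s - x| * expR C by rewrite mulr_ge0// expR_ge0.
  have bu t : t <= s -> (al < t%:E)%E -> `|u t| <= M'.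
    move=> st tb; have := HM t st tb; have := lob t st tb; have := ler_norm M.
    have : 0 <= `|M| by [].
    by rewrite ler_norml /M' => q1 q2 q3 q4; apply/andP; split; lra.
  have alE := bounded_extends_left reg Hm bu.
  by split => //; exists M' => t st; apply: bu => //; rewrite alE ltNyr.
left => M.
have [t1 [st1 t1b ut1]] : exists t1, [/\ t1 <= s, (al < t1%:E)%E & Num.max M (X + 1) < u t1].
  apply: contrapT => nE; apply: nb; exists (Num.max M (X + 1)) => t st tb.
  by rewrite leNgt; apply/negP => h; apply: nE; exists t.
move: ut1; rewrite gt_max => /andP[um uX].
exists t1; split; first by apply/andP; split => //; apply: le_lt_trans s2; rewrite lee_fin.
move=> t ta tt1; apply: lt_le_trans um _.
have XK : X < u t1 by lra.
apply: (compare_bwd reg (lam := lam) (u := fun=> u t1) (du := fun=> 0) (v := u)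
  (dv := fun r => fld w r (u r) + lam) (ltW tt1) (fun r _ => is_derive_cstf (u t1) r)) => //.
- by move=> r /andP[r1 r2]; apply: Hud; [exact: le_trans r2 st1|exact: sub r1 ta].
- by move=> r _; have := HX lam r (u t1) (lexx _) XK; lra.
Qed.

Theorem field_concave_eq : concave_eq (fld w) (fldx w).
Proof.
split.
- exact: regular_field.
- move=> M kap k0; have M0 : 0 <= `|M| by [].
  have [C hC] := average_defect M0 k0.
  have cE := @orbit_fun_cts _ _ sig sigF _ w (defect_cts M0).
  exists (primitive (fun r => concavity_defect `|M| (sig r w))),
    (fun r => concavity_defect `|M| (sig r w)), C; split.
  + exact: is_derive_primitive.
  + move=> t x y Mx xy yM; rewrite /field_dx opprD addrACA subrr add0r.
    by have := ler_norm M => q; apply: defect_ge => //; lra.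
  + by move=> s t st; rewrite -primitiveE//; exact: hC.
- exact: field_apriori.
- exact: field_lower.
- exact: field_none.
- exact: field_right.
- exact: field_left.
Qed.

End Orbit.
End Concrete.

(** * Uniformly separated solutions *)

Section Cutoff.
Context {R : realType}.

Definition cutoff (eta x : R) : R := Num.max (1 - Num.max ((x - eta) / eta) 0 ^+ 2) 0 ^+ 2.

Definition dcutoff (eta x : R) : R :=
  (0 - eta^-1 * (2 * Num.max ((x - eta) / eta) 0)) *
  (2 * Num.max (1 - Num.max ((x - eta) / eta) 0 ^+ 2) 0).

Lemma is_derive_cutoff (eta x : R) : is_derive x 1 (cutoff eta) (dcutoff eta x).
Proof.
have D1 : is_derive x 1 (fun y : R => (y - eta) / eta) eta^-1.
  apply: (is_derive_ext (v := fun y => eta^-1 * y - eta / eta)); first by move=> y; ring.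
  by apply: is_derive_eq (is_derive_subf (is_derive_linear _ _) (is_derive_cstf _ _)) _; rewrite subr0.
have D2 := is_derive_compf (u := fun y => Num.max y 0 ^+ 2) (v := fun y => (y - eta) / eta)
  (is_derive_pos_sqr _) D1.
have D3 := is_derive_subf (is_derive_cstf 1 x) D2.
exact: (is_derive_compf (u := fun y => Num.max y 0 ^+ 2)
  (v := fun y => 1 - Num.max ((y - eta) / eta) 0 ^+ 2) (is_derive_pos_sqr _) D3).
Qed.

Lemma cutoff_left eta x : 0 < eta -> x <= eta -> cutoff eta x = 1 /\ dcutoff eta x = 0.
Proof.
move=> e0 xe; have h : (x - eta) / eta <= 0 by rewrite pmulr_lle0 ?invr_gt0// subr_le0.
rewrite /cutoff /dcutoff (max_r h) expr0n/= subr0 max_l ?ler01// expr1n; split => //; ring.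
Qed.

Lemma cutoff_right eta x : 0 < eta -> 2 * eta <= x -> cutoff eta x = 0 /\ dcutoff eta x = 0.
Proof.
move=> e0 xe; have h : 1 <= (x - eta) / eta by rewrite ler_pdivlMr//; lra.
have h1 : 1 - Num.max ((x - eta) / eta) 0 ^+ 2 <= 0.
  by rewrite subr_le0 max_l; [rewrite -[leLHS](expr1n _ 2) lerXn2r ?nnegrE//|]; lra.
by rewrite /cutoff /dcutoff (max_r h1) expr0n/= !mulr0.
Qed.

Lemma cutoff_bound eta x : 0 <= cutoff eta x <= 1.
Proof.
rewrite /cutoff; set y := Num.max ((x - eta) / eta) 0 ^+ 2.
have y0 : 0 <= y by rewrite sqr_ge0.
have [h|/ltW h] := leP (1 - y) 0; first by rewrite expr0n/= lexx ler01.
by rewrite sqr_ge0/= expr_le1//; lra.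
Qed.

Lemma dcutoff_bound eta x : 0 < eta -> `|dcutoff eta x| <= 4 / eta.
Proof.
move=> e0; have [xe|xe] := leP x eta.
  by rewrite (cutoff_left e0 xe).2 normr0 divr_ge0// ltW.
have [ye|ye] := leP (2 * eta) x.
  by rewrite (cutoff_right e0 ye).2 normr0 divr_ge0// ltW.
have h0 : 0 <= (x - eta) / eta by rewrite divr_ge0; lra.
have h1 : (x - eta) / eta <= 1 by rewrite ler_pdivrMr; lra.
rewrite /dcutoff max_l//; move: ((x - eta) / eta) h0 h1 => y h0 h1.
have y2 : y ^+ 2 <= 1 by rewrite expr_le1.
have y20 := sqr_ge0 y.
rewrite max_l; last by rewrite subr_ge0.
have -> : (0 - eta^-1 * (2 * y)) * (2 * (1 - y ^+ 2)) = - (4 / eta * (y * (1 - y ^+ 2))) by ring.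
have p0 : 0 <= 4 / eta by rewrite divr_ge0// ltW.
rewrite normrN ger0_norm; last by rewrite mulr_ge0// mulr_ge0// subr_ge0.
rewrite -[leRHS]mulr1; apply: ler_wpM2l => //.
by rewrite -[leRHS]mulr1; apply: ler_pM; rewrite ?subr_ge0// gerBl.
Qed.

End Cutoff.

Section Separation.
Context {R : realType} {Om : pseudoPMetricType R}.
Variables (sig : R -> Om -> Om) (c d : Om -> R) (g gx : Om -> R -> R).
Hypothesis cptOm : compact [set: Om].
Hypothesis sigF : is_flow sig.
Hypothesis cc : continuous c.
Hypothesis cd : continuous d.
Hypothesis cg : continuous (fun p : Om * R => g p.1 p.2).
Hypothesis gxP : forall w (x : R), is_derive x 1 (g w) (gx w x).
Hypothesis cgx : continuous (fun p : Om * R => gx p.1 p.2).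
Hypothesis l2 : forall m : probability (Borel Om) R, erg_measure sig m ->
  0 < Rintegral m setT (d : Borel Om -> R).
Hypothesis l3 : forall M : R, exists X : R, forall w x, X < x -> d w * x + g w x < M.
Hypothesis l4le : forall w x, g w x <= 0.
Hypothesis l4eq : forall w (x : R), x <= 0 -> g w x = 0.
Hypothesis l4neg : forall m : probability (Borel Om) R, erg_measure sig m ->
  m [set w | forall x, 0 < x -> g w x < 0] = 1%E.
Hypothesis l5 : forall m : probability (Borel Om) R, erg_measure sig m ->
  m [set w | concave (g w)] = 1%E.
Hypothesis l6 : forall M : R, 0 < M -> forall m : probability (Borel Om) R, erg_measure sig m ->
  (0 < m [set w | forall x y : R, (0 <= x -> x < y -> y <= M -> gx w y < gx w x)%R])%E.

Local Notation fld := (field_of sig c d g).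
Local Notation fldx := (field_dx sig d gx).

Lemma psup_open (K : set (R * R)) (F : Om * (R * R) -> R) : compact K -> K !=set0 ->
  continuous F -> measurable ([set w | psup K F w < 0] : set (Borel Om)).
Proof.
move=> cK K0 cF; apply: open_borel.
apply: (@open_comp _ _ (psup K F) [set x | x < 0]); last exact: open_lt.
by move=> w _; exact: psup_cts.
Qed.

Lemma neg_measurable : measurable ([set w | forall x, 0 < x -> g w x < 0] : set (Borel Om)).
Proof.
pose K (n : nat) := square (n.+1%:R : R) (fun p : R * R => p.2 - n.+1%:R^-1).
have cK n : compact (K n).
  by apply: square_compact; apply: ctsB; [exact: cts_snd|exact: ctsC].
have n0 (n : nat) : (0 : R) < n.+1%:R by rewrite ltr0n.
have n1 (n : nat) : (1 : R) <= n.+1%:R by rewrite ler1n.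
have K0 n : K n !=set0.
  by exists (0, 1); split => /=; [rewrite normr0 ltW|rewrite normr1|rewrite subr_ge0 invf_le1].
have cF : continuous (fun q : Om * (R * R) => g q.1 q.2.2) by exact: (cts_arg2 cg).
have -> : [set w | forall x, 0 < x -> g w x < 0] =
    \bigcap_n [set w | psup (K n) (fun q : Om * (R * R) => g q.1 q.2.2) w < 0].
  apply/seteqP; split => w /=.
    move=> h n _ /=; have [[x y] [_ _ xy] [-> _]] := psup_attained (@cK n) (K0 n) cF w.
    apply: h => /=; rewrite /= subr_ge0 in xy.
    by apply: lt_le_trans xy; rewrite invr_gt0.
  move=> h x x0; have xi0 : 0 <= x^-1 by rewrite invr_ge0 ltW.
  pose n := maxn (Num.truncn x) (Num.truncn x^-1).
  apply: le_lt_trans (h n I) => /=.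
  have /andP[_ q1] := truncn_itv (ltW x0); have /andP[_ q2] := truncn_itv xi0.
  have q3 : x <= n.+1%:R.
    by apply: le_trans (ltW q1) _; rewrite ler_nat ltnS leq_maxl.
  have q4 : n.+1%:R^-1 <= x.
    rewrite -[leRHS]invrK lef_pV2 ?posrE ?invr_gt0//.
    by apply: le_trans (ltW q2) _; rewrite ler_nat ltnS leq_maxr.
  refine (@psup_ge _ _ _ _ _ (@cK n) (K0 n) cF w (0, x) _).
  by split; rewrite /= ?normr0 ?(ltW (n0 n))// ?subr_ge0// gtr0_norm.
by apply: bigcapT_measurable => n; exact: psup_open.
Qed.

Lemma strict_measurable M : 0 < M -> measurable ([set w | forall x y : R,
  (0 <= x -> x < y -> y <= M -> gx w y < gx w x)%R] : set (Borel Om)).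
Proof.
move=> M0.
pose K (n : nat) := square M (fun p : R * R => Num.min p.1 (p.2 - p.1 - M / n.+1%:R)).
have n0 (n : nat) : (0 : R) < n.+1%:R by rewrite ltr0n.
have n1 (n : nat) : (1 : R) <= n.+1%:R by rewrite ler1n.
have cK n : compact (K n).
  apply: square_compact; apply: ctsmin; first exact: cts_fst.
  by apply: ctsB; [apply: ctsB; [exact: cts_snd|exact: cts_fst]|exact: ctsC].
have K0 n : K n !=set0.
  exists (0, M); split; rewrite /= ?normr0 ?(ltW M0) ?ger0_norm ?(ltW M0)//.
  rewrite le_min lexx/= subr0 subr_ge0 ler_pdivrMr//.
  by rewrite -[leLHS]mulr1 ler_pM2l.
have cF : continuous (fun q : Om * (R * R) => gx q.1 q.2.2 - gx q.1 q.2.1).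
  by apply: ctsB; [exact: (cts_arg2 cgx)|exact: (cts_arg1 cgx)].
have -> : [set w | forall x y : R, (0 <= x -> x < y -> y <= M -> gx w y < gx w x)%R] =
    \bigcap_n [set w | psup (K n) (fun q : Om * (R * R) => gx q.1 q.2.2 - gx q.1 q.2.1) w < 0].
  apply/seteqP; split => w /=.
    move=> h n _ /=; have [[x y] [_ yM xy] [-> _]] := psup_attained (@cK n) (K0 n) cF w.
    rewrite /= in yM xy *; rewrite subr_lt0.
    move: xy; rewrite le_min => /andP[x0]; rewrite subr_ge0 => xy.
    have : 0 < M / n.+1%:R by rewrite divr_gt0.
    move=> q; apply: h => //; first by rewrite -subr_gt0; exact: lt_le_trans q xy.
    by apply: le_trans (ler_norm _) yM.
  move=> h x y x0 xy yM; rewrite -subr_lt0.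
  have yx : 0 < y - x by rewrite subr_gt0.
  have q0 : 0 <= M / (y - x) by rewrite divr_ge0 ?ltW.
  pose n := Num.truncn (M / (y - x)).
  apply: le_lt_trans (h n I) => /=.
  have /andP[_ /ltW q1] := truncn_itv q0.
  refine (@psup_ge _ _ _ _ _ (@cK n) (K0 n) cF w (x, y) _).
  split; rewrite /= ?ger0_norm//; try lra.
  rewrite le_min x0/= subr_ge0 ler_pdivrMr//.
  by rewrite ler_pdivrMr// mulrC in q1.
by apply: bigcapT_measurable => n; exact: psup_open.
Qed.

Definition slope_gap (e : R) (q : Om * (R * R)) : R :=
  gx q.1 q.2.2 - (g q.1 q.2.2 - g q.1 q.2.1) / Num.max e (q.2.2 - q.2.1).

Lemma slope_gap_cts e : 0 < e -> continuous (slope_gap e).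
Proof.
move=> e0; apply: ctsB; first exact: (cts_arg2 cgx).
apply: ctsM; first by apply: ctsB; [exact: (cts_arg2 cg)|exact: (cts_arg1 cg)].
have cm : continuous (fun q : Om * (R * R) => Num.max e (q.2.2 - q.2.1)).
  apply: ctsmax; first exact: ctsC.
  apply: ctsB; first by apply: (cts_comp (h := fun p : R * R => p.2)); [exact: cts_snd|exact: cts_snd].
  by apply: (cts_comp (h := fun p : R * R => p.1)); [exact: cts_fst|exact: cts_snd].
move=> q; apply: cvgV; last exact: cm.
by rewrite gt_eqF// lt_max e0.
Qed.

Section Thresholds.
Variables (M eta e : R).
Hypothesis eta0 : 0 < eta.
Hypothesis etae : 2 * eta <= e.
Hypothesis eM : e <= M.

Let KP := square M (fun p : R * R => Num.min (- eta - p.1) (p.2 - eta)).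
Let KL := square M (fun p : R * R => Num.min (p.1 + eta) (p.2 - p.1 - e)).

Definition gapP (w : Om) : R := - psup KP (slope_gap (2 * eta)) w.
Definition gapL (w : Om) : R := - psup KL (slope_gap (2 * eta)) w.

Let e20 : 0 < 2 * eta. Proof. by rewrite mulr_gt0. Qed.

Let cKP : compact KP.
Proof.
apply: square_compact; apply: ctsmin; apply: ctsB; try exact: ctsC;
  [exact: cts_fst|exact: cts_snd].
Qed.

Let cKL : compact KL.
Proof.
apply: square_compact; apply: ctsmin; first by apply: ctsD; [exact: cts_fst|exact: ctsC].
by apply: ctsB; [apply: ctsB; [exact: cts_snd|exact: cts_fst]|exact: ctsC].
Qed.

Let KP0 : KP !=set0.
Proof.
have h1 := eta0; have h2 := etae; have h3 := eM.
exists (- eta, eta); split => /=.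
- by rewrite normrN gtr0_norm//; lra.
- by rewrite gtr0_norm//; lra.
- by rewrite le_min; apply/andP; split; lra.
Qed.

Let KL0 : KL !=set0.
Proof.
have h1 := eta0; have h2 := etae; have h3 := eM.
exists (0, e); split => /=.
- by rewrite normr0; lra.
- by rewrite ger0_norm; lra.
- by rewrite le_min; apply/andP; split; lra.
Qed.

Lemma gapP_cts : continuous gapP.
Proof. by apply: ctsN; exact: (psup_cts cKP KP0 (slope_gap_cts e20)). Qed.

Lemma gapL_cts : continuous gapL.
Proof. by apply: ctsN; exact: (psup_cts cKL KL0 (slope_gap_cts e20)). Qed.

Lemma slope_gapE w x y : 2 * eta <= y - x ->
  - slope_gap (2 * eta) (w, (x, y)) = (g w y - g w x) / (y - x) - gx w y.
Proof. by move=> h; rewrite /slope_gap /= max_r//; ring. Qed.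

Lemma gapP_le w x y : `|x| <= M -> `|y| <= M -> x <= - eta -> eta <= y ->
  gapP w <= (g w y - g w x) / (y - x) - gx w y.
Proof.
have eta0' := eta0; have etae' := etae; have eM' := eM.
move=> xM yM xe ye; rewrite -slope_gapE; last by lra.
rewrite /gapP lerN2; refine (@psup_ge _ _ _ _ _ cKP KP0 (slope_gap_cts e20) w (x, y) _).
by split; rewrite //= le_min; apply/andP; split; lra.
Qed.

Lemma gapL_le w x y : `|x| <= M -> `|y| <= M -> - eta <= x -> e <= y - x ->
  gapL w <= (g w y - g w x) / (y - x) - gx w y.
Proof.
have eta0' := eta0; have etae' := etae; have eM' := eM.
move=> xM yM xe ye; rewrite -slope_gapE; last by lra.
rewrite /gapL lerN2; refine (@psup_ge _ _ _ _ _ cKL KL0 (slope_gap_cts e20) w (x, y) _).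
by split; rewrite //= le_min; apply/andP; split; lra.
Qed.

Lemma gapP_pos w : concave (g w) -> (forall x, 0 < x -> g w x < 0) -> 0 < gapP w.
Proof.
have eta0' := eta0; have etae' := etae; have eM' := eM.
move=> cw gneg; have [[x y] [_ _ xy] [E _]] := psup_attained cKP KP0 (slope_gap_cts e20) w.
move: xy; rewrite /= le_min => /andP[h1 h2].
have yx : 0 < y - x by lra. have y0 : 0 < y by lra.
rewrite /gapP E slope_gapE ?subr_gt0; last by lra.
have /andP[t1 _] := concave_tangent cw (gxP w) y0.
rewrite ltr_pdivlMr//; rewrite (l4eq _ (lexx 0)) subr0 in t1.
have x0 : x <= 0 by lra.
rewrite (l4eq _ x0) subr0; have gn := gneg y y0.
rewrite subr0 in t1.
have gy0 : gx w y < 0 by rewrite -(pmulr_llt0 _ y0); lra.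
have : gx w y * (- x) < 0 by rewrite nmulr_rlt0//; lra.
lra.
Qed.

Lemma gapL_pos w : concave (g w) ->
  (forall x y : R, 0 <= x -> x < y -> y <= M -> gx w y < gx w x) -> 0 < gapL w.
Proof.
have eta0' := eta0; have etae' := etae; have eM' := eM.
move=> cw gdec; have [[x y] [_ yM xy] [E _]] := psup_attained cKL KL0 (slope_gap_cts e20) w.
move: xy; rewrite /= in yM *; rewrite le_min => /andP[h1 h2].
have yx : 0 < y - x by lra. have y0 : 0 < y by lra.
rewrite /gapL E slope_gapE ?subr_gt0; last by lra.
rewrite ltr_pdivlMr//.
have {}yM : y <= M by exact: le_trans (ler_norm _) yM.
pose m := Num.max 0 x.
have my : m < y by rewrite /m gt_max y0; lra.
have m0 : 0 <= m by rewrite /m le_max lexx.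
have [xi /andP[x1 x2] Exi] := MVT_point my (gxP w).
have s1 : gx w y < gx w xi by apply: gdec => //; lra.
have s2 : gx w y * (y - m) < g w y - g w m by rewrite Exi ltr_pM2r// subr_gt0.
have s3 : gx w y * (m - x) <= g w m - g w x.
  rewrite /m; case: (leP 0 x) => x0; first by rewrite !subrr mulr0.
  rewrite (l4eq _ (lexx 0)) (l4eq _ (ltW x0)) subrr.
  have /andP[t1 _] := concave_tangent cw (gxP w) y0.
  rewrite (l4eq _ (lexx 0)) !subr0 in t1.
  have gy0 : gx w y <= 0 by rewrite -(pmulr_lle0 _ y0); have := l4le w y; lra.
  by apply: mulr_le0_ge0 => //; lra.
lra.
Qed.

Lemma average_gapL : exists2 del, 0 < del & exists C, forall w s t, s <= t ->
  del * (t - s) - C <= Rint s t (fun r => Num.max 0 (gapL (sig r w))).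
Proof.
have eta0' := eta0; have etae' := etae; have eM' := eM.
pose f w := Num.max 0 (gapL w).
have cf : continuous f by apply: ctsmax; [exact: ctsC|exact: gapL_cts].
have M0 : 0 < M by lra.
have [||m erg|n [k [C [k0 hk]]]] := @ergodic_averages _ _ sig cptOm sigF (fun _ w => - f w) 0.
- by move=> n; exact: ctsN.
- by [].
- exists 0%N; have [_ hZ] := integral_lin cptOm m measurableT.
  have := hZ (- 1) f cf; rewrite scaleN1r mulN1r => ->; rewrite oppr_lt0.
  pose A : set (Borel Om) := [set w | concave (g w)].
  pose B : set (Borel Om) := [set w | forall x y : R, (0 <= x -> x < y -> y <= M -> gx w y < gx w x)%R].
  have mA : measurable A by exact: concave_measurable.
  have mB : measurable B by exact: strict_measurable.
  apply: (@ae_pos_integral _ _ cptOm m (B `&` A)) => //.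
  + exact: measurableI.
  + have mC0 : m (~` A) = 0%E by rewrite probability_setC// l5// subee.
    have mBC : measurable (B `&` ~` A) by apply: measurableI => //; exact: measurableC.
    have BC0 : m (B `&` ~` A) = 0%E.
      apply/eqP; rewrite eq_le measure_ge0 andbT -mC0; apply: le_measure; rewrite ?inE//.
      exact: measurableC.
    have BA : m (B `&` A) = m B.
      have dis : (B `&` A) `&` (B `&` ~` A) = set0 by rewrite setIACA setICr setI0.
      have E : m B = (m (B `&` A) + m (B `&` ~` A))%E.
        rewrite -[in LHS](setIT B) -(setUv A) setIUr.
        exact: (measureU m (measurableI _ _ mB mA) mBC dis).
      by rewrite E BC0 adde0.
    by rewrite BA; exact: l6.
  + by move=> w; rewrite /f le_max lexx.
  + by move=> w [Bw Aw]; rewrite /f lt_max (gapL_pos Aw Bw) orbT.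
exists (- k); first lra; exists C => w s t st; have := hk w s t st.
have -> : Rint s t (fun r => - f (sig r w)) = - Rint s t (fun r => f (sig r w)); last by rewrite /f; lra.
rewrite -mulN1r -RintZ//; last exact: (orbit_fun_cts sigF cf).
by congr Defs.Rint; apply/funext => r; rewrite mulN1r.
Qed.

Lemma average_gapP kap : 0 < kap -> exists2 th, 0 < th & exists C, forall w s t, s <= t ->
  Rint s t (fun r => Num.max 0 (1 - Num.max 0 (gapP (sig r w)) / th)) <= kap * (t - s) + C.
Proof.
move=> kap0; pose f w := Num.max 0 (gapP w).
have cf : continuous f by apply: ctsmax; [exact: ctsC|exact: gapP_cts].
have f0 w : 0 <= f w by rewrite /f le_max lexx.
pose u (n : nat) w := Num.max 0 (1 - n.+1%:R * f w).
have cu n : continuous (u n).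
  apply: ctsmax; first exact: ctsC.
  by apply: ctsB; [exact: ctsC|apply: ctsM => //; exact: ctsC].
have ud n w : u n.+1 w <= u n w.
  rewrite /u ge_max !le_max lexx/=; apply/orP; right.
  by rewrite lerD2l lerN2 ler_wpM2r// ler_nat.
have u1 n w : 0 <= u n w <= 1.
  rewrite /u le_max lexx/= ge_max ler01/= gerBl mulr_ge0//.
have [m erg|n [k [C [k0 hk]]]] := @ergodic_averages _ _ sig cptOm sigF u kap cu ud.
  pose A : set (Borel Om) := [set w | concave (g w)].
  pose B : set (Borel Om) := [set w | forall x, 0 < x -> g w x < 0].
  have mA : measurable A by exact: concave_measurable.
  have mB : measurable B by exact: neg_measurable.
  have mAB : measurable (B `&` A) by exact: measurableI.
  have mAB1 : m (B `&` A) = 1%E.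
    have cA : m (~` A) = 0%E by rewrite probability_setC// l5// subee.
    have cB : m (~` B) = 0%E by rewrite probability_setC// l4neg// subee.
    have : m (~` (B `&` A)) = 0%E.
      rewrite setCI; apply/eqP; rewrite eq_le measure_ge0 andbT.
      apply: (@le_trans _ _ (m (~` B) + m (~` A))%E); first by apply: measureU2; exact: measurableC.
      by rewrite cA cB adde0.
    rewrite probability_setC// => h.
    have fn : m (B `&` A) \is a fin_num by exact: fin_num_measure.
    move: h; rewrite -(fineK fn) -EFinB => -[h]; congr EFin; lra.
  apply: contrapT => nE.
  have ge n : kap <= Rintegral m setT (u n : Borel Om -> R).
    by rewrite leNgt; apply/negP => h; apply: nE; exists n.
  pose phi n w := 1 - u n w.
  have cphi n : continuous (phi n) by apply: ctsB => //; exact: ctsC.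
  have : (m (B `&` A) <= (1 - kap)%:E)%E.
    apply: (@integral_sup_ge _ _ cptOm m (B `&` A) phi (1 - kap) mAB cphi).
    - by move=> n w; rewrite subr_ge0; case/andP: (u1 n w).
    - by move=> n w; rewrite lerD2l lerN2.
    - move=> w [Bw Aw] e' e'0.
      have fw : 0 < f w by rewrite /f lt_max (gapP_pos Aw Bw) orbT.
      exists (Num.truncn (f w)^-1); rewrite /phi ltrD2l ltrN2 /u.
      have g1 : 0 <= (f w)^-1 by rewrite invr_ge0 ltW.
      have /andP[_ q] := truncn_itv g1.
      rewrite gt_max e'0/= -subr_gt0.
      have : 1 < (Num.truncn (f w)^-1).+1%:R * f w by rewrite -ltr_pdivrMr// mul1r.
      lra.
    - move=> n; apply: (@le_trans _ _ (Rintegral m setT (phi n : Borel Om -> R))).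
        rewrite (integral_setIC cptOm m mAB (cphi n)) lerDl; apply: integral_pos => //.
        + exact: measurableC.
        + by move=> w; rewrite subr_ge0; case/andP: (u1 n w).
      have Jl := integral_lin cptOm m measurableT.
      have c1 : continuous (fun _ : Om => 1 : R) by exact: ctsC.
      have := linB (@ctsZ R Om) Jl c1 (cu n) => ->.
      rewrite integral_cst1// probability_setT lerD2l lerN2; exact: ge.
  by rewrite mAB1 lee_fin; lra.
exists n.+1%:R^-1; first by rewrite invr_gt0 ltr0n.
exists C => w s t st; apply: le_trans (_ : k * (t - s) + C <= _); last first.
  by rewrite lerD2r ler_wpM2r ?subr_ge0// ltW.
apply: le_trans (hk w s t st); rewrite le_eqVlt; apply/orP; left; apply/eqP.
by congr Defs.Rint; apply/funext => r; rewrite /u invrK mulrC.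
Qed.

End Thresholds.

Local Ltac forget_locals := clear -cptOm sigF cc cd cg gxP cgx l2 l3 l4le l4eq l4neg l5 l6.

Lemma field_separation w lam b1 b2 e : bounded_solution (peqn (fld w) lam) b1 ->
  bounded_solution (peqn (fld w) lam) b2 -> 0 < e -> (forall t, b1 t + e <= b2 t) ->
  hypA (fldx w) b2.
Proof.
move=> H1 H2 e0 gap; have reg := regular_field cptOm sigF cc cd cg gxP cgx w.
have [N HN] := field_apriori cptOm sigF cc cd cg gxP cgx l2 l3 l4le w lam.
have B1 := HN _ _ (lexx _) H1; have B2 := HN _ _ (lexx _) H2.
have N0 : 0 <= N by exact: le_trans (B1 0).
pose M := N + e + 1; have M0 : 0 <= M by rewrite /M; lra.
have eM : e <= M by rewrite /M; lra.
have b1M t : `|b1 t| <= M by have := B1 t; rewrite /M; lra.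
have b2M t : `|b2 t| <= M by have := B2 t; rewrite /M; lra.
have [Bh HBh] := reg_b reg M.
have [Lh Lh0 HLh] := reg_lip reg M.
have [kap [k1 [k2 [k10 Hk bk]]]] := kappa_exists cptOm sigF cd l2 w.
have k20 : 0 < k2 by have /andP[x1 x2] := bk 0; lra.
have [Bd Bd0 HBd] := cts_bounded cptOm cd.
have [Bg0 HBg] := param_bound cptOm M cgx.
pose Bg := `|Bg0| + 1; have Bgp : 0 < Bg by rewrite /Bg ltr_wpDl.
pose eta := Num.min (e / 4) (e / (2 * k2 * Bg)).
have eta0 : 0 < eta by rewrite lt_min !divr_gt0// !mulr_gt0.
have eta1 : eta <= e / 4 by rewrite ge_min lexx.
have eta2 : eta * (2 * k2 * Bg) <= e by rewrite -ler_pdivlMr ?mulr_gt0// ge_min lexx orbT.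
have etae : 2 * eta <= e by lra.
pose z t := b2 t - b1 t.
have z0 t : 0 < z t by have := gap t; rewrite /z; lra.
have ze t : e <= z t by have := gap t; rewrite /z; lra.
have zM t : z t <= 2 * M.
  by have := b1M t; have := b2M t; rewrite !ler_norml /z => /andP[x1 x2] /andP[x3 x4]; lra.
have M20 : 0 < 2 * M by rewrite /M; lra.
pose Q t := ((fld w t (b2 t) + lam) - (fld w t (b1 t) + lam)) / z t.
have Hlz : forall t : R, is_derive t 1 (fun t => ln (z t)) (Q t).
  by move=> t; exact: is_derive_lnf (z0 t) (is_derive_subf (bsol_der H2 t) (bsol_der H1 t)).
have QE t : Q t = d (sig t w) + (g (sig t w) (b2 t) - g (sig t w) (b1 t)) / z t.
  by rewrite /Q /z /field_of; field; rewrite gt_eqF//; exact: z0.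
have kp t : 0 < kap t by have /andP[x1 _] := bk t; lra.
have Hlk : forall t : R, is_derive t 1 (fun t => ln (kap t)) ((d (sig t w) * kap t - 1) / kap t).
  by move=> t; exact: is_derive_lnf (kp t) (Hk t).
pose V t := ln (z t) - ln (kap t).
pose dV t := Q t - (d (sig t w) * kap t - 1) / kap t.
have HV : forall t : R, is_derive t 1 V (dV t) by move=> t; exact: is_derive_subf (Hlz t) (Hlk t).
have dVE t : dV t = (g (sig t w) (b2 t) - g (sig t w) (b1 t)) / z t + (kap t)^-1.
  by rewrite /dV QE; field; rewrite !gt_eqF.
pose VB := `|ln e| + `|ln (2 * M)| + `|ln k1| + `|ln k2|.
have lnz t : ln e <= ln (z t) <= ln (2 * M) by rewrite !ler_ln ?posrE// ze zM.
have VBb t : `|V t| <= VB.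
  have /andP[a1 a2] := lnz t.
  have /andP[x1 x2] := bk t.
  have a3 : ln k1 <= ln (kap t) by rewrite ler_ln ?posrE.
  have a4 : ln (kap t) <= ln k2 by rewrite ler_ln ?posrE.
  have := ler_norm (- ln e); have := ler_norm (ln (2 * M)).
  have := ler_norm (ln k2); have := ler_norm (- ln k1); rewrite !normrN.
  have := normr_ge0 (ln e); have := normr_ge0 (ln (2 * M)).
  have := normr_ge0 (ln k1); have := normr_ge0 (ln k2).
  move=> *; rewrite ler_norml /V /VB; apply/andP; split; lra.
have dVb t : `|dV t| <= Lh + Bd + Bd + k1^-1.
  have Qb : `|Q t| <= Lh.
    rewrite /Q normrM normfV (gtr0_norm (z0 t)) ler_pdivrMr//.
    rewrite opprD addrACA subrr addr0.
    by apply: le_trans (HLh _ _ _ (b2M t) (b1M t)) _; rewrite ler_pM2l// -/(z t) gtr0_norm.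
  have kb : (kap t)^-1 <= k1^-1 by rewrite lef_pV2 ?posrE//; case/andP: (bk t).
  have ki : 0 <= (kap t)^-1 by rewrite invr_ge0 ltW.
  have -> : dV t = Q t - d (sig t w) + (kap t)^-1 by rewrite /dV; field; rewrite gt_eqF.
  have := HBd (sig t w); have := Qb; rewrite !ler_norml => /andP[x1 x2] /andP[x3 x4].
  by apply/andP; split; lra.
pose U t := cutoff eta (b2 t) * V t.
pose b2' t := fld w t (b2 t) + lam.
pose dU t := cutoff eta (b2 t) * dV t + V t * (b2' t * dcutoff eta (b2 t)).
have HU : forall t : R, is_derive t 1 U (dU t).
  move=> t; exact: is_derive_mulf (is_derive_compf (is_derive_cutoff eta (b2 t)) (bsol_der H2 t)) (HV t).
pose KU := (Lh + Bd + Bd + k1^-1) + VB * ((`|Bh| + `|lam|) * (4 / eta)).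
have VB0 : 0 <= VB by exact: le_trans (VBb 0).
have k1i : 0 < k1^-1 by rewrite invr_gt0.
have KU0 : 0 <= KU.
  have p1 : 0 <= VB * ((`|Bh| + `|lam|) * (4 / eta)).
    by rewrite mulr_ge0// mulr_ge0 ?addr_ge0// divr_ge0// ltW.
  by rewrite /KU; lra.
have cut1 t : `|cutoff eta (b2 t)| <= 1.
  by have /andP[x1 x2] := cutoff_bound eta (b2 t); rewrite ger0_norm.
have b2'b t : `|b2' t| <= `|Bh| + `|lam|.
  apply: le_trans (ler_normD _ _) _; rewrite lerD2r.
  by have [x1 _] := HBh t _ (b2M t); apply: le_trans x1 (ler_norm _).
have dcutb t : `|dcutoff eta (b2 t)| <= 4 / eta by exact: dcutoff_bound.
have dUb t : - KU <= dU t.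
  have : `|dU t| <= KU.
    have p1 := ler_pM (normr_ge0 _) (normr_ge0 _) (cut1 t) (dVb t).
    have p2 := ler_pM (normr_ge0 _) (normr_ge0 _) (b2'b t) (dcutb t).
    have p3 := ler_pM (normr_ge0 _) (mulr_ge0 (normr_ge0 _) (normr_ge0 _)) (VBb t) p2.
    rewrite mul1r in p1; apply: le_trans (ler_normD _ _) _.
    by rewrite (normrM (cutoff _ _)) (normrM (V t)) (normrM (b2' t)); exact: lerD.
  by rewrite ler_norml => /andP[].
have Ub t : `|U t| <= VB.
  by have := ler_pM (normr_ge0 _) (normr_ge0 _) (cut1 t) (VBb t); rewrite mul1r -normrM.
pose f t := Num.max 0 (gapL M eta e (sig t w)).
have cgL := gapL_cts eta0 etae eM.
have [LM LM0 HLM] := cts_bounded cptOm cgL.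
have fLM t : 0 <= f t <= LM.
  rewrite /f le_max lexx/= ge_max (ltW LM0)/=.
  exact: le_trans (ler_norm _) (HLM _).
have [del del0 [CL hCL]] := average_gapL eta0 etae eM.
pose ga := (2 * k2)^-1; have ga0 : 0 < ga by rewrite invr_gt0 mulr_gt0.
pose K3 := LM + LM * KU / ga.
have K30 : 0 < K3 by rewrite /K3 ltr_pwDl// divr_ge0 ?(ltW ga0)// mulr_ge0// ltW.
have kk2 : 0 < del / (4 * K3) by rewrite divr_gt0// mulr_gt0.
have [th th0 [CP hCP]] := average_gapP eta0 etae eM kk2.
pose A1 := 1 + K3 / th; have A10 : 0 < A1 by rewrite /A1 ltr_wpDr// divr_ge0 ?ltW.
have A11 : 1 <= A1 by rewrite /A1 lerDl divr_ge0 ?ltW.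
have kk1 : 0 < del / (4 * A1) by rewrite divr_gt0// mulr_gt0.
have [CE hCE] := average_defect cptOm sigF cg gxP cgx l5 M0 kk1.
pose E t := concavity_defect gx M (sig t w).
pose W t := Num.max 0 (1 - Num.max 0 (gapP M eta (sig t w)) / th).
have cb2 : continuous b2 by move=> t; exact: is_derive_cont (bsol_der H2 t).
pose K := primitive (fun t => fldx w t (b2 t)).
have HK : forall t : R, is_derive t 1 K (fldx w t (b2 t)).
  by apply: is_derive_primitive; exact: (reg_cx reg).
have cE : continuous E by exact: (orbit_fun_cts sigF (defect_cts cgx M0)).
have HE := is_derive_primitive cE.
have cf : continuous f.
  by apply: (orbit_fun_cts sigF (f := fun w => Num.max 0 (gapL M eta e w))); apply: ctsmax => //; exact: ctsC.
have Hf := is_derive_primitive cf.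
have cW : continuous W.
  apply: (orbit_fun_cts sigF (f := fun w => Num.max 0 (1 - Num.max 0 (gapP M eta w) / th))).
  apply: ctsmax; first exact: ctsC.
  apply: ctsB; first exact: ctsC.
  by apply: ctsM; [apply: ctsmax; [exact: ctsC|exact: (gapP_cts eta0 etae eM)]|exact: ctsC].
have HW := is_derive_primitive cW.
have hE t x y : - M <= x -> x <= y -> y <= M -> fldx w t y - fldx w t x <= E t.
  by move=> x1 x2 x3; rewrite /field_dx opprD addrACA subrr add0r; apply: defect_ge.
have Dl t : 0 <= Q t - fldx w t (b2 t) + E t.
  have lt12 : b1 t < b2 t by have := z0 t; rewrite /z; forget_locals; lra.
  have /andP[q _] := slope_bounds (field_concave_eq cptOm sigF cc cd cg gxP cgx l2 l3 l4le l5 w)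
    hE t (b1M t) (b2M t) (ltW lt12).
  have : fldx w t (b2 t) - E t <= Q t; last by forget_locals; lra.
  by rewrite /Q ler_pdivlMr// /z; move: q; forget_locals; lra.
have E0 t : 0 <= E t.
  have := hE t 0 0; rewrite subrr; apply; rewrite ?oppr_le0//.
have QfE t : Q t - fldx w t (b2 t) = (g (sig t w) (b2 t) - g (sig t w) (b1 t)) / (b2 t - b1 t) - gx (sig t w) (b2 t).
  by rewrite QE /field_dx /z; ring.
have W0 t : 0 <= W t by rewrite /W le_max lexx.
(* Three regimes: [b2 <= eta], where [g] is nearly inactive and [U] increases; [-eta <= b1], where
   [gapL] bounds the excess from below; [b1 < -eta < eta < b2], where [gapP] does, up to [W]. *)
have key t : f t <= A1 * (Q t - fldx w t (b2 t) + E t) + (LM / ga) * dU t + K3 * W t.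
  have /andP[f0 fl] := fLM t; have D0 := Dl t; have w0 := W0 t.
  have LMga : 0 <= LM / ga by rewrite divr_ge0 ?ltW.
  have A1D : Q t - fldx w t (b2 t) + E t <= A1 * (Q t - fldx w t (b2 t) + E t).
    by rewrite -[leLHS]mul1r ler_wpM2r.
  have K3W : 0 <= K3 * W t by rewrite mulr_ge0// ltW.
  have [Ah|Ah] := leP (b2 t) eta.
    have [c1 c2] := cutoff_left eta0 Ah.
    have dUE : dU t = dV t by rewrite /dU c1 c2 !mulr0 addr0 mul1r.
    have gb1 : g (sig t w) (b1 t) = 0 by apply: l4eq; have := gap t; move: Ah eta1 e0; forget_locals; lra.
    have gb2 : - (Bg * eta) <= g (sig t w) (b2 t).
      have [b0|b0] := leP (b2 t) 0; first by rewrite l4eq// oppr_le0 mulr_ge0 ?ltW.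
      have [xi /andP[x1 x2] Ex] := MVT_point b0 (gxP (sig t w)).
      rewrite (l4eq _ (lexx 0)) !subr0 in Ex.
      have xiM : `|xi| <= M.
        have := b2M t; rewrite !ler_norml => /andP[x3 x4]; move: x1 x2 x3 x4.
        forget_locals => x1 x2 x3 x4; apply/andP; split; lra.
      have := HBg (sig t w) xi xiM; rewrite /= ler_norml => /andP[x3 x4].
      rewrite Ex; have := ler_norm Bg0 => x5.
      have x6 : - Bg <= gx (sig t w) xi by rewrite /Bg; move: x3 x5; forget_locals; lra.
      have := ler_wpM2r (ltW b0) x6.
      have : Bg * b2 t <= Bg * eta by rewrite ler_pM2l.
      forget_locals; lra.
    have dVge : ga <= dV t.
      have kb : k2^-1 <= (kap t)^-1 by rewrite lef_pV2 ?posrE//; case/andP: (bk t).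
      rewrite dVE gb1 subr0.
      have : - (ga) <= g (sig t w) (b2 t) / z t.
        rewrite ler_pdivlMr//; apply: le_trans gb2; rewrite mulNr lerN2.
        rewrite /ga [leRHS]mulrC ler_pdivlMr ?mulr_gt0//.
        by apply: le_trans (ze t); apply: le_trans eta2; forget_locals; lra.
      have k2E : k2^-1 = 2 * ga by rewrite /ga; field; rewrite gt_eqF.
      rewrite k2E in kb; move: kb; forget_locals; lra.
    have q : LM <= LM / ga * dU t.
      rewrite dUE -[leLHS](divfK (_ : ga != 0)) ?gt_eqF//; exact: ler_wpM2l.
    move: fl q D0 A1D K3W; forget_locals; lra.
  have [Bh1|Ch] := leP (- eta) (b1 t).
    have x2e : 2 * eta <= b2 t by have := gap t; move: Bh1 eta1 eta0 e0; forget_locals; lra.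
    have [c1 c2] := cutoff_right eta0 x2e.
    have dUE : dU t = 0 by rewrite /dU c1 c2 !mulr0 mul0r addr0.
    have := gapL_le eta0 etae eM (sig t w) (b1M t) (b2M t) Bh1 (_ : e <= b2 t - b1 t).
    rewrite -QfE => q; have {}q := q (ze t).
    have fD : f t <= Q t - fldx w t (b2 t) + E t.
      by rewrite /f ge_max D0/=; have := E0 t; move: q; forget_locals; lra.
    rewrite dUE mulr0; move: fD A1D K3W; forget_locals; lra.
  have := gapP_le eta0 etae eM (sig t w) (b1M t) (b2M t) (ltW Ch) (ltW Ah).
  rewrite -QfE => q.
  set P := Num.max 0 (gapP M eta (sig t w)).
  have PD : P <= Q t - fldx w t (b2 t) + E t.
    by rewrite /P ge_max D0/=; have := E0 t; move: q; forget_locals; lra.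
  have wP : 1 - P / th <= W t by rewrite /W le_max lexx orbT.
  have r1 := ler_wpM2l LMga (dUb t).
  have r2 := ler_wpM2l (ltW K30) wP.
  have r3 : K3 / th * P <= K3 / th * (Q t - fldx w t (b2 t) + E t).
    by rewrite ler_wpM2l// divr_ge0 ?ltW.
  have K3E : K3 = LM + LM / ga * KU by rewrite /K3; ring.
  have r4 : K3 * (1 - P / th) = K3 - K3 / th * P by ring.
  have r5 : A1 * (Q t - fldx w t (b2 t) + E t) = (Q t - fldx w t (b2 t) + E t) +
     K3 / th * (Q t - fldx w t (b2 t) + E t) by rewrite /A1; ring.
  have r6 : LM / ga * - KU = - (LM / ga * KU) by ring.
  move: fl D0 r1 r2 r3 K3E r4 r5 r6; forget_locals; lra.
pose Z := 2 * (A1 * VB) + A1 * CE + LM / ga * (2 * VB) + K3 * CP + CL.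
exists K, (Z / A1), (del / (2 * A1)); split => //; first by rewrite divr_gt0// mulr_gt0.
move=> s t st.
have Hv : forall r : R, is_derive r 1 (fun r => A1 * (ln (z r) - K r + primitive E r) +
    LM / ga * U r + K3 * primitive W r)
    (A1 * (Q r - fldx w r (b2 r) + E r) + (LM / ga) * dU r + K3 * W r).
  move=> r; exact: is_derive_addf (is_derive_addf (is_derive_scalef _ (is_derive_addf
    (is_derive_subf (Hlz r) (HK r)) (HE r))) (is_derive_scalef _ (HU r))) (is_derive_scalef _ (HW r)).
have := deriv_le st (fun r _ => Hf r) (fun r _ => Hv r) (fun r _ => key r).
rewrite -primitiveE// => I1.
have I2 := hCL w s t st.
have I3 := hCE w s t st; rewrite (primitiveE cE st) in I3.
have I4 := hCP w s t st; rewrite (primitiveE cW st) in I4.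
have I5 : LM / ga * (U t - U s) <= LM / ga * (2 * VB).
  apply: ler_wpM2l; first by rewrite divr_ge0// ltW.
  have := Ub t; have := Ub s; rewrite !ler_norml => /andP[x1 x2] /andP[x3 x4].
  move: x1 x2 x3 x4; forget_locals; lra.
have I6 : ln (z t) - ln (z s) <= 2 * VB.
  have /andP[x1 x2] := lnz t; have /andP[x3 x4] := lnz s.
  have := ler_norm (- ln e); have := ler_norm (ln (2 * M)); rewrite normrN.
  have := normr_ge0 (ln e); have := normr_ge0 (ln (2 * M)).
  have := normr_ge0 (ln k1); have := normr_ge0 (ln k2).
  by rewrite /VB; move: x1 x2 x3 x4; forget_locals; lra.
have J3 := ler_wpM2l (ltW A10) I3.
have J4 := ler_wpM2l (ltW K30) I4.
have J6 := ler_wpM2l (ltW A10) I6.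
have E3 : A1 * (del / (4 * A1) * (t - s) + CE) = del / 4 * (t - s) + A1 * CE.
  by field; rewrite gt_eqF.
have E4 : K3 * (del / (4 * K3) * (t - s) + CP) = del / 4 * (t - s) + K3 * CP.
  by field; rewrite gt_eqF.
rewrite -(ler_pM2l A10).
have -> : A1 * (Z / A1 - del / (2 * A1) * (t - s)) = Z - del / 2 * (t - s).
  by field; rewrite gt_eqF.
rewrite E3 in J3; rewrite E4 in J4; rewrite /Z; move: I1 I2 J3 J4 I5 J6; forget_locals; lra.
Qed.

End Separation.

(** * Orbit closures and the linear equilibrium *)

Section Hull.
Context {R : realType} {Om : pseudoPMetricType R}.
Variables (sig : R -> Om -> Om) (c d : Om -> R) (g gx : Om -> R -> R).
Hypothesis hausOm : hausdorff_space Om.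
Hypothesis cptOm : compact [set: Om].
Hypothesis sigF : is_flow sig.
Hypothesis cc : continuous c.
Hypothesis cd : continuous d.
Hypothesis cg : continuous (fun p : Om * R => g p.1 p.2).
Hypothesis gxP : forall w (x : R), is_derive x 1 (g w) (gx w x).
Hypothesis cgx : continuous (fun p : Om * R => gx p.1 p.2).

Local Notation fld := (field_of sig c d g).

Lemma closure_lift w w' (u : R -> R) N : orbit_closure sig w w' -> (forall t, `|u t| <= N) ->
  exists x, closure (range (fun t => (sig t w, u t))) (w', x).
Proof.
move=> ww' uN; pose G := closure (range (fun t => (sig t w, u t))).
pose K := [set: Om] `*` [set x : R | `|x| <= N].
have cK : compact K by apply: compact_setX => //; exact: itv_compact.
have clI : closed [set x : R | `|x| <= N].
  by apply: compact_closed; [exact: Rhausdorff|exact: itv_compact].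
have clK : closed K.
  have -> : K = snd @^-1` [set x : R | `|x| <= N] by apply/seteqP; split => [p []//|p h]; split.
  by apply: preimage_closed => // p _; exact: cvg_snd.
have GK : G `<=` K.
  apply: subset_trans clK; apply: closure_subset => _ [t _ <-]; split => //=; exact: uN.
have cG : compact G by apply: subclosed_compact cK GK; exact: closed_closure.
have cfG : compact (fst @` G).
  by apply: continuous_compact => //; apply: continuous_subspaceT => p; exact: cvg_fst.
have clf := compact_closed hausOm cfG.
have sub : range (fun t => sig t w) `<=` fst @` G.
  by move=> _ [t _ <-]; exists (sig t w, u t) => //; apply: subset_closure; exists t.
have [[w1 x] Gx /= <-] := clf _ (closure_subset sub ww').
by exists x.
Qed.

Lemma field_joint_cts : continuous (fun p : Om * (R * R) => fld p.1 p.2.1 p.2.2).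
Proof.
have [cs _] := sigF.
have c1 : continuous (fun p : Om * (R * R) => sig p.2.1 p.1).
  move=> p; apply: (continuous_comp (f := fun p : Om * (R * R) => (p.2.1, p.1))
    (g := fun q : R * Om => sig q.1 q.2)); last exact: cs.
  apply: cts_pair; last exact: cts_fst.
  by apply: (cts_comp (h := fun p : R * R => p.1)); [exact: cts_fst|exact: cts_snd].
have c2 : continuous (fun p : Om * (R * R) => p.2.2).
  by apply: (cts_comp (h := fun p : R * R => p.2)); [exact: cts_snd|exact: cts_snd].
apply: ctsD; last exact: (cts_comp (h := fun p : Om * R => g p.1 p.2)
  (k := fun p : Om * (R * R) => (sig p.2.1 p.1, p.2.2)) cg (cts_pair c1 c2)).
apply: ctsD; first exact: (cts_comp cc c1).
by apply: ctsM => //; exact: (cts_comp cd c1).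
Qed.

(* A limit in the hull of the pairs (orbit point, value of the bounded solution) is the initial
   datum of a bounded solution: Gronwall's inequality compares it with translates of [u]. *)
Lemma solvable_hull w w' lam : orbit_closure sig w w' ->
  solvable (fld w) lam -> solvable (fld w') lam.
Proof.
move=> ww' [u Hu]; have [_ [N uN]] := Hu; have Du := bsol_der Hu.
have N0 : 0 <= N by exact: le_trans (uN 0).
have [x Gx] := closure_lift ww' uN; have [_ [_ sD]] := sigF.
have reg := regular_field cptOm sigF cc cd cg gxP cgx w'.
have [v v0 Hv] := trunc_sol reg lam 0 x N0.
have [L L0 HL] := reg_lip reg N.
exists v; apply: (trunc_bsol Hv) => t; rewrite leNgt; apply/negP => vN.
pose del := `|v t| - N; have del0 : 0 < del by rewrite subr_gt0.
pose E := expR ((2 * L + 1) * `|t|).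
have E1 : 1 <= E by rewrite -expR0 ler_expR mulr_ge0// addr_ge0// mulr_ge0// ltW.
have E0 : 0 < E by exact: lt_le_trans E1.
pose e := del / (2 * E); have e0 : 0 < e by rewrite divr_gt0// mulr_gt0.
have cK : compact ([set r : R | `|r| <= `|t|] `*` [set y : R | `|y| <= N]).
  by apply: compact_setX; exact: itv_compact.
pose U := [set w1 | forall p : R * R, `|p.1| <= `|t| /\ `|p.2| <= N ->
  `|fld w1 p.1 p.2 - fld w' p.1 p.2| <= e].
have nU : nbhs w' U by exact: (near_unif cK field_joint_cts w' e0).
have [|_ [[tau _ <-] [Uw bx]]] := Gx (U `*` ball x e).
  by exists (U, ball x e) => //; split => //; exact: nbhsx_ballx.
rewrite /ball/= distrC in bx; rewrite /U/= in Uw.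
pose ut r := u (r + tau).
have Hut : forall r : R, is_derive r 1 ut (fld (sig tau w) r (ut r) + lam).
  move=> r; apply: is_derive_eq (is_derive_shiftf (Du (r + tau))) _.
  by rewrite /field_of sD.
have bnd r : `|r| <= `|t| -> `|(fld (sig tau w) r (ut r) + lam) - (fld w' r (clamp N (v r)) + lam)|
    <= L * `|ut r - v r| + e.
  move=> rt; have uNr : `|ut r| <= N by exact: uN.
  have := Uw (r, ut r) (conj rt uNr) => /= h1.
  have h2 : `|fld w' r (ut r) - fld w' r (clamp N (v r))| <= L * `|ut r - v r|.
    rewrite -{1}(clamp_id uNr).
    apply: le_trans (HL _ _ _ (clamp_bound _ N0) (clamp_bound _ N0)) _.
    by rewrite ler_pM2l// clamp_lip.
  have -> : (fld (sig tau w) r (ut r) + lam) - (fld w' r (clamp N (v r)) + lam) =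
    (fld w' r (ut r) - fld w' r (clamp N (v r))) + (fld (sig tau w) r (ut r) - fld w' r (ut r)) by ring.
  by apply: le_trans (ler_normD _ _) _; exact: lerD.
have u0 : (ut 0 - v 0) ^+ 2 <= e ^+ 2.
  rewrite v0 /ut add0r -ler_sqrt ?sqr_ge0// !sqrtr_sqr (gtr0_norm e0) ltW//.
have key : (ut t - v t) ^+ 2 <= (e ^+ 2 + e ^+ 2) * E.
  apply: (@le_trans _ _ (((ut 0 - v 0) ^+ 2 + e ^+ 2) * E)); last by rewrite ler_pM2r// lerD2r.
  have [t0|/ltW t0] := leP 0 t.
    have := @gronwall_sqr R ut v _ _ L e 0 t t0 (ltW L0) (fun r _ => Hut r) (fun r _ => Hv r) _.
    rewrite subr0 /E (ger0_norm t0) => q; apply: (q _).1 => r /andP[r0 rt].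
    by apply: bnd; rewrite !ger0_norm.
  have := @gronwall_sqr R ut v _ _ L e t 0 t0 (ltW L0) (fun r _ => Hut r) (fun r _ => Hv r) _.
  rewrite sub0r /E (ler0_norm t0) => q; apply: (q _).2 => r /andP[r0 rt].
  by apply: bnd; rewrite !ler0_norm// lerN2.
have q1 : del <= `|ut t - v t|.
  have vE : v t = ut t - (ut t - v t) by ring.
  have := ler_normB (ut t) (ut t - v t); rewrite -vE.
  by have := uN (t + tau); rewrite -/(ut t) /del; lra.
have q2 : del ^+ 2 <= (ut t - v t) ^+ 2.
  by rewrite -[leRHS]real_normK ?num_real// lerXn2r ?nnegrE// ltW.
have q3 : (e ^+ 2 + e ^+ 2) * E = del ^+ 2 / (2 * E) by rewrite /e; field; rewrite gt_eqF.
have q4 : del ^+ 2 / (2 * E) < del ^+ 2.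
  rewrite ltr_pdivrMr ?mulr_gt0// -[ltLHS]mulr1 ltr_pM2l ?exprn_gt0//; lra.
by have := le_lt_trans (le_trans q2 key); rewrite q3 => /(_ _ q4); rewrite ltxx.
Qed.

Lemma orbit_closure_refl w : orbit_closure sig w w.
Proof. by have [_ [s0 _]] := sigF; apply: subset_closure; exists 0. Qed.

Lemma lam0_hull w w' : orbit_closure sig w = orbit_closure sig w' -> lam0 (fld w) = lam0 (fld w').
Proof.
move=> E; rewrite /lam0; congr inf; apply/seteqP; split => lam /=; apply: solvable_hull.
  by rewrite E; exact: orbit_closure_refl.
by rewrite -E; exact: orbit_closure_refl.
Qed.

End Hull.

Section LinearEquilibrium.
Context {R : realType} {Om : pseudoPMetricType R}.
Variables (sig : R -> Om -> Om) (c d : Om -> R).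
Hypothesis cptOm : compact [set: Om].
Hypothesis sigF : is_flow sig.
Hypothesis cc : continuous c.
Hypothesis cd : continuous d.
Hypothesis l2 : forall m : probability (Borel Om) R, erg_measure sig m ->
  0 < Rintegral m setT (d : Borel Om -> R).

Local Notation mu := (@lebesgue_measure R).

Lemma improper_integral w (q y : R -> R) M : continuous q -> (forall t, 0 <= q t) ->
  (forall t : R, is_derive t 1 y (d (sig t w) * y t + q t)) -> (forall t, `|y t| <= M) ->
  let f := fun s => expR (- Rint 0 s (fun l => d (sig l w))) * q s in
  mu.-integrable `[0, +oo[%classic (EFin \o f) /\ Rintegral mu `[0, +oo[%classic f = - y 0.
Proof.
move=> cq q0 Hy yM f; have M0 : 0 <= M by exact: le_trans (yM 0).
have cdo : continuous (fun r => d (sig r w)) by exact: (orbit_fun_cts sigF cd).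
pose D := primitive (fun r => d (sig r w)).
have HD : forall t : R, is_derive t 1 D (d (sig t w)) by exact: is_derive_primitive.
have [gam g0 [C hC]] := average_d cptOm sigF cd l2.
pose h s := expR (- (D s - D 0)) * q s.
have fh : {in `[0, +oo[%classic, h =1 f}.
  by move=> s; rewrite inE/= in_itv/= andbT => s0; rewrite /f (primitiveE cdo s0).
have He : forall t : R, is_derive t 1 (fun s => expR (- (D s - D 0)))
    (- (d (sig t w) - 0) * expR (- (D t - D 0))).
  move=> t; exact: is_derive_expf (is_derive_oppf (is_derive_subf (HD t) (is_derive_cstf _ _))).
have ch : continuous h.
  by apply: ctsM => // t; exact: is_derive_cont (He t).
pose F s := expR (- (D s - D 0)) * y s.
have HF : forall t : R, is_derive t 1 F (h t).
  by move=> t; apply: is_derive_eq (is_derive_mulf (He t) (Hy t)) _; rewrite /h; ring.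
have F0 : F x @[x --> +oo] --> (0 : R).
  apply/cvgrPdist_le => e e0.
  have A0 : 0 <= expR C * M by rewrite mulr_ge0// expR_ge0.
  have [T T0 hT] := exp_small A0 g0 e0.
  exists T; split; first exact: num_real.
  move=> s Ts; rewrite sub0r normrN normrM ger0_norm ?expR_ge0//.
  apply: le_trans (hT s (ltW Ts)); rewrite mulrAC -expRD.
  apply: ler_pM; rewrite ?expR_ge0 ?normr_ge0 ?yM//.
  have s0 : 0 <= s by apply: le_trans (ltW T0) (ltW Ts).
  by rewrite ler_expR; have := hC w 0 s s0; rewrite (primitiveE cdo s0) -/D; lra.
have dF : forall x : R, derivable F x 1 by move=> x; exact: (@ex_derive _ _ _ _ _ _ _ (HF x)).
have h0 x : 0 <= h x by rewrite mulr_ge0// expR_ge0.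
have I := @ge0_continuous_FTC2y R h F 0 0 (fun x _ => h0 x) (continuous_subspaceT ch) F0
  (fun x _ => dF x) (cvg_at_right_filter (is_derive_cont (HF 0)))
  (fun x _ => eq_trans (derive1E _ _) (@derive_val _ _ _ _ _ _ _ (HF x))).
have F0E : F 0 = y 0 by rewrite /F subrr oppr0 expR0 mul1r.
have Eint : (\int[mu]_(x in `[0%R, +oo[) (f x)%:E = (- y 0)%:E)%E.
  transitivity (\int[mu]_(x in `[0%R, +oo[) (h x)%:E)%E.
    by apply: eq_integral => s sI; rewrite -(fh _ sI).
  by rewrite I F0E -EFinB sub0r.
split; last by rewrite /Rintegral Eint.
have mh : measurable_fun setT (h : R -> R) by exact: continuous_measurable_fun.
apply: (@eq_integrable _ _ _ mu _ _ (EFin \o h)) => //.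
- by move=> s sI; rewrite /= -(fh _ sI).
- apply/integrableP; split; first by apply/measurable_EFinP; exact: measurable_funTS mh.
  under eq_integral do rewrite /= ger0_norm//.
  by rewrite I -EFinB ltry.
Qed.

Lemma b_eq_bounded w lam b M : (forall t : R, is_derive t 1 b (c (sig t w) + d (sig t w) * b t + lam)) ->
  (forall t, `|b t| <= M) -> b_eq sig c d lam w = b 0.
Proof.
move=> Hb bM; have [B B0 HB] := cts_bounded cptOm cc; pose Q := B + `|lam|.
have Q0 : 0 <= Q by rewrite addr_ge0// ltW.
have cQ : continuous (fun _ : R => Q) by exact: ctsC.
have [b2 H2 [M2 b2M]] := linear_bounded cptOm sigF cd l2 w cQ (fun _ => le_refl `|Q|).
pose q1 t := c (sig t w) + lam + Q.
have cq1 : continuous q1.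
  by apply: ctsD => //; apply: ctsD; [exact: (orbit_fun_cts sigF cc)|exact: ctsC].
have q10 t : 0 <= q1 t.
  have := HB (sig t w); rewrite ler_norml => /andP[x1 _].
  by have := ler_norm (- lam); rewrite normrN /q1 /Q; lra.
have H1 : forall t : R, is_derive t 1 (fun t => b t + b2 t) (d (sig t w) * (b t + b2 t) + q1 t).
  by move=> t; apply: is_derive_eq (is_derive_addf (Hb t) (H2 t)) _; rewrite /q1; ring.
have b1M t : `|b t + b2 t| <= M + M2 by apply: le_trans (ler_normD _ _) _; exact: lerD.
have [i1 e1] := improper_integral cq1 q10 H1 b1M.
have [i2 e2] := improper_integral cQ (fun _ => Q0) H2 b2M.
rewrite /b_eq; transitivity (- (- (b 0 + b2 0) - (- b2 0))); last by ring.
congr (- _); rewrite -e1 -e2 -RintegralB//; apply: eq_Rintegral => s _.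
by rewrite /q1; ring.
Qed.

Lemma b_eq_orbit w lam b : (forall t : R, is_derive t 1 b (c (sig t w) + d (sig t w) * b t + lam)) ->
  (exists M, forall t, `|b t| <= M) -> forall t, b_eq sig c d lam (sig t w) = b t.
Proof.
move=> Hb [M bM] t; have [_ [_ sD]] := sigF; rewrite -[in RHS](add0r t).
apply: (@b_eq_bounded (sig t w) lam (fun r => b (r + t)) M) => // r.
by apply: is_derive_eq (is_derive_shiftf (Hb (r + t))) _; rewrite sD.
Qed.

End LinearEquilibrium.

Section Equilibrium.
Context {R : realType} {Om : pseudoPMetricType R}.
Variables (sig : R -> Om -> Om) (c d : Om -> R) (g gx : Om -> R -> R).
Hypothesis cptOm : compact [set: Om].
Hypothesis sigF : is_flow sig.
Hypothesis cc : continuous c.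
Hypothesis cd : continuous d.
Hypothesis gxP : forall w (x : R), is_derive x 1 (g w) (gx w x).
Hypothesis l2 : forall m : probability (Borel Om) R, erg_measure sig m ->
  0 < Rintegral m setT (d : Borel Om -> R).
Hypothesis l4le : forall w x, g w x <= 0.
Hypothesis l4eq : forall w (x : R), x <= 0 -> g w x = 0.
Variable w : Om.

Local Notation fld := (field_of sig c d g w).
Local Notation fldx := (field_dx sig d gx w).

Hypothesis ceq : concave_eq fld fldx.
Hypothesis sep : prop_i (peqn fld) (lam0 fld) (lower_of fld) (upper_of fld).

(* Nonpositive arguments are maximum points of [g w]. *)
Lemma gx_nonpos w1 (x : R) : x <= 0 -> gx w1 x = 0.
Proof.
move=> x0.
have D : forall t : R, derivable (g w1) t 1 by move=> t; exact: (@ex_derive _ _ _ _ _ _ _ (gxP w1 t)).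
have H := @derive1_at_max R (g w1) (x - 1) (x + 1) x _ (fun t _ => D t) _ _.
have {H} H : is_derive x 1 (g w1) 0.
  apply: H.
  - by lra.
  - by rewrite in_itv/=; apply/andP; split; lra.
  - by move=> t _; rewrite (l4eq _ x0).
by rewrite -(@derive_val _ _ _ _ _ _ _ (gxP w1 x)) (@derive_val _ _ _ _ _ _ _ H).
Qed.

Lemma equilibrium_threshold :
  let mu := inf [set l | forall t, b_eq sig c d l (sig t w) <= 0] in
  lam0 fld < mu /\ forall l, mu <= l -> forall t, lower_of fld l t = b_eq sig c d l (sig t w).
Proof.
have [b Hb [Mb HMb]] := beta_exists cptOm sigF cc cd l2 w 0.
have [kap [k1 [k2 [k10 Hk bk]]]] := kappa_exists cptOm sigF cd l2 w.
have kp t : 0 < kap t by have /andP[x1 _] := bk t; lra.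
pose bet l t := b t - l * kap t.
have Hbet l : forall t : R, is_derive t 1 (bet l) (c (sig t w) + d (sig t w) * bet l t + l).
  move=> t; apply: is_derive_eq (is_derive_subf (Hb t) (is_derive_scalef l (Hk t))) _.
  by rewrite /bet; ring.
have betB l : exists M, forall t, `|bet l t| <= M.
  exists (Mb + `|l| * k2) => t; apply: le_trans (ler_normB _ _) _; apply: lerD => //.
  rewrite normrM ler_wpM2l//; have /andP[_ x2] := bk t; by rewrite gtr0_norm.
have bE l t : b_eq sig c d l (sig t w) = bet l t by exact: (b_eq_orbit cptOm sigF cc cd l2 (Hbet l)).
set S := [set l | _]; move=> mu.
have SE l : S l <-> forall t, b t / kap t <= l.
  by split => h t; have := h t; rewrite bE /bet subr_le0 ler_pdivrMr.
have Mb0 : 0 <= Mb by exact: le_trans (HMb 0).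
have S0 : S !=set0.
  exists (Mb / k1); apply/SE => t; rewrite ler_pdivrMr// mulrAC ler_pdivlMr//.
  have /andP[x1 _] := bk t; apply: le_trans (_ : Mb * k1 <= _); last by rewrite ler_wpM2l.
  by rewrite ler_wpM2r ?(ltW k10)//; exact: le_trans (ler_norm _) (HMb t).
have up l : mu <= l -> S l.
  move=> ml; apply/SE => t; apply: le_trans ml; apply: lb_le_inf => // l' /SE; exact.
have bs l : S l -> bounded_solution (peqn fld l) (bet l).
  move=> Sl; split => // t _; apply: is_derive_eq (Hbet l t) _.
  by rewrite /peqn /field_of (l4eq _ (_ : bet l t <= 0)) ?addr0// -bE; exact: Sl.
have ge0 : lam0 fld <= mu.
  rewrite leNgt; apply/negP => lt; apply: (below_lam0 ceq lt).
  by exists (bet mu); apply: bs; exact: up.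
split.
  rewrite lt_neqAle ge0 andbT; apply/eqP => E.
  have [_ [_ [[nh _] _]]] := sep.
  have B := bs _ (up _ (lexx mu)); have B' := B; rewrite -E in B'.
  apply: (nh _ B'); right; apply/(repulsiveP (ce_reg ceq) B').
  have [gam g0 [C hC]] := average_d cptOm sigF cd l2.
  have cdo : continuous (fun r => d (sig r w)) by exact: (orbit_fun_cts sigF cd).
  exists (primitive (fun r => d (sig r w))), C, gam; split => //.
    move=> t; apply: is_derive_eq (is_derive_primitive cdo t) _.
    by rewrite /field_dx gx_nonpos ?addr0// -bE E; exact: (up _ (lexx mu)).
  by move=> s t st; rewrite -primitiveE//; exact: hC.
move=> l ml t; have B := bs _ (up _ ml); rewrite bE; apply/eqP; rewrite eq_le; apply/andP; split.
  exact: (lower_le_of ceq _ B).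
have [L _] := lower_ofP ceq (ex_intro _ _ B).
exact: (lower_ge_beta cptOm sigF cd l2 l4le _ (bsol_lower (lexx l) L) (Hbet l) (betB l)).
Qed.

End Equilibrium.
Theorem mainTheorem4 (R : realType) (Om : pseudoPMetricType R)
    (sig : R -> Om -> Om) (c d : Om -> R) (g : Om -> R -> R) :
  (* (Omega, sigma): continuous global flow on a compact metric space *)
  hausdorff_space Om -> compact [set: Om] -> is_flow sig ->
  (* (l1) *)
  continuous c -> continuous d ->
  continuous (fun p : Om * R => g p.1 p.2) ->
  (forall w x, derivable (g w) x 1) ->
  continuous (fun p : Om * R => derive1 (g p.1) p.2) ->
  (* (l2) *)
  (forall m : probability (Borel Om) R, erg_measure sig m ->
     (0 < \int[m]_w (d w)%:E)%E) ->
  (* (l3) *)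
  (forall M : R, exists X : R, forall w x, X < x -> d w * x + g w x < M) ->
  (* (l4) *)
  (forall w x, g w x <= 0) ->
  (forall w x, x <= 0 -> g w x = 0) ->
  (forall m : probability (Borel Om) R, erg_measure sig m ->
     m [set w | forall x, 0 < x -> g w x < 0] = 1%E) ->
  (* (l5) *)
  (forall m : probability (Borel Om) R, erg_measure sig m ->
     m [set w | concave (g w)] = 1%E) ->
  (* (l6) *)
  (forall j1 j2 : R, 0 <= j1 <= j2 ->
   forall m : probability (Borel Om) R, erg_measure sig m ->
     (0 < m [set w | forall x y : R, (j1 <= x -> x < y -> y <= j2 ->
                       derive1 (g w) y < derive1 (g w) x)%R])%E) ->
  forall wb : Om,
  let F := vfield sig c d g wb in
  exists (l0 : R) (r a : R -> R -> R),
  [/\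
   (* (i) *)
   prop_i F l0 r a,
   (* (ii) *)
   [/\ (forall l, l0 < l -> forall e, 0 < e -> exists del, 0 < del /\
          forall l', l0 < l' -> `|l' - l| < del ->
            forall t, `|a l' t - a l t| < e /\ `|(- r l' t) - (- r l t)| < e),
       (forall l1 l2, l0 < l1 -> l1 < l2 -> forall t,
          - r l1 t < - r l2 t /\ a l1 t < a l2 t),
       (forall t, (fun l => a l t) @ l0^'+ --> a l0 t),
       (forall t, (fun l => r l t) @ l0^'+ --> r l0 t) &
       (forall M, exists L, forall l, L < l -> forall t, M < a l t /\ M < - r l t)],
   (* (iii) *)
   (forall w, orbit_closure sig w = orbit_closure sig wb ->
      exists r' a' : R -> R -> R, prop_i (vfield sig c d g w) l0 r' a'),
   (* (iv) *)
   (let mu := inf [set l | forall t, b_eq sig c d l (sig t wb) <= 0] in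
    l0 < mu /\ forall l, mu <= l -> forall t, r l t = b_eq sig c d l (sig t wb)) &
   (* (v) *)
   [/\ (forall l, l0 <= l -> forall s x (al be : \bar R) (u : R -> R),
          is_maximal_solution (F l) s x al be u ->
          (blowup_left al be u <-> a l s < x) /\ (blowup_right al be u <-> x < r l s)),
       (forall l, l0 < l -> forall s x (al be : \bar R) (u : R -> R),
          is_maximal_solution (F l) s x al be u ->
          (conv_minus_infty al be u (r l) <-> x < a l s) /\
          (conv_plus_infty al be u (a l) <-> r l s < x)) &
       (forall l, l < l0 -> forall s x (al be : \bar R) (u : R -> R),
          is_maximal_solution (F l) s x al be u ->
          blowup_left al be u \/ blowup_right al be u)]].
Proof.
move=> hausOm cptOm sigF cc cd cg dg cgx l2 l3 l4le l4eq l4neg l5 l6 wb F.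
pose gx w x := derive1 (g w) x.
have gxP w (x : R) : is_derive x 1 (g w) (gx w x) by rewrite /gx derive1E; exact: derivableP.
have l2' (m : probability (Borel Om) R) : erg_measure sig m ->
    0 < Rintegral m setT (d : Borel Om -> R).
  by move=> erg; have := l2 m erg; rewrite (integral_fine cptOm m measurableT cd) lte_fin.
have l6' (M : R) : 0 < M -> forall m : probability (Borel Om) R, erg_measure sig m ->
    (0 < m [set w | forall x y : R, (0 <= x -> x < y -> y <= M -> gx w y < gx w x)%R])%E.
  by move=> M0; apply: l6; rewrite lexx ltW.
pose H := field_concave_eq cptOm sigF cc cd cg gxP cgx l2' l3 l4le l5.
have I w := concave_prop_i (H w)
  (@field_separation _ _ _ _ _ _ _ cptOm sigF cc cd cg gxP cgx l2' l3 l4le l4eq l4neg l5 l6' w).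
exists (lam0 (field_of sig c d g wb)), (lower_of (field_of sig c d g wb)),
  (upper_of (field_of sig c d g wb)).
split.
- exact: (I wb).
- exact: (concave_prop_ii (H wb)).
- move=> w E; exists (lower_of (field_of sig c d g w)), (upper_of (field_of sig c d g w)).
  have := I w; rewrite (lam0_hull hausOm cptOm sigF cc cd cg gxP cgx E); exact.
- exact: (equilibrium_threshold cptOm sigF cc cd gxP l2' l4le l4eq (H wb) (I wb)).
- exact: (concave_prop_v (H wb)).
Qed.
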